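(* Work in $\mathsf{ZF}$ (without the axiom of choice). For every infinite set $A$ and every natural number $n$, there is no boundedly finite-to-one function from $\mathcal{S}(A)$ to $\mathcal{S}_{\leq n}(A)$.
   Context: A function $f$ is boundedly finite-to-one if there is a natural number $k$ such that every point has at most $k$ preimages under $f$. For a set $A$, $\mathcal{S}(A)$ is the set of all permutations of $A$; for a permutation $s$ of $A$, $\mathrm{mov}(s)=\{a\in A\mid s(a)\neq a\}$; and $\mathcal{S}_{\leq n}(A)=\{s\in\mathcal{S}(A)\mid |\mathrm{mov}(s)|\leq n\}$. *)

(* Defs.v *)
(** ** First-order language of set theory *)

Record structure := Structure {
  dom :> Type;
  mem : dom -> dom -> Prop
}.

Arguments mem {_} _ _.

Notation "x ∈ y" := (mem x y) (at level 70, no associativity).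
Notation "x ∉ y" := (~ mem x y) (at level 70, no associativity).

(** Variables are de Bruijn indices: a quantifier binds index 0. *)
Inductive formula : Type :=
| Fmem : nat -> nat -> formula
| Feq : nat -> nat -> formula
| Fbot : formula
| Fimp : formula -> formula -> formula
| Fand : formula -> formula -> formula
| For : formula -> formula -> formula
| Fall : formula -> formula
| Fex : formula -> formula.

Definition scons {T : Type} (x : T) (e : nat -> T) (i : nat) : T :=
  match i with O => x | S j => e j end.

Fixpoint sat {V : structure} (e : nat -> V) (phi : formula) : Prop :=
  match phi with
  | Fmem i j => e i ∈ e j
  | Feq i j => e i = e j
  | Fbot => False
  | Fimp p q => sat e p -> sat e q
  | Fand p q => sat e p /\ sat e q
  | For p q => sat e p \/ sat e q
  | Fall p => forall x : V, sat (scons x e) p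
  | Fex p => exists x : V, sat (scons x e) p
  end.

Definition is_empty {V : structure} (x : V) : Prop := forall z : V, z ∉ x.

(** y = x ∪ {x} *)
Definition is_succ {V : structure} (x y : V) : Prop :=
  forall z : V, z ∈ y <-> z ∈ x \/ z = x.

Definition inductive_set {V : structure} (w : V) : Prop :=
  (exists x : V, is_empty x /\ x ∈ w) /\
  (forall x : V, x ∈ w -> exists y : V, is_succ x y /\ y ∈ w).

(** The structure V is a model of first-order ZF. The two schemata range over
    first-order formulas only, with the environment e supplying parameters
    from V. If they ranged over arbitrary predicates on V, choice in the
    metatheory would force every such V to satisfy the axiom of choice. *)
Record ZF (V : structure) : Prop := {
  ZF_extensionality : forall x y : V, (forall z : V, z ∈ x <-> z ∈ y) -> x = y;
  ZF_foundation : forall x : V, (exists y : V, y ∈ x) ->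
    exists y : V, y ∈ x /\ forall z : V, z ∈ y -> z ∉ x;
  ZF_pairing : forall x y : V, exists p : V,
    forall z : V, z ∈ p <-> z = x \/ z = y;
  ZF_union : forall x : V, exists u : V,
    forall z : V, z ∈ u <-> exists y : V, y ∈ x /\ z ∈ y;
  ZF_powerset : forall x : V, exists p : V,
    forall z : V, z ∈ p <-> forall t : V, t ∈ z -> t ∈ x;
  ZF_infinity : exists w : V, inductive_set w;
  ZF_separation : forall (phi : formula) (e : nat -> V) (a : V), exists b : V,
    forall x : V, x ∈ b <-> x ∈ a /\ sat (scons x e) phi;
  ZF_replacement : forall (phi : formula) (e : nat -> V) (a : V),
    (forall x y y' : V, x ∈ a ->
       sat (scons y (scons x e)) phi -> sat (scons y' (scons x e)) phi ->
       y = y') ->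
    exists b : V, forall y : V,
      y ∈ b <-> exists x : V, x ∈ a /\ sat (scons y (scons x e)) phi
}.

(** ** Set-theoretic notions, interpreted inside a structure

    All quantifiers below range over V, so numbers, functions and finiteness
    are those of V, not those of the metatheory. *)

(** A collection {x | P x} of elements of V is written as its defining
    predicate. If V satisfies ZF, those used below are sets of V: see the
    [is_set] lemmas at the end. *)
Definition collection (V : structure) : Type := V -> Prop.

Definition elements {V : structure} (X : V) : collection V := fun x => x ∈ X.

Definition is_upair {V : structure} (a b p : V) : Prop :=
  forall z : V, z ∈ p <-> z = a \/ z = b.

(** p is the Kuratowski pair {{a}, {a, b}} *)
Definition is_opair {V : structure} (a b p : V) : Prop :=
  exists u v : V, is_upair a a u /\ is_upair a b v /\ is_upair u v p.

(** f(x) = y *)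
Definition maps {V : structure} (f x y : V) : Prop :=
  exists p : V, is_opair x y p /\ p ∈ f.

Definition is_function {V : structure} (f : V) (X Y : collection V) : Prop :=
  (forall p : V, p ∈ f -> exists x y : V, X x /\ Y y /\ is_opair x y p) /\
  (forall x : V, X x -> exists! y : V, maps f x y).

Definition is_injection {V : structure} (f : V) (X Y : collection V) : Prop :=
  is_function f X Y /\
  forall x x' y : V, maps f x y -> maps f x' y -> x = x'.

Definition is_bijection {V : structure} (f : V) (X Y : collection V) : Prop :=
  is_injection f X Y /\ forall y : V, Y y -> exists x : V, maps f x y.

(** n belongs to ω, the least inductive set. *)
Definition is_nat {V : structure} (n : V) : Prop :=
  forall w : V, inductive_set w -> n ∈ w.

(** |X| ≤ n, with n a von Neumann natural number *)
Definition card_le {V : structure} (X : collection V) (n : V) : Prop :=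
  exists g : V, is_injection g X (elements n).

Definition is_finite {V : structure} (A : V) : Prop :=
  exists n g : V, is_nat n /\ is_bijection g (elements A) (elements n).

Definition is_infinite {V : structure} (A : V) : Prop := ~ is_finite A.

Definition permutations {V : structure} (A : V) : collection V :=
  fun s => is_bijection s (elements A) (elements A).

Definition mov {V : structure} (A s : V) : collection V :=
  fun a => a ∈ A /\ ~ maps s a a.

Definition permutations_le {V : structure} (n A : V) : collection V :=
  fun s => permutations A s /\ card_le (mov A s) n.

Definition boundedly_finite_to_one {V : structure} (f : V) : Prop :=
  exists k : V, is_nat k /\ forall y : V, card_le (fun x => maps f x y) k.

(** ** The collections of the statement are sets *)

Definition is_set {V : structure} (X : collection V) : Prop :=
  exists b : V, forall x : V, x ∈ b <-> X x.

Lemma permutations_bound (V : structure) (hZF : ZF V) (A : V) :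
  exists B : V, forall s : V, permutations A s -> s ∈ B.
Proof.
  destruct (ZF_powerset V hZF A) as [P1 h1].
  destruct (ZF_powerset V hZF P1) as [P2 h2].
  destruct (ZF_powerset V hZF P2) as [P3 h3].
  exists P3; intros s [[[hs _] _] _].
  apply h3; intros p hp.
  destruct (hs p hp) as (x & y & hx & hy & u & v & hu & hv & huv).
  unfold elements in hx, hy.
  apply h2; intros q hq; apply h1; intros t ht.
  apply huv in hq; destruct hq as [-> | ->].
  - apply hu in ht; destruct ht; subst; assumption.
  - apply hv in ht; destruct ht; subst; assumption.
Qed.

Definition Fiff (p q : formula) := Fand (Fimp p q) (Fimp q p).
Definition Fnot (p : formula) := Fimp p Fbot.
Definition Fupair (a b p : nat) :=
  Fall (Fiff (Fmem 0 (S p)) (For (Feq 0 (S a)) (Feq 0 (S b)))).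
Definition Fopair (a b p : nat) :=
  Fex (Fex (Fand (Fupair (2 + a) (2 + a) 1)
           (Fand (Fupair (2 + a) (2 + b) 0) (Fupair 1 0 (2 + p))))).
Definition Fmaps (f x y : nat) :=
  Fex (Fand (Fopair (S x) (S y) 0) (Fmem 0 (S f))).

(** [X d x] says that the variable x lies in X, under d extra binders. *)
Definition Ffunction (f : nat) (X Y : nat -> nat -> formula) :=
  Fand
    (Fall (Fimp (Fmem 0 (S f))
       (Fex (Fex (Fand (X 3 1) (Fand (Y 3 0) (Fopair 1 0 2)))))))
    (Fall (Fimp (X 1 0)
       (Fex (Fand (Fmaps (2 + f) 1 0)
                  (Fall (Fimp (Fmaps (3 + f) 2 0) (Feq 1 0))))))).
Definition Finjection (f : nat) (X Y : nat -> nat -> formula) :=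
  Fand (Ffunction f X Y)
    (Fall (Fall (Fall (Fimp (Fmaps (3 + f) 2 0)
       (Fimp (Fmaps (3 + f) 1 0) (Feq 2 1)))))).
Definition Felements (A d x : nat) := Fmem x (d + A).
Definition Fpermutations (A s : nat) :=
  Fand (Finjection s (Felements A) (Felements A))
    (Fall (Fimp (Felements A 1 0) (Fex (Fmaps (2 + s) 0 1)))).
Definition Fmov (A s d a : nat) :=
  Fand (Fmem a (d + A)) (Fnot (Fmaps (d + s) a a)).
Definition Fpermutations_le (n A s : nat) :=
  Fand (Fpermutations A s)
    (Fex (Finjection 0 (Fmov (S A) (S s)) (Felements (S n)))).

Lemma permutations_form_a_set (V : structure) (hZF : ZF V) (A : V) :
  is_set (permutations A).
Proof.
  destruct (permutations_bound V hZF A) as [B hB].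
  destruct (ZF_separation V hZF (Fpermutations 1 0) (fun _ => A) B) as [b hb].
  exists b; intros s; split.
  - intros hs; apply hb in hs; exact (proj2 hs).
  - intros hs; apply hb; exact (conj (hB s hs) hs).
Qed.

Lemma permutations_le_form_a_set (V : structure) (hZF : ZF V) (n A : V) :
  is_set (permutations_le n A).
Proof.
  destruct (permutations_bound V hZF A) as [B hB].
  destruct (ZF_separation V hZF (Fpermutations_le 2 1 0)
              (scons A (fun _ => n)) B) as [b hb].
  exists b; intros s; split.
  - intros hs; apply hb in hs; exact (proj2 hs).
  - intros hs; apply hb; exact (conj (hB s (proj1 hs)) hs).
Qed.

Lemma mov_is_a_set (V : structure) (hZF : ZF V) (A s : V) : is_set (mov A s).
Proof.
  destruct (ZF_separation V hZF (Fnot (Fmaps 1 0 0)) (fun _ => s) A) as [b hb].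
  exists b; exact hb.
Qed.

Lemma preimage_is_a_set (V : structure) (hZF : ZF V) (f y : V) :
  is_set (fun x => maps f x y).
Proof.
  destruct (ZF_union V hZF f) as [U1 h1].
  destruct (ZF_union V hZF U1) as [U2 h2].
  destruct (ZF_separation V hZF (Fmaps 1 0 2) (scons f (fun _ => y)) U2)
    as [b hb].
  exists b; intros x; split.
  - intros hx; apply hb in hx; exact (proj2 hx).
  - intros hx; apply hb; split; [| exact hx].
    destruct hx as (p & (u & v & hu & hv & huv) & hp).
    apply h2; exists u; split; [apply h1; exists p; split |].
    + exact hp.
    + apply huv; left; reflexivity.
    + apply hu; left; reflexivity.
Qed.

(* Main.v *)
(** Let [f] map the permutations of [A] to permutations moving at most [n] points, with fibers
    of size at most [k]. We construct by transfinite recursion permutations [p xi], moving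
    boundedly many points, such that [p xi] moves a point that no earlier [p eta] moves. The
    indices are the finite sets of ordinals, ordered by their largest difference, so that the
    ordinals inject into the set of permutations of [A]: a contradiction.

    At stage [xi], let [F] be the set of earlier indices and give each moved point the rank of
    the first [p eta] moving it. Following each point along the permutation of its rank yields
    a forest of points, and from it five permutations [w_i] of [A] labelled by elements of [F],
    every element of [F] being used as a label. Restricting [w_i] to the labels in [Z] gives a
    permutation [t_i Z] for each subset [Z] of [F], and [Z] is determined by the [t_i Z]. If
    some [f (t_i Z)] moves a new point, it can serve as [p xi]; it remains to choose [Z]
    canonically. If [F] is finite and large, counting shows that some [Z] works, since the
    permutations of bounded support inside the old points are too few, and one takes the least
    such [Z]. If [F] is infinite, an injection of (finite subsets of the old letters) x omega
    into [F], which the choice of the index set provides uniformly, allows one to diagonalize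
    against all unsuccessful [Z]. The construction starts with finitely many transpositions. *)

(* Two constraints shape the proof. The schemata of [ZF] cover first-order formulas only, so every
   separation, replacement, induction and recursion comes with a proof of definability; the epsilon
   operator of the metatheory serves to name values and makes no choice inside [V]. Moreover each
   stage must be determined by [xi] and the earlier stages. The order of the indices serves this: if
   [m] is the largest element of [xi], the indices before [xi] include all finite subsets of [m] and
   are subsets of [m + 1], so the injection needed for the diagonalization is an explicit formula.
   The number five comes from repairing a lack of injectivity. A rank-lowering step may send many
   points to one, so points with a common image are linked in order of rank, and the last one is
   linked to the image. This gives two rank-lowering injections; each splits into two matchings,
   hence four involutions. The points of a rank whose permutation never lowers it provide the fifth
   permutation. *)
From Stdlib Require Import Classical ClassicalEpsilon Lia.
From Corelib Require Import ssreflect.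
Require Import Defs.

Existing Class ZF.

(** * Definable predicates and terms *)

Definition tl {T : Type} (e : nat -> T) : nat -> T := fun i => e (S i).

Fixpoint mix {T : Type} (e c : nat -> T) (i : nat) : T :=
  match i with
  | O => e O
  | S O => c O
  | S (S j) => mix (tl e) (tl c) j
  end.

Fixpoint dbl (i : nat) : nat := match i with O => O | S j => S (S (dbl j)) end.

Lemma mix_even {T : Type} (e c : nat -> T) i : mix e c (dbl i) = e i.
Proof. elim: i e c => [|i IH] e c //=; exact: IH. Qed.

Lemma mix_odd {T : Type} (e c : nat -> T) i : mix e c (S (dbl i)) = c i.
Proof. elim: i e c => [|i IH] e c //=; exact: (IH (tl e) (tl c)). Qed.

Lemma nat_parity_ind (P : nat -> Prop) :
  P 0 -> P 1 -> (forall i, P i -> P (S (S i))) -> forall i, P i.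
Proof. move=> h0 h1 h2 i; suff [] : P i /\ P (S i) by []; elim: i => [|i []]; auto. Qed.

Lemma mix_ext {T : Type} (e c e' c' : nat -> T) :
  (forall i, e i = e' i) -> (forall i, c i = c' i) ->
  forall i, mix e c i = mix e' c' i.
Proof.
  move=> he hc i; elim/nat_parity_ind: i e c e' c' he hc => [|| i IH] e c e' c' he hc //=.
  by apply: IH => j; rewrite /tl.
Qed.

Lemma mix_map {T U : Type} (g : T -> U) (e c : nat -> T) i :
  g (mix e c i) = mix (fun j => g (e j)) (fun j => g (c j)) i.
Proof. elim/nat_parity_ind: i e c => [|| i IH] e c //=; exact: IH. Qed.

Definition up (r : nat -> nat) (i : nat) : nat :=
  match i with O => O | S j => S (r j) end.

Fixpoint ren (r : nat -> nat) (phi : formula) : formula :=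
  match phi with
  | Fmem i j => Fmem (r i) (r j)
  | Feq i j => Feq (r i) (r j)
  | Fbot => Fbot
  | Fimp p q => Fimp (ren r p) (ren r q)
  | Fand p q => Fand (ren r p) (ren r q)
  | For p q => For (ren r p) (ren r q)
  | Fall p => Fall (ren (up r) p)
  | Fex p => Fex (ren (up r) p)
  end.

Lemma sat_ext {V : structure} (phi : formula) (e e' : nat -> V) :
  (forall i, e i = e' i) -> sat e phi <-> sat e' phi.
Proof.
  elim: phi e e' => [i j|i j||p IHp q IHq|p IHp q IHq|p IHp q IHq|p IHp|p IHp] e e' h /=;
    rewrite ?h //.
  1-3: by rewrite (IHp _ _ h) (IHq _ _ h).
  all: have h' x i : scons x e i = scons x e' i by case: i => /=.
  - by split=> H x; apply/(IHp _ _ (h' x)).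
  - by split=> -[x H]; exists x; apply/(IHp _ _ (h' x)).
Qed.

Lemma sat_ren {V : structure} (phi : formula) (r : nat -> nat) (e : nat -> V) :
  sat e (ren r phi) <-> sat (fun i => e (r i)) phi.
Proof.
  elim: phi r e => [i j|i j||p IHp q IHq|p IHp q IHq|p IHp q IHq|p IHp|p IHp] r e //=.
  1-3: by rewrite IHp IHq.
  all: have h' x i : scons x e (up r i) = scons x (fun i => e (r i)) i by case: i.
  - by split=> H x; move: (H x); rewrite IHp (sat_ext _ _ _ (h' x)).
  - by split=> -[x H]; exists x; move: H; rewrite IHp (sat_ext _ _ _ (h' x)).
Qed.

(** Even variables of the formula carry the arguments, odd ones the parameters. *)
Definition Def {V : structure} (P : (nat -> V) -> Prop) : Prop :=
  exists phi c, forall e, sat (mix e c) phi <-> P e.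

Definition DefT {V : structure} (t : (nat -> V) -> V) : Prop :=
  Def (fun e => e 0 = t (tl e)).

Section Definability.
Context {V : structure}.
Implicit Types (P Q : (nat -> V) -> Prop) (t u v w : (nat -> V) -> V).

Lemma def_ext P Q : (forall e, P e <-> Q e) -> Def P -> Def Q.
Proof. by move=> h [phi [c H]]; exists phi, c => e; rewrite H h. Qed.

(** The two parameter sequences are interleaved once more, into [mix c d]. Since environments are
    infinite sequences, no bound on the free variables is needed. *)
Lemma def_merge P Q : Def P -> Def Q ->
  exists phi psi c, (forall e, sat (mix e c) phi <-> P e) /\
                    (forall e, sat (mix e c) psi <-> Q e).
Proof.
  move=> [phi [c H]] [psi [d K]].
  exists (ren (mix dbl (fun i => S (dbl (dbl i)))) phi),
         (ren (mix dbl (fun i => S (dbl (S (dbl i))))) psi), (mix c d).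
  split=> e; rewrite sat_ren; [rewrite -H | rewrite -K]; apply: sat_ext => i;
    rewrite (mix_map (mix e (mix c d))); apply: mix_ext => j;
    by rewrite ?mix_odd ?mix_even ?mix_odd.
Qed.

Lemma def_and P Q : Def P -> Def Q -> Def (fun e => P e /\ Q e).
Proof.
  move=> hP hQ; have [phi [psi [c [H K]]]] := def_merge _ _ hP hQ.
  by exists (Fand phi psi), c => e /=; rewrite H K.
Qed.

Lemma def_or P Q : Def P -> Def Q -> Def (fun e => P e \/ Q e).
Proof.
  move=> hP hQ; have [phi [psi [c [H K]]]] := def_merge _ _ hP hQ.
  by exists (For phi psi), c => e /=; rewrite H K.
Qed.

Lemma def_imp P Q : Def P -> Def Q -> Def (fun e => P e -> Q e).
Proof.
  move=> hP hQ; have [phi [psi [c [H K]]]] := def_merge _ _ hP hQ.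
  by exists (Fimp phi psi), c => e /=; rewrite H K.
Qed.

(** The truth of [C] is decided once, in the metatheory, so [C] may be any proposition independent
    of the environment. [ZF] supplies an element to fill the parameters. *)
Lemma def_const {hZF : ZF V} (C : Prop) : Def (fun _ : nat -> V => C).
Proof.
  have [w _] := ZF_infinity V hZF.
  case: (classic C) => hC.
  - by exists (Fimp Fbot Fbot), (fun _ => w) => e /=; tauto.
  - by exists Fbot, (fun _ => w) => e /=; tauto.
Qed.

Lemma def_not {hZF : ZF V} P : Def P -> Def (fun e => ~ P e).
Proof. move=> hP; apply: def_imp => //; exact: def_const. Qed.

Lemma def_iff P Q : Def P -> Def Q -> Def (fun e => P e <-> Q e).
Proof. by move=> hP hQ; apply: def_and; apply: def_imp. Qed.

(** A bound variable enters in front of the interleaved sequence, whereas it should enter in front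
    of the arguments alone; [rq] reindexes accordingly. *)
Let rq := mix (up dbl) (fun i => S (S (dbl i))).

Lemma rqE (e c : nat -> V) (x : V) i :
  scons x (mix e c) (rq i) = mix (scons x e) c i.
Proof.
  rewrite /rq (mix_map (scons x (mix e c))); apply: mix_ext => j.
  - case: j => [|j] //=; exact: mix_even.
  - exact: (mix_odd e c).
Qed.

Lemma def_all (P : (nat -> V) -> V -> Prop) :
  Def (fun e => P (tl e) (e 0)) -> Def (fun e => forall x, P e x).
Proof.
  move=> [phi [c H]]; exists (Fall (ren rq phi)), c => e /=.
  by split=> K x; move: (K x); rewrite sat_ren (sat_ext _ _ _ (rqE e c x)) H.
Qed.

Lemma def_ex (P : (nat -> V) -> V -> Prop) :
  Def (fun e => P (tl e) (e 0)) -> Def (fun e => exists x, P e x).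
Proof.
  move=> [phi [c H]]; exists (Fex (ren rq phi)), c => e /=.
  by split=> -[x K]; exists x; move: K; rewrite sat_ren (sat_ext _ _ _ (rqE e c x)) H.
Qed.

Lemma def_ren P (r : nat -> nat) : Def P -> Def (fun e => P (fun i => e (r i))).
Proof.
  move=> [phi [c H]]; exists (ren (mix (fun i => dbl (r i)) (fun i => S (dbl i))) phi), c => e.
  rewrite sat_ren -H; apply: sat_ext => i; rewrite (mix_map (mix e c)).
  by apply: mix_ext => j; [apply: mix_even | apply: mix_odd].
Qed.

Lemma defT_weak t : DefT t -> DefT (fun e => t (tl e)).
Proof. exact: (def_ren _ (up S)). Qed.

Lemma def_subst P t : Def P -> DefT t -> Def (fun e => P (scons (t e) e)).
Proof.
  move=> hP ht.
  have /def_ext : Def (fun e => exists x, x = t e /\ P (scons x e)).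
    apply: (def_ex (fun e x => x = t e /\ P (scons x e))); apply: def_and => //.
    (* That [P] respects pointwise equality of environments is obtained by passing through its
       formula, without functional extensionality. *)
    apply: (def_ext P) => // e; move: hP => [phi [c H]]; rewrite -2!H.
    by apply: sat_ext => i; apply: mix_ext => // -[].
  by apply=> e; split=> [[x [-> ]]|h] //; exists (t e).
Qed.

Lemma defT_const (c : V) : DefT (fun _ => c).
Proof. by exists (Feq 0 1), (fun _ => c) => e. Qed.

Lemma defT_var {hZF : ZF V} i : DefT (fun e : nat -> V => e i).
Proof.
  have [w _] := ZF_infinity V hZF.
  exists (Feq 0 (dbl (S i))), (fun _ => w) => e; rewrite /sat mix_even //.
Qed.

(** Definability by arity: named predicates and functions receive instances, and [dsolve] deals with
    the connectives and quantifiers between them. *)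
Class D1 (R : V -> Prop) : Prop := d1 : Def (fun e => R (e 0)).
Class D2 (R : V -> V -> Prop) : Prop := d2 : Def (fun e => R (e 0) (e 1)).
Class D3 (R : V -> V -> V -> Prop) : Prop := d3 : Def (fun e => R (e 0) (e 1) (e 2)).
Class D4 (R : V -> V -> V -> V -> Prop) : Prop :=
  d4 : Def (fun e => R (e 0) (e 1) (e 2) (e 3)).
Class D5 (R : V -> V -> V -> V -> V -> Prop) : Prop :=
  d5 : Def (fun e => R (e 0) (e 1) (e 2) (e 3) (e 4)).
Class D6 (R : V -> V -> V -> V -> V -> V -> Prop) : Prop :=
  d6 : Def (fun e => R (e 0) (e 1) (e 2) (e 3) (e 4) (e 5)).
Class T1 (f : V -> V) : Prop := t1 : DefT (fun e => f (e 0)).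
Class T2 (f : V -> V -> V) : Prop := t2 : DefT (fun e => f (e 0) (e 1)).
Class T3 (f : V -> V -> V -> V) : Prop := t3 : DefT (fun e => f (e 0) (e 1) (e 2)).
Class T4 (f : V -> V -> V -> V -> V) : Prop :=
  t4 : DefT (fun e => f (e 0) (e 1) (e 2) (e 3)).

Lemma app1 R t : D1 R -> DefT t -> Def (fun e => R (t e)).
Proof. exact: def_subst. Qed.

Lemma app2 R t u : D2 R -> DefT t -> DefT u -> Def (fun e => R (t e) (u e)).
Proof.
  move=> hR ht hu.
  have h1 := def_subst _ _ hR (defT_weak _ ht); exact: (def_subst _ _ h1 hu).
Qed.

Lemma app3 R t u v : D3 R -> DefT t -> DefT u -> DefT v ->
  Def (fun e => R (t e) (u e) (v e)).
Proof.
  move=> hR ht hu hv.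
  have h1 := def_subst _ _ hR (defT_weak _ (defT_weak _ ht)).
  have h2 := def_subst _ _ h1 (defT_weak _ hu); exact: (def_subst _ _ h2 hv).
Qed.

Lemma app4 R t u v w : D4 R -> DefT t -> DefT u -> DefT v -> DefT w ->
  Def (fun e => R (t e) (u e) (v e) (w e)).
Proof.
  move=> hR ht hu hv hw.
  have h1 := def_subst _ _ hR (defT_weak _ (defT_weak _ (defT_weak _ ht))).
  have h2 := def_subst _ _ h1 (defT_weak _ (defT_weak _ hu)).
  have h3 := def_subst _ _ h2 (defT_weak _ hv); exact: (def_subst _ _ h3 hw).
Qed.

Lemma app5 R t u v w x : D5 R -> DefT t -> DefT u -> DefT v -> DefT w -> DefT x ->
  Def (fun e => R (t e) (u e) (v e) (w e) (x e)).
Proof.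
  move=> hR ht hu hv hw hx.
  have h1 := def_subst _ _ hR (defT_weak _ (defT_weak _ (defT_weak _ (defT_weak _ ht)))).
  have h2 := def_subst _ _ h1 (defT_weak _ (defT_weak _ (defT_weak _ hu))).
  have h3 := def_subst _ _ h2 (defT_weak _ (defT_weak _ hv)).
  have h4 := def_subst _ _ h3 (defT_weak _ hw); exact: (def_subst _ _ h4 hx).
Qed.

Lemma app6 R t u v w x y :
  D6 R -> DefT t -> DefT u -> DefT v -> DefT w -> DefT x -> DefT y ->
  Def (fun e => R (t e) (u e) (v e) (w e) (x e) (y e)).
Proof.
  move=> hR ht hu hv hw hx hy.
  have h1 := def_subst _ _ hR
    (defT_weak _ (defT_weak _ (defT_weak _ (defT_weak _ (defT_weak _ ht))))).
  have h2 := def_subst _ _ h1 (defT_weak _ (defT_weak _ (defT_weak _ (defT_weak _ hu)))).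
  have h3 := def_subst _ _ h2 (defT_weak _ (defT_weak _ (defT_weak _ hv))).
  have h4 := def_subst _ _ h3 (defT_weak _ (defT_weak _ hw)).
  have h5 := def_subst _ _ h4 (defT_weak _ hx); exact: (def_subst _ _ h5 hy).
Qed.

#[export] Instance D2_mem {hZF : ZF V} : D2 (@mem V).
Proof.
  have [w _] := ZF_infinity V hZF.
  by exists (Fmem 0 2), (fun _ => w) => e.
Qed.

#[export] Instance D2_eq {hZF : ZF V} : D2 (@eq V).
Proof.
  have [w _] := ZF_infinity V hZF.
  by exists (Feq 0 2), (fun _ => w) => e.
Qed.

Context {hZF : ZF V}.

Lemma appT1 f t : T1 f -> DefT t -> DefT (fun e => f (t e)).
Proof.
  move=> hf ht; apply: (app2 (fun a b => a = f b)); [|exact: defT_var|exact: defT_weak].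
  exact: hf.
Qed.

Lemma appT2 f t u : T2 f -> DefT t -> DefT u -> DefT (fun e => f (t e) (u e)).
Proof.
  move=> hf ht hu; apply: (app3 (fun a b c => a = f b c)); first exact: hf.
  - exact: defT_var.
  - exact: defT_weak.
  - exact: defT_weak.
Qed.

Lemma appT3 f t u v : T3 f -> DefT t -> DefT u -> DefT v ->
  DefT (fun e => f (t e) (u e) (v e)).
Proof.
  move=> hf ht hu hv; apply: (app4 (fun a b c d => a = f b c d)); first exact: hf.
  - exact: defT_var.
  - exact: defT_weak.
  - exact: defT_weak.
  - exact: defT_weak.
Qed.

Lemma appT4 f t u v w : T4 f -> DefT t -> DefT u -> DefT v -> DefT w ->
  DefT (fun e => f (t e) (u e) (v e) (w e)).
Proof.
  move=> hf ht hu hv hw; apply: (app5 (fun a b c d x => a = f b c d x)); first exact: hf.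
  - exact: defT_var.
  - exact: defT_weak.
  - exact: defT_weak.
  - exact: defT_weak.
  - exact: defT_weak.
Qed.

Lemma ext (x y : V) : (forall z, z ∈ x <-> z ∈ y) -> x = y.
Proof. exact: ZF_extensionality. Qed.

Lemma sep_ex (a : V) (P : V -> Prop) {hP : D1 P} :
  exists b, forall x, x ∈ b <-> x ∈ a /\ P x.
Proof.
  case: hP => [phi [c H]].
  have [b hb] := ZF_separation V hZF phi (tl (mix (fun _ => a) c)) a.
  exists b => x; rewrite hb -(H (scons x (fun _ => a))).
  have h i : scons x (tl (mix (fun _ => a) c)) i = mix (scons x (fun _ => a)) c i
    by move: i => [|[|i]].
  by rewrite (sat_ext _ _ _ h).
Qed.

Lemma repl_ex (a : V) (R : V -> V -> Prop) {hR : D2 R} :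
  (forall x y y', x ∈ a -> R x y -> R x y' -> y = y') ->
  exists b, forall y, y ∈ b <-> exists x, x ∈ a /\ R x y.
Proof.
  move=> hf.
  have [phi [c H]] : D2 (fun y x => R x y)
    by exact: (app2 R (fun e => e 1) (fun e => e 0) hR (defT_var 1) (defT_var 0)).
  pose e0 := tl (tl (mix (fun _ => a) c)).
  (* Replacement puts [x] at index 1, where the interleaving has its first parameter; hence the
     exchange of the variables 1 and 2. *)
  have h x y : sat (scons y (scons x (scons (c 0) (tl e0))))
      (ren (fun i => match i with 1 => 2 | 2 => 1 | _ => i end) phi) <-> R x y.
    rewrite sat_ren -(H (scons y (scons x (fun _ => a)))).
    by apply: sat_ext => -[|[|[|[|i]]]].
  have hf' x y y' : x ∈ a ->
      sat (scons y (scons x (scons (c 0) (tl e0))))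
        (ren (fun i => match i with 1 => 2 | 2 => 1 | _ => i end) phi) ->
      sat (scons y' (scons x (scons (c 0) (tl e0))))
        (ren (fun i => match i with 1 => 2 | 2 => 1 | _ => i end) phi) -> y = y'.
    rewrite !h; exact: hf.
  have [b hb] := ZF_replacement V hZF _ _ _ hf'.
  by exists b => y; rewrite hb; split=> -[x [hx hy]]; exists x; move: hy; rewrite h.
Qed.

Lemma empty_ex : exists x : V, is_empty x.
Proof. by have [w [[x [h _]] _]] := ZF_infinity V hZF; exists x. Qed.

(** Definite description, with the empty set as junk value. *)
Lemma the_sig (P : V -> Prop) :
  { y | unique P y \/ (~ (exists! y, P y) /\ is_empty y) }.
Proof.
  apply: constructive_indefinite_description.
  case: (classic (exists! y, P y)) => [[y h]|h]; first by exists y; left.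
  by have [x hx] := empty_ex; exists x; right.
Qed.

Definition the (P : V -> Prop) : V := proj1_sig (the_sig P).

Lemma the_def (P : V -> Prop) :
  unique P (the P) \/ (~ (exists! y, P y) /\ is_empty (the P)).
Proof. exact: proj2_sig (the_sig P). Qed.

Lemma the_spec (P : V -> Prop) : (exists! y, P y) -> P (the P).
Proof. by case: (the_def P) => [[]|[h _ /h]]. Qed.

Lemma the_eq (P : V -> Prop) y : P y -> (forall z, P z -> z = y) -> the P = y.
Proof.
  move=> hy hu; apply: (hu); apply: the_spec; exists y; split=> // z hz.
  by rewrite (hu z hz).
Qed.

(** The junk case is first-order as well: without a unique solution the value is the empty set, so
    the graph of [the] is given by a formula. A value picked arbitrarily by epsilon would not allow
    this. *)
Lemma defT_the (P : (nat -> V) -> V -> Prop) :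
  Def (fun e => P (tl e) (e 0)) -> DefT (fun e => the (P e)).
Proof.
  move=> hP; rewrite /DefT.
  have hP1 : Def (fun e => P (tl (tl e)) (e 0)).
    exact: (def_ren _ (fun i => match i with 0 => 0 | S j => S (S j) end) hP).
  have hq : Def (fun e : nat -> V => e 1 = e 0)
    by apply: (app2 (@eq V)); apply: defT_var.
  have hU : Def (fun e => unique (P (tl e)) (e 0)).
    apply: def_and => //.
    apply: (def_all (fun e y => P (tl e) y -> e 0 = y)); exact: def_imp.
  have hU1 : Def (fun e => unique (P (tl (tl e))) (e 0)).
    exact: (def_ren _ (fun i => match i with 0 => 0 | S j => S (S j) end) hU).
  apply: (def_ext (fun e => unique (P (tl e)) (e 0) \/
      (~ (exists! y, P (tl e) y) /\ forall z, ~ z ∈ e 0))).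
  { move=> e; case: (the_def (P (tl e))) => [[h1 h2]|[h1 h2]]; split.
    - by case=> [[h3 h4]|[[]]]; [rewrite (h2 _ h3) | exists (the (P (tl e)))].
    - by move=> ->; left.
    - case=> [h3|[_ h3]]; first by case: h1; exists (e 0).
      by apply: ext => z; split=> [/h3|/h2].
    - by move=> ->; right. }
  apply: def_or => //; apply: def_and.
  - by apply: def_not; apply: (def_ex (fun e y => unique (P (tl e)) y)).
  - apply: (def_all (fun e z => ~ z ∈ e 0)); apply: def_not.
    by apply: (app2 (@mem V)); apply: defT_var.
Qed.

Definition sep (a : V) (P : V -> Prop) : V :=
  the (fun b => forall x, x ∈ b <-> x ∈ a /\ P x).

Lemma in_sep (a : V) (P : V -> Prop) {hP : D1 P} : forall x, x ∈ sep a P <-> x ∈ a /\ P x.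
Proof.
  apply: (the_spec (fun b => forall x, x ∈ b <-> x ∈ a /\ P x)).
  have [b hb] := sep_ex a P; exists b; split=> // c hc.
  by apply: ext => z; rewrite hb hc.
Qed.

Lemma defT_sep t (P : (nat -> V) -> V -> Prop) : DefT t ->
  Def (fun e => P (tl e) (e 0)) -> DefT (fun e => sep (t e) (P e)).
Proof.
  move=> ht hP; apply: (defT_the (fun e b => forall x, x ∈ b <-> x ∈ t e /\ P e x)).
  apply: (def_all (fun e x => x ∈ e 0 <-> x ∈ t (tl e) /\ P (tl e) x)).
  apply: def_iff; first by apply: (app2 (@mem V)); apply: defT_var.
  apply: def_and.
  - apply: (app2 (@mem V)); first exact: defT_var.
    by apply: (defT_weak (fun e => t (tl e))); apply: defT_weak.
  - exact: (def_ren _ (fun i => match i with 0 => 0 | S j => S (S j) end) hP).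
Qed.

Definition ite (P : Prop) (a b : V) : V :=
  the (fun y => (P /\ y = a) \/ (~ P /\ y = b)).

Lemma ite_true (P : Prop) (a b : V) : P -> ite P a b = a.
Proof. by move=> h; apply: the_eq => [|z]; tauto. Qed.

Lemma ite_false (P : Prop) (a b : V) : ~ P -> ite P a b = b.
Proof. by move=> h; apply: the_eq => [|z]; tauto. Qed.

Lemma defT_ite P t u : Def P -> DefT t -> DefT u -> DefT (fun e => ite (P e) (t e) (u e)).
Proof.
  move=> hP ht hu.
  have hP' : Def (fun e => P (tl e)) by exact: (def_ren _ S hP).
  apply: (defT_the (fun e y => (P e /\ y = t e) \/ (~ P e /\ y = u e))).
  by apply: def_or; apply: def_and => //; apply: def_not.
Qed.

End Definability.

Notation "x ⊆ y" := (forall z, z ∈ x -> z ∈ y) (at level 70, no associativity).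

#[global] Opaque the sep ite.

(** * Automatic proofs of definability *)

Ltac dsolve :=
  cbv beta; unfold tl; cbv beta;
  lazymatch goal with
  | |- DefT _ => dterm
  | |- Def (fun e => @?P e /\ @?Q e) => apply (def_and P Q); dsolve
  | |- Def (fun e => @?P e \/ @?Q e) => apply (def_or P Q); dsolve
  | |- Def (fun e => @?P e <-> @?Q e) => apply (def_iff P Q); dsolve
  | |- Def (fun e => ~ @?P e) => apply (def_not P); dsolve
  | |- Def (fun e => @?P e -> @?Q e) => apply (def_imp P Q); dsolve
  | |- Def (fun e => forall x : _, @?P e x) => apply (def_all P); dsolve
  | |- Def (fun e => exists x : _, @?P e x) => apply (def_ex P); dsolve
  | |- Def (fun e => unique (@?P e) (@?t e)) => unfold unique; dsolve
  | |- Def (fun _ => ?C) => apply (def_const C)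
  | |- D1 ?R => unfold D1; dsolve
  | |- D2 ?R => unfold D2; dsolve
  | |- D3 ?R => unfold D3; dsolve
  | |- D4 ?R => unfold D4; dsolve
  | |- D5 ?R => unfold D5; dsolve
  | |- D6 ?R => unfold D6; dsolve
  | |- T1 ?R => unfold T1; dsolve
  | |- T2 ?R => unfold T2; dsolve
  | |- T3 ?R => unfold T3; dsolve
  | |- T4 ?R => unfold T4; dsolve
  | |- _ => datom
  end
(* The longest argument list is tried first; if there is no instance, the match backtracks to a
   shorter list and leaves the first arguments inside [R]. *)
with datom :=
  match goal with
  | |- Def (fun e => ?R (@?a e) (@?b e) (@?c e) (@?d e) (@?x e) (@?y e)) =>
      let H := constr:(_ : D6 R) in apply (app6 R a b c d x y H); dsolve
  | |- Def (fun e => ?R (@?a e) (@?b e) (@?c e) (@?d e) (@?x e)) =>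
      let H := constr:(_ : D5 R) in apply (app5 R a b c d x H); dsolve
  | |- Def (fun e => ?R (@?a e) (@?b e) (@?c e) (@?d e)) =>
      let H := constr:(_ : D4 R) in apply (app4 R a b c d H); dsolve
  | |- Def (fun e => ?R (@?a e) (@?b e) (@?c e)) =>
      let H := constr:(_ : D3 R) in apply (app3 R a b c H); dsolve
  | |- Def (fun e => ?R (@?a e) (@?b e)) =>
      let H := constr:(_ : D2 R) in apply (app2 R a b H); dsolve
  | |- Def (fun e => ?R (@?a e)) =>
      let H := constr:(_ : D1 R) in apply (app1 R a H); dsolve
  end
with dterm :=
  match goal with
  | |- DefT (fun _ => ?c) => apply (defT_const c)
  | |- DefT (fun e => e ?i) => apply (defT_var i)
  | |- DefT (fun e => the (@?P e)) => apply (defT_the P); dsolve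
  | |- DefT (fun e => ite (@?P e) (@?a e) (@?b e)) =>
      apply (defT_ite P a b); dsolve
  | |- DefT (fun e => sep (@?a e) (@?P e)) => apply (defT_sep a P); dsolve
  | |- DefT (fun e => ?R (@?a e) (@?b e) (@?c e) (@?d e)) =>
      let H := constr:(_ : T4 R) in apply (appT4 R a b c d H); dsolve
  | |- DefT (fun e => ?R (@?a e) (@?b e) (@?c e)) =>
      let H := constr:(_ : T3 R) in apply (appT3 R a b c H); dsolve
  | |- DefT (fun e => ?R (@?a e) (@?b e)) =>
      let H := constr:(_ : T2 R) in apply (appT2 R a b H); dsolve
  | |- DefT (fun e => ?R (@?a e)) =>
      let H := constr:(_ : T1 R) in apply (appT1 R a H); dsolve
  end.

(** The second case is for predicates introduced by [pose] during a proof. *)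
Ltac dclass R :=
  lazymatch R with
  | fun _ => _ => solve [dsolve]
  | _ => is_var R; unfold R; solve [dsolve]
  end.

#[export] Hint Extern 5 (D1 ?R) => dclass R : typeclass_instances.
#[export] Hint Extern 5 (D2 ?R) => dclass R : typeclass_instances.
#[export] Hint Extern 5 (D3 ?R) => dclass R : typeclass_instances.
#[export] Hint Extern 5 (T1 ?R) => dclass R : typeclass_instances.
#[export] Hint Extern 5 (T2 ?R) => dclass R : typeclass_instances.

#[export] Instance D1_part {V : structure} {hZF : ZF V} (R : V -> V -> Prop) (a : V) :
  D2 R -> D1 (R a).
Proof. by move=> hR; dsolve. Qed.

#[export] Instance D2_part {V : structure} {hZF : ZF V} (R : V -> V -> V -> Prop) (a : V) :
  D3 R -> D2 (R a).
Proof. by move=> hR; dsolve. Qed.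

#[export] Instance D3_part {V : structure} {hZF : ZF V}
  (R : V -> V -> V -> V -> Prop) (a : V) : D4 R -> D3 (R a).
Proof. by move=> hR; dsolve. Qed.

#[export] Instance D4_part {V : structure} {hZF : ZF V}
  (R : V -> V -> V -> V -> V -> Prop) (a : V) : D5 R -> D4 (R a).
Proof. by move=> hR; dsolve. Qed.

#[export] Instance T1_part {V : structure} {hZF : ZF V} (f : V -> V -> V) (a : V) :
  T2 f -> T1 (f a).
Proof. by move=> hf; dsolve. Qed.

(** * Elementary set theory *)

Section Basics.
Context {V : structure} {hZF : ZF V}.
Implicit Types (a b c f g p s w x y z : V).

Lemma the_set (P : V -> Prop) :
  (exists b, forall x, x ∈ b <-> P x) ->
  forall x, x ∈ the (fun b => forall x, x ∈ b <-> P x) <-> P x.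
Proof.
  move=> [b hb]; apply: (the_spec (fun b => forall x, x ∈ b <-> P x)).
  by exists b; split=> // c hc; apply: ext => z; rewrite hb hc.
Qed.

Definition emp : V := the (fun b => forall x, x ∈ b <-> False).
Definition upair x y : V := the (fun b => forall z, z ∈ b <-> z = x \/ z = y).
Definition union x : V := the (fun b => forall z, z ∈ b <-> exists y, y ∈ x /\ z ∈ y).
Definition pow x : V := the (fun b => forall z, z ∈ b <-> z ⊆ x).
Definition sing x : V := upair x x.
Definition cup x y : V := union (upair x y).
Definition add x a : V := cup x (sing a).
Definition diff x y : V := sep x (fun z => z ∉ y).
Definition pr x y : V := upair (sing x) (upair x y).
Definition prod a b : V :=
  sep (pow (pow (cup a b))) (fun p => exists x y, x ∈ a /\ y ∈ b /\ p = pr x y).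
Definition app f x : V := the (fun y => maps f x y).

Lemma in_emp x : x ∈ emp <-> False.
Proof.
  apply: the_set; have [e he] := empty_ex; exists e => z.
  by split=> // /he.
Qed.

Lemma in_upair x y z : z ∈ upair x y <-> z = x \/ z = y.
Proof. apply: the_set; exact: ZF_pairing. Qed.

Lemma in_union x z : z ∈ union x <-> exists y, y ∈ x /\ z ∈ y.
Proof. apply: the_set; exact: ZF_union. Qed.

Lemma in_pow x z : z ∈ pow x <-> z ⊆ x.
Proof. apply: (the_set (fun z => z ⊆ x)); exact: ZF_powerset. Qed.

Lemma in_sing x z : z ∈ sing x <-> z = x.
Proof. rewrite in_upair; tauto. Qed.

Lemma in_cup x y z : z ∈ cup x y <-> z ∈ x \/ z ∈ y.
Proof.
  rewrite in_union; split=> [[u []]|h].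
    by rewrite in_upair => -[] ->; auto.
  by case: h => h; [exists x | exists y]; rewrite in_upair; auto.
Qed.

Lemma in_add x a z : z ∈ add x a <-> z ∈ x \/ z = a.
Proof. by rewrite in_cup in_sing. Qed.

Lemma in_diff x y z : z ∈ diff x y <-> z ∈ x /\ z ∉ y.
Proof. exact: in_sep. Qed.

#[export] Instance T2_upair : T2 upair.
Proof. rewrite /upair; dsolve. Qed.
#[export] Instance T1_union : T1 union.
Proof. rewrite /union; dsolve. Qed.
#[export] Instance T1_pow : T1 pow.
Proof. rewrite /pow; dsolve. Qed.
#[export] Instance T1_sing : T1 sing.
Proof. rewrite /sing; dsolve. Qed.
#[export] Instance T2_cup : T2 cup.
Proof. rewrite /cup; dsolve. Qed.
#[export] Instance T2_add : T2 add.
Proof. rewrite /add; dsolve. Qed.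
#[export] Instance T2_pr : T2 pr.
Proof. rewrite /pr; dsolve. Qed.
#[export] Instance T2_prod : T2 prod.
Proof. rewrite /prod; dsolve. Qed.

Lemma sub_antisym x y : x ⊆ y -> y ⊆ x -> x = y.
Proof. by move=> h1 h2; apply: ext => z; split; [apply: h1 | apply: h2]. Qed.

Lemma sing_inj x y : sing x = sing y -> x = y.
Proof. by move=> h; have : x ∈ sing y by [rewrite -h in_sing]; rewrite in_sing. Qed.

Lemma pr_inj x y x' y' : pr x y = pr x' y' -> x = x' /\ y = y'.
Proof.
  move=> h.
  have e : x = x'.
    have : sing x ∈ pr x' y' by rewrite -h in_upair; left.
    rewrite in_upair => -[/sing_inj //|e].
    by have : x' ∈ sing x by [rewrite e in_upair; left]; rewrite in_sing.
  split=> //; subst x'.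
  have h1 : upair x y ∈ pr x y' by rewrite -h in_upair; right.
  have h2 : upair x y' ∈ pr x y by rewrite h in_upair; right.
  have hy : y ∈ upair x y by rewrite in_upair; right.
  have hy' : y' ∈ upair x y' by rewrite in_upair; right.
  move: h1 h2; rewrite !in_upair => -[e1|e1] [e2|e2].
  - move: hy hy'; rewrite e1 e2 !in_sing; congruence.
  - move: hy hy'; rewrite e2 e1 !in_sing; congruence.
  - move: hy hy'; rewrite e1 e2 !in_sing; congruence.
  - have : y ∈ upair x y' by rewrite -e1.
    have : y' ∈ upair x y by rewrite -e2.
    rewrite !in_upair; intuition congruence.
Qed.

Lemma is_opairE x y p : is_opair x y p <-> p = pr x y.
Proof.
  split=> [[u [v [hu [hv hp]]]]|->].
    apply: ext => z; rewrite hp in_upair.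
    have -> : u = sing x by apply: ext => t; rewrite hu in_sing; tauto.
    by have -> : v = upair x y by apply: ext => t; rewrite hv in_upair.
  exists (sing x), (upair x y); split; [|split] => z; rewrite ?in_upair ?in_sing; tauto.
Qed.

Lemma mapsE f x y : maps f x y <-> pr x y ∈ f.
Proof.
  split=> [[p [/is_opairE ->]] //|h]; exists (pr x y); split=> //.
  by apply/is_opairE.
Qed.

#[export] Instance D3_maps : D3 (@maps V).
Proof.
  apply: (def_ext (fun e => pr (e 1) (e 2) ∈ e 0)); first by move=> e; rewrite mapsE.
  dsolve.
Qed.

#[export] Instance T2_app : T2 app.
Proof. rewrite /app; dsolve. Qed.

Lemma in_prod a b p : p ∈ prod a b <-> exists x y, x ∈ a /\ y ∈ b /\ p = pr x y.
Proof.
  rewrite in_sep.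
  split=> [[]//|h]; split=> //; move: h => [x [y [hx [hy ->]]]].
  rewrite in_pow => z; rewrite in_upair in_pow => -[] -> t;
    rewrite ?in_sing ?in_upair in_cup.
  - by move=> ->; left.
  - by case=> ->; [left | right].
Qed.

Lemma pr_in_prod a b x y : pr x y ∈ prod a b <-> x ∈ a /\ y ∈ b.
Proof.
  rewrite in_prod; split=> [[x' [y' [hx [hy /pr_inj [-> ->]]]]]//|[hx hy]].
  by exists x, y.
Qed.

Definition fst p : V := the (fun x => exists y, p = pr x y).
Definition snd p : V := the (fun y => exists x, p = pr x y).
#[export] Instance T1_fst : T1 fst.
Proof. rewrite /fst; dsolve. Qed.
#[export] Instance T1_snd : T1 snd.
Proof. rewrite /snd; dsolve. Qed.

Lemma fst_pr x y : fst (pr x y) = x.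
Proof. by apply: the_eq => [|z [w /pr_inj []]]; first exists y. Qed.

Lemma snd_pr x y : snd (pr x y) = y.
Proof. by apply: the_eq => [|z [w /pr_inj []]]; first exists x. Qed.

Lemma app_eq f x y : (forall z, maps f x z -> z = y) -> maps f x y -> app f x = y.
Proof. by move=> h1 h2; apply: the_eq. Qed.

Lemma fun_graph a (F : V -> V) {hF : T1 F} :
  exists g, forall x y, maps g x y <-> x ∈ a /\ y = F x.
Proof.
  have [x p p' _ -> -> //|g hg] := repl_ex a (fun x p => p = pr x (F x)).
  exists g => x y; rewrite mapsE hg; split=> [[x' [hx /pr_inj [-> ->]]]//|[hx ->]].
  by exists x.
Qed.

Lemma fun_rep a (F : V -> V) {hF : T1 F} : exists g, forall x, x ∈ a -> app g x = F x.
Proof.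
  have [g hg] := fun_graph a F; exists g => x hx.
  by apply: app_eq => [z|]; rewrite hg // => -[].
Qed.

Definition le a b : Prop := card_le (elements a) b.

Lemma le_intro a b (F : V -> V) {hF : T1 F} :
  (forall x, x ∈ a -> F x ∈ b) ->
  (forall x y, x ∈ a -> y ∈ a -> F x = F y -> x = y) -> le a b.
Proof.
  move=> h1 h2; have [g0 hg0] := fun_graph a F.
  (* [g0] is known only through [maps] and might have elements that are not pairs, which
     [is_function] forbids. *)
  pose (g := sep g0 (fun p => exists x, x ∈ a /\ p = pr x (F x))).
  have hg x y : maps g x y <-> x ∈ a /\ y = F x.
    rewrite mapsE in_sep.
    rewrite -mapsE hg0; split=> [[]//|[hx ->]]; split=> //; by exists x.
  exists g; split; [split|].
  - move=> p; rewrite in_sep.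
    move=> [_ [x [hx ->]]]; exists x, (F x); split=> //; split; first exact: h1.
    by apply/is_opairE.
  - move=> x hx; exists (F x); split=> [|y]; rewrite hg => //; by case.
  - by move=> x x' y; rewrite !hg => -[hx ->] [hx' /h2]; auto.
Qed.

Lemma card_le_elim (X : V -> Prop) b : card_le X b ->
  exists g, (forall x, X x -> app g x ∈ b) /\
            (forall x y, X x -> X y -> app g x = app g y -> x = y).
Proof.
  move=> [g [[h1 h2] h3]]; exists g.
  have H x : X x -> maps g x (app g x).
    by move=> hx; apply: (the_spec (fun y => maps g x y)); apply: h2.
  split=> [x hx|x y hx hy e].
    have [p [hp pg]] := H x hx; have [x' [y' [_ [hy]]]] := h1 p pg.
    move: hp => /is_opairE -> /is_opairE /pr_inj [_ ->] //.
  by apply: (h3 _ _ (app g x)); [apply: H | rewrite e; apply: H].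
Qed.

Lemma le_elim a b : le a b ->
  exists g, (forall x, x ∈ a -> app g x ∈ b) /\
            (forall x y, x ∈ a -> y ∈ a -> app g x = app g y -> x = y).
Proof. exact: card_le_elim. Qed.

Lemma card_le_set (X : V -> Prop) a b :
  (forall x, x ∈ a <-> X x) -> card_le X b <-> le a b.
Proof.
  move=> h; split=> /card_le_elim [g [h1 h2]].
    apply: (le_intro _ _ (app g)) => [x|x y]; rewrite !h; auto.
  have : le a b by apply: (le_intro _ _ (app g)).
  move=> [g' [[k1 k2] k3]]; exists g'; split=> //; split=> [p /k1 [x [y]]|x /h /k2 //].
  by rewrite /elements h; exists x, y.
Qed.

#[export] Instance D2_le : D2 le.
Proof.
  apply: (def_ext (fun e => exists g, (forall x, x ∈ e 0 -> app g x ∈ e 1) /\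
     (forall x y, x ∈ e 0 -> y ∈ e 0 -> app g x = app g y -> x = y))); last dsolve.
  move=> e; split=> [[g [h1 h2]]|/le_elim //]; exact: (le_intro _ _ (app g)).
Qed.

Lemma le_refl_sub a b : a ⊆ b -> le a b.
Proof. move=> h; apply: (le_intro _ _ (fun x => x)). all: done. Qed.

Lemma le_trans a b c : le a b -> le b c -> le a c.
Proof.
  move=> /le_elim [g [g1 g2]] /le_elim [h [h1 h2]].
  apply: (le_intro _ _ (fun x => app h (app g x))); auto.
Qed.

Lemma le_pow a b : le a b -> le (pow a) (pow b).
Proof.
  move=> /le_elim [g [g1 g2]].
  pose (F := fun x => sep b (fun y => exists z, z ∈ x /\ y = app g z)).
  have hF x y : y ∈ F x <-> y ∈ b /\ exists z, z ∈ x /\ y = app g z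
    by exact: in_sep.
  apply: (le_intro _ _ F).
  - by move=> x _; rewrite in_pow => y /hF [].
  - have H x y : x ∈ pow a -> y ∈ pow a -> F x = F y -> x ⊆ y.
      move=> /in_pow hx /in_pow hy e z hz.
      have : app g z ∈ F y by rewrite -e hF; split; [auto | exists z].
      by rewrite hF => -[_ [z' [hz' /g2]]] => ->; auto.
    by move=> x y hx hy e; apply: sub_antisym; apply: H.
Qed.

Lemma le_prod a b c d : le a b -> le c d -> le (prod a c) (prod b d).
Proof.
  move=> /le_elim [g [g1 g2]] /le_elim [h [h1 h2]].
  apply: (le_intro _ _ (fun p => pr (app g (fst p)) (app h (snd p)))).
  - move=> p /in_prod [x [y [hx [hy ->]]]].
    by rewrite fst_pr snd_pr pr_in_prod; auto.
  - move=> p q /in_prod [x [y [hx [hy ->]]]] /in_prod [x' [y' [hx' [hy' ->]]]].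
    rewrite !fst_pr !snd_pr => /pr_inj [/g2 e1 /h2 e2].
    by rewrite e1 // e2.
Qed.

End Basics.

#[global] Opaque emp upair union pow sing cup add diff pr prod app fst snd.

(** * Finite sets *)

(** Induction is available for definable motives only; instance search proves the definability of
    the motive read off from the goal. *)
Ltac set_induct principle x hx :=
  pattern x;
  match goal with
  | |- ?P x => let H := constr:(_ : D1 P) in
      refine (principle P H x hx _ _); clear hx; try clear x; cbv beta
  end.

Section Finite.
Context {V : structure} {hZF : ZF V}.
Implicit Types (a b c f g n p s u v w x y z : V).

(** Kuratowski finiteness: it has an induction principle without numbers. *)
Definition fin x : Prop :=
  forall B, emp ∈ B -> (forall y a, y ∈ B -> a ∈ x -> add y a ∈ B) -> x ∈ B.

#[export] Instance D1_fin : D1 fin.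
Proof. rewrite /fin; dsolve. Qed.

Lemma sub_emp x : x ⊆ emp -> x = emp.
Proof. by move=> h; apply: ext => z; split=> [/h|/in_emp]. Qed.

Lemma add_absorb x a : a ∈ x -> add x a = x.
Proof. by move=> h; apply: ext => z; rewrite in_add; split=> [[|->]|]; auto. Qed.

Lemma add_diff x a : a ∈ x -> x = add (diff x (sing a)) a.
Proof.
  move=> h; apply: ext => z; rewrite in_add in_diff in_sing.
  by case: (classic (z = a)) => [->|]; tauto.
Qed.

Lemma fin_emp : fin emp.
Proof. by []. Qed.

Lemma fin_add x a : fin x -> fin (add x a).
Proof.
  move=> hx B h0 hB; apply: (hB x a); last by rewrite in_add; right.
  by apply: hx => // y b hy hb; apply: hB => //; rewrite in_add; left.
Qed.

Lemma fin_ind (Q : V -> Prop) {hQ : D1 Q} x : fin x -> Q emp ->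
  (forall y a, fin y -> a ∉ y -> Q y -> Q (add y a)) -> Q x.
Proof.
  move=> hx h0 hs.
  have : x ∈ sep (pow x) (fun y => fin y /\ Q y).
  { apply: hx => [|y a]; rewrite !in_sep !in_pow.
      by split=> [z /in_emp|] //; split=> //; apply: fin_emp.
    move=> [hy [fy qy]] ha; split; last split.
    - by move=> z /in_add [/hy|->].
    - exact: fin_add.
    - by case: (classic (a ∈ y)) => [/add_absorb ->|]; auto. }
  by rewrite in_sep => -[_ []].
Qed.

Lemma fin_sub x y : fin x -> y ⊆ x -> fin y.
Proof.
  move=> hx; move: y; set_induct (@fin_ind) x hx => [|x a hx _ IH] y hy.
    by rewrite (sub_emp _ hy); apply: fin_emp.
  have h : fin (diff y (sing a)).
    by apply: IH => z; rewrite in_diff in_sing => -[/hy/in_add []].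
  case: (classic (a ∈ y)) => [/add_diff ->|ha]; first exact: fin_add.
  apply: IH => z hz; case/in_add: (hy z hz) => // e; by move: hz; rewrite e.
Qed.

Lemma fin_image (F : V -> V) {hF : T1 F} x y :
  fin x -> (forall z, z ∈ y -> exists u, u ∈ x /\ z = F u) -> fin y.
Proof.
  move=> hx; move: y; set_induct (@fin_ind) x hx => [|x a hx _ IH] y hy.
    have -> : y = emp by apply: sub_emp => z /hy [u [/in_emp]].
    exact: fin_emp.
  apply: (fin_sub (add (sep y (fun z => exists u, u ∈ x /\ z = F u)) (F a))).
    by apply: fin_add; apply: IH => z; rewrite in_sep => -[].
  move=> z hz; rewrite in_add in_sep.
  case: (hy z hz) => u [/in_add [hu|->] e]; [left | by right].
  by split=> //; exists u.
Qed.

Lemma fin_le x y : le x y -> fin y -> fin x.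
Proof.
  move=> /le_elim [g [g1 g2]] hy.
  apply: (fin_image (fun v => the (fun u => u ∈ x /\ app g u = v)) y) => // u hu.
  exists (app g u); split; first exact: g1.
  by symmetry; apply: the_eq => // z [hz /g2]; apply.
Qed.

Lemma fin_cup x y : fin x -> fin y -> fin (cup x y).
Proof.
  move=> hx hy; set_induct (@fin_ind) y hy => [|y a _ _ IH].
    by apply: (fin_sub x) => // z /in_cup [|/in_emp].
  apply: (fin_sub (add (cup x y) a)); first exact: fin_add.
  move=> z; rewrite !(in_cup, in_add); tauto.
Qed.

Lemma fin_union x : fin x -> (forall y, y ∈ x -> fin y) -> fin (union x).
Proof.
  move=> hx; set_induct (@fin_ind) x hx => [|x a _ _ IH] h.
    by apply: (fin_sub emp) => [|z /in_union [y [/in_emp]]]; first exact: fin_emp.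
  apply: (fin_sub (cup (union x) a)).
    apply: fin_cup; [apply: IH => y hy|]; apply: h; rewrite in_add; auto.
  move=> z; rewrite in_cup !in_union => -[y [/in_add [hy|->] hz]]; auto.
  by left; exists y.
Qed.

Lemma fin_prod x y : fin x -> fin y -> fin (prod x y).
Proof.
  move=> hx hy; set_induct (@fin_ind) x hx => [|x a _ _ IH].
    by apply: (fin_sub emp) => [|z /in_prod [u [v [/in_emp]]]]; first exact: fin_emp.
  apply: (fin_sub (cup (prod x y) (sep (prod (sing a) y) (fun _ => True)))).
    apply: fin_cup => //; apply: (fin_image (pr a) y) => // z.
    rewrite in_sep => -[/in_prod [u [v [/in_sing -> [hv ->]]]] _]; by exists v.
  move=> z /in_prod [u [v [/in_add [hu|->] [hv ->]]]]; rewrite in_cup in_sep !pr_in_prod.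
    by left.
  by right; rewrite in_sing.
Qed.

Lemma fin_pow x : fin x -> fin (pow x).
Proof.
  move=> hx; set_induct (@fin_ind) x hx => [|x a _ _ IH].
    apply: (fin_sub (add emp emp)); first by apply: fin_add; apply: fin_emp.
    by move=> z /in_pow /sub_emp ->; rewrite in_add; right.
  apply: (fin_sub (cup (pow x) (sep (pow (add x a)) (fun z => a ∈ z)))).
    apply: fin_cup => //; apply: (fin_image (fun u => add u a) (pow x)) => // z.
    rewrite in_sep in_pow => -[hz /add_diff ha]; exists (diff z (sing a)); split=> //.
    by rewrite in_pow => t; rewrite in_diff in_sing => -[/hz/in_add []].
  move=> z; rewrite in_cup in_sep !in_pow => h.
  case: (classic (a ∈ z)) => ha; [by right | left=> t ht].
  by case/in_add: (h t ht) => // e; move: ha; rewrite -e.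
Qed.

(** A point of [x] that went to [b] is redirected to the image of [a], which is free and differs
    from [b]. *)
Lemma le_remove x y a b : a ∉ x -> le (add x a) (add y b) -> le x y.
Proof.
  move=> hax /le_elim [g [g1 g2]].
  have ha : a ∈ add x a by rewrite in_add; right.
  have hx u : u ∈ x -> u ∈ add x a by rewrite in_add; left.
  have hne u : u ∈ x -> u <> a by move=> h e; move: h; rewrite e.
  apply: (le_intro _ _ (fun u => ite (app g u = b) (app g a) (app g u))).
  - move=> u hu; case: (classic (app g u = b)) => e; [rewrite ite_true //|rewrite ite_false //].
    + case/in_add: (g1 a ha) => // e'.
      by case: (hne u hu); apply: g2; rewrite ?e ?e'; auto.
    + by case/in_add: (g1 u (hx u hu)).
  - move=> u v hu hv.
    case: (classic (app g u = b)) => e; case: (classic (app g v = b)) => e'.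
    + by move=> _; apply: g2; auto; rewrite e e'.
    + by rewrite ite_true // ite_false // => /g2 h; case: (hne v hv); rewrite h //; auto.
    + by rewrite ite_false // ite_true // => /g2 h; case: (hne u hu); rewrite h //; auto.
    + by rewrite !ite_false // => /g2; apply; auto.
Qed.

(** Induction on [x]. If the new element [a] is in [y], it is removed from both sides. Otherwise its
    image is removed from [y], and the induction hypothesis puts this image back into the set it was
    removed from. *)
Lemma pigeonhole x y : fin x -> y ⊆ x -> le x y -> x ⊆ y.
Proof.
  move=> hx; move: y; set_induct (@fin_ind) x hx => [|x a hx hax IH] y hy hle.
    by move=> z /in_emp.
  case: (classic (a ∈ y)) => ha.
    have hd : diff y (sing a) ⊆ x.
      by move=> z; rewrite in_diff in_sing => -[/hy/in_add []].
    rewrite (add_diff _ _ ha) in hle.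
    have h := IH _ hd (le_remove _ _ _ _ hax hle).
    by move=> z /in_add [/h/in_diff []|->].
  have hyx : y ⊆ x.
    by move=> z hz; case/in_add: (hy z hz) => // e; move: hz; rewrite e.
  have [g [g1 _]] := le_elim _ _ hle.
  have hb := g1 a; rewrite in_add in hb; have {}hb := hb (or_intror eq_refl).
  have hd : diff y (sing (app g a)) ⊆ x by move=> z; rewrite in_diff => -[/hyx].
  rewrite (add_diff _ _ hb) in hle.
  have h := IH _ hd (le_remove _ _ _ _ hax hle).
  by move: (h _ (hyx _ hb)); rewrite in_diff in_sing => -[_ []].
Qed.

(** In the absence of choice the injections of the fibers are picked one at a time, by induction on
    the finite set [y]. The fibers may overlap: a new fiber only receives the points not yet
    covered. *)
Lemma le_fibers (R : V -> V -> Prop) {hR : D2 R} b y : fin y -> forall x,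
  (forall u, u ∈ x -> exists c, c ∈ y /\ R c u) ->
  (forall c, c ∈ y -> le (sep x (R c)) b) -> le x (prod y b).
Proof.
  move=> hy; set_induct (@fin_ind) y hy => [|y a _ ha IH] x h1 h2.
    by apply: le_refl_sub => u /h1 [c [/in_emp]].
  pose (x1 := sep x (fun u => exists c, c ∈ y /\ R c u)).
  have hx1 u : u ∈ x1 <-> u ∈ x /\ exists c, c ∈ y /\ R c u by exact: in_sep.
  have : le x1 (prod y b).
    apply: IH => [u /hx1 []//|c hc].
    apply: (le_trans _ (sep x (R c))); last by apply: h2; rewrite in_add; left.
    by apply: le_refl_sub => u; rewrite !in_sep; tauto.
  move=> /le_elim [g [g1 g2]].
  have /h2 /le_elim [h [k1 k2]] : a ∈ add y a by rewrite in_add; right.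
  have hx2 u : u ∈ x -> u ∉ x1 -> u ∈ sep x (R a).
    move=> hu hu1; rewrite in_sep; split=> //.
    have [c [/in_add [hc|->]]] // := h1 u hu => hr; case: hu1; rewrite hx1; split=> //.
    by exists c.
  apply: (le_intro _ _ (fun u => ite (u ∈ x1) (app g u) (pr a (app h u)))).
  - move=> u hu; case: (classic (u ∈ x1)) => hu1.
      rewrite ite_true //; case/in_prod: (g1 u hu1) => c [v [hc [hv ->]]].
      by rewrite pr_in_prod in_add; auto.
    by rewrite ite_false // pr_in_prod in_add; split; auto.
  - have H u v : u ∈ x -> v ∈ x -> u ∈ x1 -> v ∉ x1 -> app g u <> pr a (app h v).
      move=> hu hv hu1 hv1 e; case/in_prod: (g1 u hu1) => c [w [hc [hw]]].
      by rewrite e => /pr_inj [e1 _]; rewrite e1 in ha.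
    move=> u v hu hv.
    case: (classic (u ∈ x1)) => hu1; case: (classic (v ∈ x1)) => hv1.
    + rewrite !ite_true //; exact: g2.
    + by rewrite ite_true // ite_false // => /H; case.
    + by rewrite ite_false // ite_true // => e; case: (H v u).
    + by rewrite !ite_false // => /pr_inj [_ /k2]; apply; auto.
Qed.

(** * Natural numbers *)

Definition succ x : V := add x x.
#[export] Instance T1_succ : T1 succ.
Proof. rewrite /succ; dsolve. Qed.

Lemma in_succ x z : z ∈ succ x <-> z ∈ x \/ z = x.
Proof. exact: in_add. Qed.

#[export] Instance D1_is_nat : D1 (@is_nat V).
Proof. rewrite /is_nat /inductive_set /is_empty /is_succ; dsolve. Qed.

Lemma inductive_setE w :
  inductive_set w <-> emp ∈ w /\ forall x, x ∈ w -> succ x ∈ w.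
Proof.
  have h1 x : is_empty x <-> x = emp.
    by split=> [h|->]; [apply: ext => z; split=> [/h|/in_emp]|move=> z /in_emp].
  have h2 x y : is_succ x y <-> y = succ x.
    split=> [h|-> z]; last exact: in_succ.
    by apply: ext => z; rewrite h in_succ.
  split=> -[].
    move=> [x [/h1 -> hx]] hs; split=> // y /hs [z [/h2 ->]] //.
  move=> h0 hs; split; first by exists emp; rewrite h1.
  by move=> x /hs hx; exists (succ x); rewrite h2.
Qed.

Definition omega : V := the (fun b => forall x, x ∈ b <-> is_nat x).

Lemma in_omega x : x ∈ omega <-> is_nat x.
Proof.
  apply: the_set; have [w hw] := ZF_infinity V hZF.
  exists (sep w (@is_nat V)) => y; rewrite in_sep; split=> [[]//|h]; split=> //; exact: h.
Qed.

Lemma nat_emp : is_nat emp.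
Proof. by move=> w /inductive_setE []. Qed.

Lemma nat_succ n : is_nat n -> is_nat (succ n).
Proof. by move=> h w hw; have /inductive_setE [_] := hw; apply; apply: h. Qed.

Lemma nat_ind (Q : V -> Prop) {hQ : D1 Q} n : is_nat n -> Q emp ->
  (forall n, is_nat n -> Q n -> Q (succ n)) -> Q n.
Proof.
  move=> hn h0 hs.
  have : n ∈ sep omega Q.
    apply: hn; apply/inductive_setE; split=> [|x]; rewrite !in_sep !in_omega.
      by split=> //; apply: nat_emp.
    by move=> [hx qx]; split; [apply: nat_succ | apply: hs].
  by rewrite in_sep => -[].
Qed.

Lemma nat_fin n : is_nat n -> fin n.
Proof.
  move=> hn; set_induct (@nat_ind) n hn => [|n _]; [exact: fin_emp | exact: fin_add].
Qed.

Lemma notin_self x : x ∉ x.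
Proof.
  have [|y [/in_sing -> h]] := ZF_foundation V hZF (sing x).
    by exists x; rewrite in_sing.
  by move=> hx; apply: (h x hx); rewrite in_sing.
Qed.

Lemma no_two_cycle x y : x ∈ y -> y ∉ x.
Proof.
  move=> hxy hyx; have [|z []] := ZF_foundation V hZF (upair x y).
    by exists x; rewrite in_upair; left.
  rewrite in_upair => -[] -> h; [apply: (h y)|apply: (h x)] => //; rewrite in_upair; auto.
Qed.

Lemma succ_inj x y : succ x = succ y -> x = y.
Proof.
  move=> e; have hx : x ∈ succ y by rewrite -e in_succ; right.
  have hy : y ∈ succ x by rewrite e in_succ; right.
  move: hx hy; rewrite !in_succ => -[] // hx [] // hy.
  by case: (no_two_cycle _ _ hx hy).
Qed.

Lemma fin_nat x : fin x -> exists n g, is_nat n /\ (forall u, u ∈ x -> app g u ∈ n) /\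
  (forall u v, u ∈ x -> v ∈ x -> app g u = app g v -> u = v) /\
  (forall v, v ∈ n -> exists u, u ∈ x /\ app g u = v).
Proof.
  move=> hx; set_induct (@fin_ind) x hx => [|x a _ ha [n [g [hn [g1 [g2 g3]]]]]].
    by exists emp, emp; split; [exact: nat_emp | split; [|split] => u => [|v|]; move=> /in_emp].
  have [h hh] := fun_rep (add x a) (fun u => ite (u = a) n (app g u)).
  have ka : app h a = n by rewrite hh ?ite_true // in_add; right.
  have kx u : u ∈ x -> app h u = app g u.
    move=> hu; rewrite hh ?ite_false // ?in_add; auto.
    by move=> e; move: hu; rewrite e.
  have hng u : u ∈ x -> app g u <> n.
    by move=> /g1 hu e; move: hu; rewrite e; apply: notin_self.
  exists (succ n), h; split; first exact: nat_succ.
  split; [|split].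
  - by move=> u; rewrite in_add in_succ => -[hu|->]; [left; rewrite kx //; auto | right].
  - move=> u v; rewrite !in_add => -[hu|->] [hv|->]; rewrite ?ka ?kx //.
    + exact: g2.
    + by move=> /hng; case.
    + by move=> e; case: (hng v hv).
  - move=> v; rewrite in_succ => -[/g3 [u [hu <-]]|->].
      by exists u; rewrite in_add kx //; auto.
    by exists a; rewrite in_add; auto.
Qed.

Lemma fin_is_finite x : fin x -> is_finite x.
Proof.
  move=> /fin_nat [n [g [hn [g1 [g2 g3]]]]].
  have [h [[k1 k2] k3]] : exists h, is_injection h (elements x) (elements n) /\
      forall u, u ∈ x -> maps h u (app g u).
    have [h0 hh0] := fun_graph x (app g).
    pose (h := sep h0 (fun p => exists u, u ∈ x /\ p = pr u (app g u))).
    have hh u v : maps h u v <-> u ∈ x /\ v = app g u.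
      rewrite mapsE in_sep -mapsE hh0; split=> [[]//|[hu ->]]; split=> //; by exists u.
    exists h; split; last by move=> u hu; rewrite hh.
    split; last by move=> u u' v; rewrite !hh => -[hu ->] [hu' /g2]; auto.
    split=> [p|u hu].
      rewrite in_sep => -[_ [u [hu ->]]]; exists u, (app g u); split=> //; split; first exact: g1.
      by apply/is_opairE.
    exists (app g u); split=> [|y]; rewrite hh => //; by case.
  exists n, h; split=> //; split=> // v /g3 [u [hu <-]]; exists u; exact: k3.
Qed.

(** [A] may be Dedekind-finite, but induction on the finite set [x] requires only one new point of
    [A] per step. *)
Lemma le_infinite A x : is_infinite A -> fin x -> le x A.
Proof.
  move=> hA hx.
  have nA : ~ fin A by move=> /fin_is_finite.
  set_induct (@fin_ind) x hx => [|x a hx ha /le_elim [g [g1 g2]]].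
    by apply: le_refl_sub => z /in_emp.
  have [v [hv hn]] : exists v, v ∈ A /\ forall u, u ∈ x -> app g u <> v.
    apply: NNPP => h; case: nA; apply: (fin_image (app g) x) => // z hz.
    apply: NNPP => h'; apply: h; exists z; split=> // u hu e; apply: h'.
    by exists u.
  apply: (le_intro _ _ (fun u => ite (u = a) v (app g u))).
  - move=> u hu; case: (classic (u = a)) => e; [rewrite ite_true // | rewrite ite_false //].
    by case/in_add: hu => // /g1.
  - have hx' u : u ∈ add x a -> u <> a -> u ∈ x by move=> /in_add [].
    move=> u w hu hw; case: (classic (u = a)) => e; case: (classic (w = a)) => e'.
    + by rewrite e e'.
    + rewrite ite_true // ite_false // => e2; case: (hn w (hx' w hw e')). by rewrite e2.
    + rewrite ite_false // ite_true // => /hn []; exact: hx'.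
    + rewrite !ite_false // => /g2; apply; exact: hx'.
Qed.

Lemma omega_not_fin : ~ fin omega.
Proof.
  move=> h.
  have hsub : diff omega (sing emp) ⊆ omega by move=> z /in_diff [].
  have hle : le omega (diff omega (sing emp)).
    apply: (le_intro _ _ succ) => [x|x y _ _ /succ_inj //].
    rewrite in_diff !in_omega in_sing => /nat_succ hx; split=> // e.
    have : x ∈ emp by rewrite -e in_succ; right.
    by rewrite in_emp.
  have /(pigeonhole _ _ h hsub hle) : emp ∈ omega by apply/in_omega/nat_emp.
  by rewrite in_diff in_sing => -[].
Qed.

End Finite.

#[global] Opaque succ omega.

(** * Ordinals *)

Section Ordinals.
Context {V : structure} {hZF : ZF V}.
Implicit Types (a b c f g m n p s u v w x y z : V).

(** A transitive set of transitive sets; by foundation, membership well-orders it. *)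
Definition ord x : Prop := (forall y, y ∈ x -> y ⊆ x) /\
  (forall y, y ∈ x -> forall z, z ∈ y -> z ⊆ y).

#[export] Instance D1_ord : D1 ord.
Proof. rewrite /ord; dsolve. Qed.

Lemma ord_in x y : ord x -> y ∈ x -> ord y.
Proof.
  move=> [h1 h2] hy; split=> [z|z hz]; first exact: h2.
  by apply: h2; apply: h1 hz.
Qed.

Lemma ord_trans x y z : ord z -> x ∈ y -> y ∈ z -> x ∈ z.
Proof. move=> [h _] hx /h; exact. Qed.

Lemma ord_min (Q : V -> Prop) {hQ : D1 Q} a : ord a -> Q a ->
  exists b, ord b /\ Q b /\ forall c, c ∈ b -> ~ Q c.
Proof.
  move=> oa qa; have [|b] := ZF_foundation V hZF (sep (succ a) Q).
    by exists a; rewrite in_sep in_succ; auto.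
  rewrite in_sep in_succ => -[[hb qb] hm]; exists b.
  have ob : ord b by case: hb => [/(ord_in _ _ oa)|->].
  split=> //; split=> // c hc qc; apply: (hm c hc); rewrite in_sep in_succ; split=> //.
  by left; case: hb => [hb|<-] //; apply: ord_trans oa hc hb.
Qed.

(** Take [x0] least among the ordinals that are incomparable with some ordinal, then [y0] least
    among those incomparable with [x0]. Both then have the same elements. *)
Lemma ord_trichotomy x y : ord x -> ord y -> x ∈ y \/ x = y \/ y ∈ x.
Proof.
  move=> ox oy; apply: NNPP => hxy.
  have [x0 [ox0 [[y1 [oy1 hxy1]] hm]]] :=
    ord_min (fun x => exists y, ord y /\ ~ (x ∈ y \/ x = y \/ y ∈ x)) x ox
      (ex_intro _ y (conj oy hxy)).
  have [y0 [oy0 [hxy0 hm0]]] :=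
    ord_min (fun y => ~ (x0 ∈ y \/ x0 = y \/ y ∈ x0)) y1 oy1 hxy1.
  apply: (hxy0); right; left; apply: ext => z; split=> hz.
  - have oz := ord_in _ _ ox0 hz.
    apply: NNPP => hz'; apply: (hm z hz); exists y0; split=> // -[|[|]] // h.
      by apply: (hxy0); right; right; rewrite -h.
    by apply: hxy0; right; right; apply: ord_trans ox0 h hz.
  - have oz := ord_in _ _ oy0 hz.
    apply: NNPP => hz'; apply: (hm0 z hz) => -[|[|]] // h.
      by apply: hxy0; left; apply: ord_trans oy0 h hz.
    by apply: hxy0; left; rewrite h.
Qed.

Lemma ord_succ x : ord x -> ord (succ x).
Proof.
  move=> ox; split=> [y|y]; rewrite in_succ => -[hy|->].
  - by move=> z hz; rewrite in_succ; left; apply: ord_trans ox hz hy.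
  - by move=> z hz; rewrite in_succ; left.
  - by have [] := ord_in _ _ ox hy.
  - by have [] := ox.
Qed.

(** Burali-Forti: the ordinals in [s] would form an ordinal that is an element of itself. *)
Lemma ord_not_set s : ~ forall x, ord x -> x ∈ s.
Proof.
  move=> h; have ho x : x ∈ sep s ord <-> ord x.
    by rewrite in_sep; split=> [[]//|hx]; split; auto.
  have : ord (sep s ord).
    split=> [y /ho oy z hz|y /ho [] //]; rewrite ho; exact: ord_in oy hz.
  by move=> /ho; apply: notin_self.
Qed.

Lemma nat_ord n : is_nat n -> ord n.
Proof.
  move=> hn; set_induct (@nat_ind _ _) n hn => [|n _]; last exact: ord_succ.
  by split=> y /in_emp.
Qed.

Lemma nat_in n x : is_nat n -> x ∈ n -> is_nat x.
Proof.
  move=> hn; move: x; set_induct (@nat_ind _ _) n hn => [|n hn IH] x; first by move=> /in_emp.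
  by rewrite in_succ => -[/IH|->].
Qed.

Lemma omega_sub m : ord m -> ~ is_nat m -> omega ⊆ m.
Proof.
  move=> om hm z /in_omega hz.
  case: (ord_trichotomy z m (nat_ord _ hz) om) => [//|[e|/(nat_in _ _ hz)]] //.
  by rewrite e in hz.
Qed.

End Ordinals.

(** * Recursion along a definable well-order *)

Section Recursion.
Context {V : structure} {hZF : ZF V}.
Implicit Types (a b c f g h m n p q s u v w x y z : V).

(** [M] may be a proper class, so [wo_wf] speaks of sets only. As [seg] makes initial segments sets,
    least elements of definable classes follow in [wo_min]. *)
Class wellorder (M : V -> Prop) (lt : V -> V -> Prop) (seg : V -> V) : Prop := {
  wo_M : D1 M;
  wo_lt : D2 lt;
  wo_segT : T1 seg;
  wo_irr : forall x, ~ lt x x;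
  wo_trans : forall x y z, M x -> M y -> M z -> lt x y -> lt y z -> lt x z;
  wo_total : forall x y, M x -> M y -> lt x y \/ x = y \/ lt y x;
  wo_seg : forall x, M x -> forall z, z ∈ seg x <-> M z /\ lt z x;
  wo_wf : forall s, (forall x, x ∈ s -> M x) -> (exists x, x ∈ s) ->
    exists x, x ∈ s /\ forall y, y ∈ s -> ~ lt y x
}.

Context {M : V -> Prop} {lt : V -> V -> Prop} {seg : V -> V} {hwo : wellorder M lt seg}.

Let dM : D1 M := wo_M.
Let dlt : D2 lt := wo_lt.
Let dseg : T1 seg := wo_segT.
#[local] Existing Instance dM.
#[local] Existing Instance dlt.
#[local] Existing Instance dseg.

Lemma wo_min (Q : V -> Prop) {hQ : D1 Q} x : M x -> Q x ->
  exists y, M y /\ Q y /\ forall z, M z -> lt z y -> ~ Q z.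
Proof.
  move=> mx qx.
  have hs y : y ∈ add (seg x) x <-> M y /\ (lt y x \/ y = x).
    rewrite in_add wo_seg //; split=> [[|->]|]; tauto.
  have [z|| y] := wo_wf (sep (add (seg x) x) Q).
  - by rewrite in_sep hs; tauto.
  - by exists x; rewrite in_sep hs; tauto.
  - rewrite in_sep hs => -[[[my hy] qy] hmin]; exists y; split=> //; split=> // z mz hz qz.
    apply: (hmin z) => //; rewrite in_sep hs; split=> //; split=> //; left.
    by case: hy => [hy|<-] //; apply: wo_trans hz hy.
Qed.

Lemma wo_ind (Q : V -> Prop) {hQ : D1 Q} :
  (forall x, M x -> (forall z, M z -> lt z x -> Q z) -> Q x) -> forall x, M x -> Q x.
Proof.
  move=> IH x mx; apply: NNPP => nq.
  have [y [my [ny hy]]] := wo_min (fun x => ~ Q x) x mx nq.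
  by apply: ny; apply: IH => // z mz hz; apply: NNPP; apply: hy.
Qed.

Variable G : V -> V -> V.
Context {hG : T2 G}.

Definition restr h x : V := sep h (fun q => exists z y, q = pr z y /\ z ∈ seg x).

(** An approximation to the recursion: [h] is the graph of the solution strictly below [x], each
    value being computed from the part of [h] before it. *)
Definition attempt x h : Prop :=
  forall q, q ∈ h <-> exists z, z ∈ seg x /\ q = pr z (G z (restr h z)).

#[local] Instance T2_restr : T2 restr.
Proof. rewrite /restr; dsolve. Qed.
#[local] Instance D2_attempt : D2 attempt.
Proof. rewrite /attempt; dsolve. Qed.

Lemma in_restr h x q : q ∈ restr h x <-> q ∈ h /\ exists z y, q = pr z y /\ z ∈ seg x.
Proof. exact: in_sep. Qed.

Lemma restr_attempt x h z : M x -> attempt x h -> z ∈ seg x -> attempt z (restr h z).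
Proof.
  move=> mx hh hz q; rewrite in_restr hh.
  have [mz zx] : M z /\ lt z x by apply/wo_seg.
  have hsub y : y ∈ seg z -> y ∈ seg x /\ restr (restr h z) y = restr h y.
    rewrite !wo_seg // => -[my yz]; split; first by split=> //; apply: wo_trans yz zx.
    apply: ext => r; rewrite !in_restr; split=> [[[]]//|[hr hr']]; split=> //; split=> //.
    move: hr' => [u [v [-> hu]]]; exists u, v; split=> //; move: hu; rewrite !wo_seg //.
    by move=> [mu uy]; split=> //; apply: wo_trans uy yz.
  split=> [[[y [hy ->]] [y' [v [/pr_inj [<- _] hy']]]]|[y [hy ->]]].
    by exists y; split=> //; have [_ ->] := hsub y hy'.
  have [hy' ->] := hsub y hy; split; first by exists y.
  by exists y, (G y (restr h y)).
Qed.

Lemma attempt_unique x h h' : M x -> attempt x h -> attempt x h' -> h = h'.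
Proof.
  move=> mx hh hh'.
  have H z : M z -> lt z x -> restr h z = restr h' z.
    move=> mz; move: z mz; apply: wo_ind => z mz IH zx.
    have hz : z ∈ seg x by rewrite wo_seg.
    apply: ext => q; rewrite (restr_attempt x h z mx hh hz) (restr_attempt x h' z mx hh' hz).
    have E y : y ∈ seg z -> restr (restr h z) y = restr (restr h' z) y.
      rewrite wo_seg // => -[my yz].
      have R k : restr (restr k z) y = restr k y.
        apply: ext => r; rewrite !in_restr; split=> [[[]]//|[hr hr']]; split=> //; split=> //.
        move: hr' => [u [v [-> hu]]]; exists u, v; split=> //; move: hu; rewrite !wo_seg //.
        by move=> [mu uy]; split=> //; apply: wo_trans uy yz.
      by rewrite !R; apply: IH => //; apply: wo_trans yz zx.
    by split=> -[y [hy ->]]; exists y; rewrite E.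
  apply: ext => q; rewrite hh hh'.
  by split=> -[z [hz ->]]; exists z; split=> //; move: hz; rewrite wo_seg // => -[mz zx]; rewrite H.
Qed.

Definition history x : V := the (attempt x).
Definition wo_rec x : V := G x (history x).

#[export] Instance T1_history : T1 history.
Proof. rewrite /history; dsolve. Qed.
#[export] Instance T1_wo_rec : T1 wo_rec.
Proof. rewrite /wo_rec; dsolve. Qed.

Lemma wo_recE x : wo_rec x = G x (history x).
Proof. by []. Qed.

Lemma history_attempt x : M x -> attempt x (history x).
Proof.
  move: x; apply: wo_ind => x mx IH.
  have eqH z h : M z -> attempt z h -> history z = h.
    by move=> mz hh; apply: the_eq => // h' hh'; apply: attempt_unique hh' hh.
  have HE z : M z -> lt z x -> forall q, q ∈ history z <-> exists y, y ∈ seg z /\ q = pr y (wo_rec y).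
    move=> mz zx q; rewrite (IH z mz zx).
    have E y : y ∈ seg z -> restr (history z) y = history y.
      move=> hy; symmetry; apply: eqH; first by move: hy; rewrite wo_seg // => -[].
      exact: restr_attempt (IH z mz zx) hy.
    by split=> -[y [hy ->]]; exists y; rewrite /wo_rec E.
  have [h hh] : exists h, forall q, q ∈ h <-> exists z, z ∈ seg x /\ q = pr z (wo_rec z).
    by apply: repl_ex => z q q' _ -> ->.
  have hr z : z ∈ seg x -> restr h z = history z.
    rewrite wo_seg // => -[mz zx]; apply: ext => q; rewrite in_restr hh HE //; split.
      by move=> [[y [hy ->]] [y' [v [/pr_inj [<- _] hy']]]]; exists y.
    move=> [y [hy ->]]; split; last by exists y, (wo_rec y).
    exists y; split=> //; move: hy; rewrite !wo_seg // => -[my yz]; split=> //.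
    exact: wo_trans yz zx.
  have ah : attempt x h by move=> q; rewrite hh; split=> -[z [hz ->]]; exists z; rewrite hr.
  by rewrite (eqH x h).
Qed.

Lemma in_history x q : M x ->
  q ∈ history x <-> exists y, y ∈ seg x /\ q = pr y (wo_rec y).
Proof.
  move=> mx; rewrite (history_attempt x mx).
  have E y : y ∈ seg x -> restr (history x) y = history y.
  { move=> hy; apply: (attempt_unique y).
    - by move: hy; rewrite wo_seg // => -[].
    - exact: restr_attempt (history_attempt x mx) hy.
    - by apply: history_attempt; move: hy; rewrite wo_seg // => -[]. }
  by split=> -[y [hy ->]]; exists y; rewrite /wo_rec E.
Qed.

Lemma app_history x z : M x -> z ∈ seg x -> app (history x) z = wo_rec z.
Proof.
  move=> mx hz; apply: app_eq => [y|]; rewrite mapsE in_history //.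
    by move=> [z' [_ /pr_inj [-> ->]]].
  by exists z.
Qed.

End Recursion.

#[global] Opaque history wo_rec.

(** * Finite subsets of a well-order, compared at the largest difference *)

Section FiniteSubsets.
Context {V : structure} {hZF : ZF V}.
Implicit Types (a b c f g h l m n p q s u v w x y z : V).

Definition finset (M : V -> Prop) x : Prop := fin x /\ forall a, a ∈ x -> M a.

Definition flt (lt : V -> V -> Prop) x y : Prop :=
  exists a, a ∈ y /\ a ∉ x /\ forall b, lt a b -> (b ∈ x <-> b ∈ y).

Definition below (seg : V -> V) x : V :=
  the (fun t => forall b, b ∈ t <-> exists a, a ∈ x /\ b ∈ seg a).

(** An element of a predecessor of [x] either exceeds the largest difference, and is then in [x], or
    lies below an element of [x]. This bound by a power set is what makes the segment a set. *)
Definition fseg (M : V -> Prop) (lt : V -> V -> Prop) (seg : V -> V) x : V :=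
  sep (pow (cup x (below seg x))) (fun y => finset M y /\ flt lt y x).

Context {M : V -> Prop} {lt : V -> V -> Prop} {seg : V -> V} {hwo : wellorder M lt seg}.

Let dM : D1 M := wo_M.
Let dlt : D2 lt := wo_lt.
Let dseg : T1 seg := wo_segT.
#[local] Existing Instance dM.
#[local] Existing Instance dlt.
#[local] Existing Instance dseg.

Lemma D1_finset : D1 (finset M).
Proof. rewrite /finset; dsolve. Qed.
#[local] Existing Instance D1_finset.
Lemma D2_flt : D2 (flt lt).
Proof. rewrite /flt; dsolve. Qed.
#[local] Existing Instance D2_flt.
Lemma T1_below : T1 (below seg).
Proof. rewrite /below; dsolve. Qed.
#[local] Existing Instance T1_below.
Lemma T1_fseg : T1 (fseg M lt seg).
Proof. rewrite /fseg; dsolve. Qed.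

Lemma in_below x b : b ∈ below seg x <-> exists a, a ∈ x /\ b ∈ seg a.
Proof.
  apply: the_set; have [t ht] : exists t, forall y, y ∈ t <-> exists a, a ∈ x /\ y = seg a.
    by apply: repl_ex => ? ? ? _ -> ->.
  exists (union t) => z; rewrite in_union; split.
    by move=> [y [/ht [a [ha ->]] hz]]; exists a.
  by move=> [a [ha hz]]; exists (seg a); rewrite ht; split=> //; exists a.
Qed.

Definition bounded x m : Prop := forall a, a ∈ x -> a = m \/ lt a m.

Let D2_bounded : D2 bounded.
Proof. rewrite /bounded; dsolve. Qed.
#[local] Existing Instance D2_bounded.

Lemma wo_asym x y : M x -> M y -> lt x y -> ~ lt y x.
Proof. by move=> mx my h1 h2; apply: (wo_irr x); apply: wo_trans h1 h2. Qed.

Lemma finset_max x : finset M x -> x <> emp -> exists m, m ∈ x /\ bounded x m.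
Proof.
  move=> [hx]; rewrite /bounded; set_induct (@fin_ind _ _) x hx => [|x a _ _ IH] hm hne //.
  have ma : M a by apply: hm; rewrite in_add; right.
  have mx b : b ∈ x -> M b by move=> hb; apply: hm; rewrite in_add; left.
  case: (classic (x = emp)) => [e|/(IH mx) [m [hmx bm]]].
    exists a; split=> [|z]; rewrite in_add e; first by right.
    by move=> [/in_emp []|->]; left.
  case: (wo_total a m ma (mx m hmx)) => [am|[->|am]].
  - by exists m; split=> [|z]; rewrite in_add; [left | move=> [/bm|->]; auto].
  - by exists m; split=> [|z]; rewrite in_add; [left | move=> [/bm|->]; auto].
  - exists a; split=> [|z]; rewrite in_add; first by right.
    move=> [hz|->]; auto; right; case: (bm z hz) => [->|zm] //.
    by apply: (wo_trans z m a); auto.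
Qed.

Lemma flt_irr x : ~ flt lt x x.
Proof. by move=> [a [h1 [h2 _]]]. Qed.

Lemma flt_trans x y z : finset M x -> finset M y -> finset M z ->
  flt lt x y -> flt lt y z -> flt lt x z.
Proof.
  move=> [_ hx] [_ hy] [_ hz] [a [ay [nax ha]]] [b [bz [nby hb]]].
  have ma := hy a ay; have mb := hz b bz.
  have T c d e : M c -> M d -> (e ∈ x \/ e ∈ y \/ e ∈ z) -> lt c d -> lt d e -> lt c e.
    move=> mc md he; apply: wo_trans => //; case: he => [/hx|[/hy|/hz]] //.
  have D c : lt a c -> lt b c -> (c ∈ x <-> c ∈ z) by move=> /ha -> /hb ->.
  case: (wo_total a b ma mb) => [ab|[e|ba]].
  - exists b; split=> //; split; first by rewrite ha.
    move=> c bc; case: (classic (c ∈ x \/ c ∈ y \/ c ∈ z)) => [hc|]; last tauto.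
    by apply: D => //; apply: (T a b).
  - by rewrite e in ay.
  - exists a; split; first by rewrite -hb.
    split=> // c ac; case: (classic (c ∈ x \/ c ∈ y \/ c ∈ z)) => [hc|]; last tauto.
    by apply: D => //; apply: (T b a).
Qed.

Lemma flt_total x y : finset M x -> finset M y -> flt lt x y \/ x = y \/ flt lt y x.
Proof.
  move=> [fx hx] [fy hy].
  have hd z : z ∈ cup (diff x y) (diff y x) <-> (z ∈ x /\ z ∉ y) \/ (z ∈ y /\ z ∉ x)
    by rewrite in_cup !in_diff.
  case: (classic (cup (diff x y) (diff y x) = emp)) => [e|].
    right; left; apply: ext => z; have := hd z; rewrite e in_emp.
    by case: (classic (z ∈ x)); case: (classic (z ∈ y)); tauto.
  case/finset_max.
    split; last by move=> a /hd [[/hx]|[/hy]].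
    by apply: (fin_sub (cup x y)); [exact: fin_cup|move=> z /hd; rewrite in_cup; tauto].
  move=> m [/hd hm bm].
  have mm : M m by case: hm => [[/hx]|[/hy]].
  have H b : lt m b -> (b ∈ x <-> b ∈ y).
    move=> mb; apply: NNPP => hb.
    have hb' : b ∈ cup (diff x y) (diff y x) by rewrite hd; tauto.
    have Mb : M b by move: hb'; rewrite hd => -[[/hx]|[/hy]].
    case: (bm b hb') => [e|/(wo_asym _ _ mm Mb mb)] //.
    by rewrite e in mb; apply: wo_irr mb.
  case: hm => -[h1 h2]; [right; right|left]; exists m; split=> //; split=> // b /H; tauto.
Qed.

Definition has_least s : Prop := exists x, x ∈ s /\ forall y, y ∈ s -> ~ flt lt y x.

Let D1_has_least : D1 has_least.
Proof. rewrite /has_least; dsolve. Qed.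
#[local] Existing Instance D1_has_least.

(** A set smaller than [l] agrees with [l] above their largest difference, so it is bounded by [m]
    whenever [l] is. *)
Lemma least_bounded s x m : (forall y, y ∈ s -> finset M y) -> x ∈ s -> m ∈ x -> bounded x m ->
  has_least (sep s (fun y => bounded y m)) -> has_least s.
Proof.
  move=> hs xs mx bx [l []]; rewrite in_sep => -[ls bl] hl; exists l; split=> // y ys yl.
  have [_ hy] := hs y ys; have [_ hx] := hs x xs; have [_ hl'] := hs l ls.
  apply: (hl y) => //; rewrite in_sep; split=> // b hb.
  move: yl => [a [al [nay ha]]].
  have mm := hx m mx; have mb := hy b hb; have ma := hl' a al.
  case: (wo_total b m mb mm) => [|[|mb']]; auto.
  have ab : lt a b by case: (bl a al) => [->|am] //; apply: wo_trans am mb'.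
  have : b ∈ l by rewrite -ha.
  move=> /bl [e|bm]; first by rewrite e in mb'; case: (wo_irr m).
  by case: (wo_asym b m).
Qed.

(** The largest element [m'] of a member omitting [m] is below [m], so the induction hypothesis
    applies to the members bounded by [m']. *)
Lemma least_step m s : M m ->
  (forall m', M m' -> lt m' m -> forall s, (forall y, y ∈ s -> finset M y /\ bounded y m') ->
     (exists x, x ∈ s) -> has_least s) ->
  (forall y, y ∈ s -> finset M y /\ bounded y m) ->
  (exists x, x ∈ s /\ m ∉ x) -> has_least s.
Proof.
  move=> mm IH hs [x [xs nmx]].
  have fs y : y ∈ s -> finset M y by move=> /hs [].
  case: (classic (x = emp)) => [e|ne].
    by exists x; split=> // y _ [a []]; rewrite e in_emp.
  have [m' [hm' bm']] := finset_max x (fs x xs) ne.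
  apply: (least_bounded s x m') => //; apply: (IH m').
  - by have [_] := fs x xs; apply.
  - by have [_ bx] := hs x xs; case: (bx m' hm') => // e; rewrite e in hm'.
  - by move=> y; rewrite in_sep => -[/fs].
  - by exists x; rewrite in_sep.
Qed.

(** Induction on the bound. If every member contains [m], deleting [m] from all of them preserves
    the order and leads back to [least_step]. *)
Lemma least_bounded_family m : M m -> forall s,
  (forall y, y ∈ s -> finset M y /\ bounded y m) -> (exists x, x ∈ s) -> has_least s.
Proof.
  move: m; apply: wo_ind => m mm IH s hs [x0 hx0].
  case: (classic (exists x, x ∈ s /\ m ∉ x)) => [|hm]; first exact: least_step IH hs.
  have {}hm x : x ∈ s -> m ∈ x by move=> hx; apply: NNPP => h; apply: hm; exists x.
  pose (s' := sep (pow (union s)) (fun z => m ∉ z /\ add z m ∈ s)).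
  have hs' z : z ∈ s' <-> m ∉ z /\ add z m ∈ s.
    rewrite in_sep in_pow; split=> [[]//|[h1 h2]]; split=> // t ht; rewrite in_union.
    by exists (add z m); rewrite in_add; auto.
  have hd x : x ∈ s -> diff x (sing m) ∈ s'.
    by move=> hx; rewrite hs' in_diff in_sing -add_diff; [auto|]; split=> //; tauto.
  have : has_least s'.
    apply: (least_step m) => // [y /hs' [ny /hs [[fy hy] by_]]|].
      split; [split|] => [|a ha|a ha]; [|apply: hy|apply: by_]; rewrite ?in_add; auto.
      by apply: (fin_sub _ _ fy) => z; rewrite in_add; left.
    exists (diff x0 (sing m)); split; first exact: hd.
    by rewrite in_diff in_sing; tauto.
  move=> [l [/hs' [nl ls] hl]]; exists (add l m); split=> // y ys [a [al [nay ha]]].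
  have am : a <> m by move=> e; apply: nay; rewrite e; apply: hm.
  apply: (hl _ (hd y ys)); exists a; split; first by case/in_add: al.
  split; first by rewrite in_diff; tauto.
  move=> b /ha; rewrite in_diff in_sing in_add.
  by case: (classic (b = m)) => [->|]; tauto.
Qed.

(** Stated for any well-order because it is iterated: it orders the indices, which are finite sets
    of ordinals, and then the finite sets [Z] of indices among which a least one is taken. *)
#[export] Instance finset_wellorder : wellorder (finset M) (flt lt) (fseg M lt seg).
Proof.
  split.
  - exact: D1_finset.
  - exact: D2_flt.
  - exact: T1_fseg.
  - exact: flt_irr.
  - exact: flt_trans.
  - exact: flt_total.
  - move=> x [fx hx] y; rewrite in_sep in_pow; split=> [[]//|[[fy hy] yx]]; split=> // b hb.
    rewrite in_cup in_below; have mb := hy b hb.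
    move: yx => [a [ax [nay ha]]]; have ma := hx a ax.
    case: (wo_total b a mb ma) => [ba|[->|ab]]; auto.
    + by right; exists a; rewrite wo_seg.
    + by left; rewrite -ha.
  - move=> s hs [x xs]; case: (classic (x = emp)) => [e|ne].
      by exists x; split=> // y _ [a []]; rewrite e in_emp.
    have [m [mx bm]] := finset_max x (hs x xs) ne.
    apply: (least_bounded s x m) => //; apply: (least_bounded_family m).
    + by have [_] := hs x xs; apply.
    + by move=> y; rewrite in_sep => -[/hs].
    + by exists x; rewrite in_sep.
Qed.

End FiniteSubsets.

(** * Ordinals and natural numbers as well-orders; doubling *)

Section OrdinalOrders.
Context {V : structure} {hZF : ZF V}.
Implicit Types (a b c f g h m n p q s u v w x y z : V).

#[export] Instance ord_wellorder : wellorder ord (@mem V) (fun x => x).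
Proof.
  split; try exact _.
  - exact: notin_self.
  - move=> x y z _ _; exact: ord_trans.
  - exact: ord_trichotomy.
  - by move=> x ox z; split=> [hz|[]] //; split=> //; apply: ord_in hz.
  - move=> s _ /(ZF_foundation V hZF) [y [ys h]]; exists y; split=> // z zs zy.
    exact: (h z).
Qed.

#[export] Instance nat_wellorder : wellorder (@is_nat V) (@mem V) (fun x => x).
Proof.
  split; try exact _.
  - exact: notin_self.
  - by move=> x y z _ _ /nat_ord; apply: ord_trans.
  - by move=> x y /nat_ord ox /nat_ord; apply: ord_trichotomy.
  - by move=> x ox z; split=> [hz|[]] //; split=> //; apply: nat_in hz.
  - move=> s _ /(ZF_foundation V hZF) [y [ys h]]; exists y; split=> // z zs zy.
    exact: (h z).
Qed.

Definition double_step n h : V :=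
  the (fun y => (n = emp /\ y = emp) \/
                exists k, is_nat k /\ n = succ k /\ y = succ (succ (app h k))).

#[local] Instance T2_double_step : T2 double_step.
Proof. rewrite /double_step; dsolve. Qed.

Lemma double_sig : { d : V -> V | T1 d /\ d emp = emp /\
  forall n, is_nat n -> d (succ n) = succ (succ (d n)) }.
Proof.
  apply: constructive_indefinite_description.
  exists (wo_rec (seg := fun x => x) double_step); split; first exact: T1_wo_rec.
  split=> [|n hn].
    apply: the_eq; first by left.
    move=> z [[]//|[k [_ [e _]]]]; have : k ∈ emp by rewrite e in_succ; right.
    by rewrite in_emp.
  have hSn : is_nat (succ n) by exact: nat_succ.
  have hin : n ∈ succ n by rewrite in_succ; right.
  have e : app (history (seg := fun x => x) double_step (succ n)) n =
      wo_rec (seg := fun x => x) double_step n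
    by exact: (app_history (hwo := nat_wellorder)).
  apply: the_eq.
    by right; exists n; split; [exact: hn | split; [reflexivity | rewrite e; reflexivity]].
  move=> z [[e' _]|[k [hk [/succ_inj <- ->]]]]; last by rewrite e; reflexivity.
  by exfalso; rewrite e' in_emp in hin.
Qed.

Definition double : V -> V := proj1_sig double_sig.

#[export] Instance T1_double : T1 double.
Proof. by have [] := proj2_sig double_sig. Qed.

Lemma double0 : double emp = emp.
Proof. by have [_ []] := proj2_sig double_sig. Qed.

Lemma doubleS n : is_nat n -> double (succ n) = succ (succ (double n)).
Proof. by have [_ [_]] := proj2_sig double_sig; apply. Qed.

Lemma nat_double n : is_nat n -> is_nat (double n).
Proof.
  move=> hn; set_induct (@nat_ind _ _) n hn => [|n hn IH].
    by rewrite double0; apply: nat_emp.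
  by rewrite doubleS //; apply/nat_succ/nat_succ.
Qed.

Lemma double_lt i j : is_nat j -> i ∈ j -> succ (double i) ∈ double j.
Proof.
  move=> hj; move: i; set_induct (@nat_ind _ _) j hj => [|j hj IH] i; first by move=> /in_emp.
  rewrite (doubleS j hj) !in_succ => -[/IH h|->]; [by left; left | by right].
Qed.

Lemma double_inj i j : is_nat i -> is_nat j -> double i = double j -> i = j.
Proof.
  have H i' j' : is_nat j' -> i' ∈ j' -> double i' <> double j'.
    move=> hj' /(double_lt _ _ hj') h e; apply: (no_two_cycle _ _ h); rewrite e in_succ; auto.
  move=> hi hj e; case: (ord_trichotomy i j (nat_ord _ hi) (nat_ord _ hj)) => [h|[//|h]].
    by case: (H i j).
  by case: (H j i).
Qed.

Lemma double_odd i j : is_nat i -> is_nat j -> double i <> succ (double j).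
Proof.
  move=> hi hj e; case: (ord_trichotomy i j (nat_ord _ hi) (nat_ord _ hj)) => [h|[h|h]].
  - have k := double_lt _ _ hj h.
    have o : ord (double j) by apply/nat_ord/nat_double.
    have : double i ∈ double j by apply: ord_trans o _ k; rewrite in_succ; right.
    by rewrite e => k'; apply: (no_two_cycle _ _ k'); rewrite in_succ; right.
  - by rewrite h in e; apply: (notin_self (double j)); rewrite {2}e in_succ; right.
  - have := double_lt _ _ hi h; rewrite e; exact: notin_self.
Qed.

End OrdinalOrders.

#[global] Opaque below fseg.

(** * Permutations *)

Section Permutations.
Context {V : structure} {hZF : ZF V}.
Implicit Types (A a b c f g h p q s u v w x y z : V).

(** Agrees with [mov] for permutations of [A] but does not mention [A], so that ranks depend on the
    sequence alone. *)
Definition mv s x : Prop := exists y, maps s x y /\ y <> x.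

#[export] Instance D2_mv : D2 mv.
Proof. rewrite /mv; dsolve. Qed.

Lemma perm_dom A s x y : permutations A s -> maps s x y -> x ∈ A /\ y ∈ A.
Proof.
  move=> [[[h _] _] _] [p [/is_opairE -> /h [x' [y' [hx [hy]]]]]].
  by move=> /is_opairE /pr_inj [-> ->].
Qed.

Lemma perm_fun A s x y y' : permutations A s -> maps s x y -> maps s x y' -> y = y'.
Proof.
  move=> hs h1 h2; have [hx _] := perm_dom _ _ _ _ hs h1.
  move: hs => [[[_ h] _] _]; have [z [_ hz]] := h x hx.
  by rewrite -(hz y h1) -(hz y' h2).
Qed.

Lemma perm_inj A s x x' y : permutations A s -> maps s x y -> maps s x' y -> x = x'.
Proof. move=> [[_ h] _]; exact: h. Qed.

Lemma perm_tot A s x : permutations A s -> x ∈ A -> exists y, maps s x y.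
Proof. by move=> [[[_ h] _] _] /h [y [hy _]]; exists y. Qed.

Lemma perm_intro A s : (forall p, p ∈ s -> p ∈ prod A A) ->
  (forall x, x ∈ A -> exists y, maps s x y) ->
  (forall x y y', maps s x y -> maps s x y' -> y = y') ->
  (forall x x' y, maps s x y -> maps s x' y -> x = x') ->
  (forall y, y ∈ A -> exists x, maps s x y) -> permutations A s.
Proof.
  move=> h1 h2 h3 h4 h5; split=> //; split=> //; split.
    move=> p /h1 /in_prod [x [y [hx [hy ->]]]]; exists x, y; split=> //; split=> //.
    by apply/is_opairE.
  by move=> x /h2 [y hy]; exists y; split=> // y'; apply: h3.
Qed.

Lemma perm_ext A s s' : permutations A s -> permutations A s' ->
  (forall x y, maps s x y -> maps s' x y) -> s = s'.
Proof.
  move=> hs hs' h.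
  have h' x y : maps s' x y -> maps s x y.
    move=> hxy; have [hx _] := perm_dom _ _ _ _ hs' hxy.
    have [y' hy'] := perm_tot _ _ _ hs hx.
    by rewrite (perm_fun _ _ _ _ _ hs' hxy (h _ _ hy')).
  have P t p : permutations A t -> p ∈ t -> exists x y, p = pr x y.
    by move=> [[[k _] _] _] /k [x [y [_ [_ /is_opairE]]]]; exists x, y.
  apply: ext => p; split=> hp.
    by have [x [y e]] := P s p hs hp; move: hp; rewrite e -!mapsE; apply: h.
  by have [x [y e]] := P s' p hs' hp; move: hp; rewrite e -!mapsE; apply: h'.
Qed.

Lemma mv_mov A s x : permutations A s -> mv s x <-> mov A s x.
Proof.
  move=> hs; split=> [[y [hy ne]]|[hx h]].
    split; first by have [] := perm_dom _ _ _ _ hs hy.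
    by move=> hxx; apply: ne; apply: perm_fun hs hy hxx.
  have [y hy] := perm_tot _ _ _ hs hx; exists y; split=> // e.
  by rewrite e in hy.
Qed.

Definition movset A s : V := sep A (mv s).

#[export] Instance T2_movset : T2 movset.
Proof. rewrite /movset; dsolve. Qed.

Lemma in_movset A s x : permutations A s -> x ∈ movset A s <-> mv s x.
Proof.
  move=> hs; rewrite in_sep; split=> [[]//|h]; split=> //.
  by move: h => [y [/(perm_dom _ _ _ _ hs) []]].
Qed.

Lemma mv_image A s x y : permutations A s -> mv s x -> maps s x y -> mv s y.
Proof.
  move=> hs [y' [h ne]] hy; have [_ Ay] := perm_dom _ _ _ _ hs hy.
  have [z hz] := perm_tot _ _ _ hs Ay; exists z; split=> // e.
  rewrite e in hz; apply: ne; rewrite (perm_fun _ _ _ _ _ hs h hy).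
  exact: (perm_inj _ _ _ _ _ hs hz hy).
Qed.

End Permutations.

(** * Splitting a decreasing injection into two matchings *)

Section Kernel.
Context {V : structure} {hZF : ZF V}.
Implicit Types (c u v w x y z eta zeta : V).

(** The points at odd distance from the start of their [g]-chain. *)
Definition ker (g : V -> V -> Prop) x : Prop :=
  exists c, x ∈ c /\ forall y, y ∈ c -> exists z, g y z /\ forall w, g z w -> w ∈ c.

Context {M : V -> Prop} {lt : V -> V -> Prop} {seg : V -> V} {hwo : wellorder M lt seg}.
Variables (g r : V -> V -> Prop).
Context {hg : D2 g} {hr : D2 r}.
Hypothesis g_fun : forall x y y', g x y -> g x y' -> y = y'.
Hypothesis g_dec : forall x y, g x y ->
  exists eta zeta, M eta /\ M zeta /\ r x eta /\ r y zeta /\ lt zeta eta.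
Hypothesis r_fun : forall x eta zeta, r x eta -> r x zeta -> eta = zeta.

(** With witnesses [c] for [x] and [c'] for [y], two further steps along [g] lead to an arrow whose
    ends lie again in [c] and [c'], at smaller rank. A least rank is thus impossible. *)
Lemma ker_disjoint x y : g x y -> ker g x -> ~ ker g y.
Proof.
  move=> gxy [c [xc hc]] [c' [yc' hc']].
  have [eta [_ [me [_ [re _]]]]] := g_dec x y gxy.
  have [e0 [me0 [[x0 [y0 [x0c [y0c' [g0 r0]]]]] hm]]] :=
    wo_min (fun e => exists x y, x ∈ c /\ y ∈ c' /\ g x y /\ r x e) eta me
      (ex_intro _ x (ex_intro _ y (conj xc (conj yc' (conj gxy re))))).
  have [z [gz hz]] := hc x0 x0c; have e := g_fun _ _ _ g0 gz; subst z.
  have [z [gyz hz']] := hc' y0 y0c'.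
  have zc := hz z gyz.
  have [w [gzw _]] := hc z zc.
  have wc' := hz' w gzw.
  have [e1 [e2 [m1 [m2 [r1 [r2 l12]]]]]] := g_dec _ _ g0.
  have [e3 [e4 [m3 [m4 [r3 [r4 l34]]]]]] := g_dec _ _ gyz.
  apply: (hm e4) => //.
    rewrite (r_fun _ _ _ r0 r1); apply: wo_trans l34 _ => //.
    by rewrite (r_fun _ _ _ r3 r2).
  by exists z, w.
Qed.

(** Induction on the rank of [x]. If [y] has an image [z], either [ker g y] holds or a witness for
    [z] becomes one for [x] by adding [x]; if [y] has none, [sing x] is a witness. *)
Lemma ker_cover x y : g x y -> ker g x \/ ker g y.
Proof.
  move=> gxy; have [eta [_ [me [_ [re _]]]]] := g_dec x y gxy.
  suff H : forall x, r x eta -> forall y, g x y -> ker g x \/ ker g y by exact: (H x re y gxy).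
  have dker : D1 (ker g) by rewrite /ker; dsolve.
  move: eta me {re}; apply: wo_ind => eta me IH {gxy}{}x re {}y gxy.
  case: (classic (exists z, g y z)) => [[z gyz]|hn].
    have [e1 [e2 [m1 [m2 [r1 [r2 l12]]]]]] := g_dec _ _ gxy.
    rewrite -(r_fun _ _ _ re r1) in l12.
    case: (IH e2 m2 l12 y r2 z gyz) => [|[c [zc hc]]]; first by right.
    left; exists (add c x); split; first by rewrite in_add; right.
    move=> u; rewrite in_add => -[/hc [v [guv hv]]|->].
      by exists v; split=> // w /hv; rewrite in_add; left.
    exists y; split=> // w /(g_fun _ _ _ gyz) <-; rewrite in_add; by left.
  left; exists (sing x); split; first by rewrite in_sing.
  move=> u /in_sing ->; exists y; split=> // w gyw; case: hn; by exists w.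
Qed.

End Kernel.

(** * Labelled permutations from an independent sequence *)

Section Labels.
Context {V : structure} {hZF : ZF V}.
Implicit Types (A F h i p s u v w x y z eta zeta xi : V).

Definition L : V -> Prop := finset ord.
Definition ltL : V -> V -> Prop := flt (@mem V).
Definition segL : V -> V := fseg ord (@mem V) (fun x => x).

#[export] Instance L_wellorder : wellorder L ltL segL.
Proof. exact: finset_wellorder. Qed.
#[export] Instance D2_ltL : D2 ltL.
Proof. exact: wo_lt. Qed.
#[export] Instance T1_segL : T1 segL.
Proof. exact: wo_segT. Qed.

Fixpoint num (n : nat) : V := match n with O => emp | S m => succ (num m) end.

Lemma in_num n x : x ∈ num n <-> exists m, m < n /\ x = num m.
Proof.
  elim: n => [|n IH] /=; first by rewrite in_emp; split=> // -[m []]; lia.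
  rewrite in_succ IH; split=> [[[m [hm ->]]|->]|[m [hm ->]]].
  - by exists m; split=> //; lia.
  - by exists n; split=> //; lia.
  - case: (Compare_dec.le_lt_dec n m) => hnm; last by left; exists m.
    by right; have -> : m = n by lia.
Qed.

Lemma num_inj m n : num m = num n -> m = n.
Proof.
  move=> e; have H k l : k < l -> num k <> num l.
    by move=> hkl e'; apply: (notin_self (num l)); rewrite in_num; exists k.
  case: (Compare_dec.lt_eq_lt_dec m n) => [[|]//|] hmn; first by case: (H m n).
  by case: (H n m).
Qed.

Lemma nat_num n : is_nat (num n).
Proof. elim: n => [|n IH]; [exact: nat_emp | exact: nat_succ]. Qed.

(** [h] is a sequence of permutations indexed by [F]; the rank of a point is the
    first index moving it. *)
Definition rk F h x eta : Prop := eta ∈ F /\ mv (app h eta) x /\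
  forall zeta, zeta ∈ F -> ltL zeta eta -> ~ mv (app h zeta) x.

#[export] Instance D4_rk : D4 rk.
Proof. rewrite /rk; dsolve. Qed.

(** [app h eta] also moves the image [y] of [x], so the rank of [y] is at most that of [x]. [reg] is
    the case of a drop, and [loop] says that no point of rank [eta] drops. *)
Definition reg F h x y : Prop := exists eta zeta,
  rk F h x eta /\ maps (app h eta) x y /\ rk F h y zeta /\ ltL zeta eta.

#[export] Instance D4_reg : D4 reg.
Proof. rewrite /reg; dsolve. Qed.

Definition loop F h eta : Prop :=
  forall x y, rk F h x eta -> maps (app h eta) x y -> rk F h y eta.

#[export] Instance D3_loop : D3 loop.
Proof. rewrite /loop; dsolve. Qed.

(** Points with the same image [y] under [reg] have distinct ranks; [gnext] sends such a
    point to the one preceding it, and [glast] sends the last one to [y]. *)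
Definition gnext F h x' x : Prop := exists y eta zeta,
  reg F h x y /\ reg F h x' y /\ rk F h x eta /\ rk F h x' zeta /\ ltL eta zeta /\
  forall z theta, reg F h z y -> rk F h z theta -> ltL eta theta -> ~ ltL theta zeta.

Definition glast F h x y : Prop := reg F h x y /\
  forall z eta theta, rk F h x eta -> reg F h z y -> rk F h z theta -> ~ ltL eta theta.

#[export] Instance D4_gnext : D4 gnext.
Proof. rewrite /gnext; dsolve. Qed.
#[export] Instance D4_glast : D4 glast.
Proof. rewrite /glast; dsolve. Qed.

(** Labels are placed so that a point [x] with [reg F h x y] has its rank used: on the edge entering
    [x] from the next point with image [y] if there is one, and otherwise on the edge from [x] to
    [y]. The parity given by [ker] turns each of [gnext] and [glast] into two matchings. *)
Definition edge F h i eta u v : Prop :=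
  (i = num 1 /\ gnext F h u v /\ ker (gnext F h) u /\ rk F h v eta) \/
  (i = num 2 /\ gnext F h u v /\ ~ ker (gnext F h) u /\ rk F h v eta) \/
  (i = num 3 /\ glast F h u v /\ ker (glast F h) u /\ rk F h u eta) \/
  (i = num 4 /\ glast F h u v /\ ~ ker (glast F h) u /\ rk F h u eta).

(** For each [i] the arrows are the graph of a permutation of its support, whose label [eta]
    is constant along cycles. *)
Definition arrow F h i eta x y : Prop :=
  (i = num 0 /\ loop F h eta /\ rk F h x eta /\ maps (app h eta) x y) \/
  edge F h i eta x y \/ edge F h i eta y x.

#[export] Instance D6_edge : D6 edge.
Proof. rewrite /edge /ker; dsolve. Qed.
#[export] Instance D6_arrow : D6 arrow.
Proof. rewrite /arrow; dsolve. Qed.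

Definition tperm A F h i Z : V :=
  sep (prod A A) (fun p => exists x y, p = pr x y /\
    ((exists eta, eta ∈ Z /\ arrow F h i eta x y) \/
     (y = x /\ ~ exists eta y', eta ∈ Z /\ arrow F h i eta x y'))).

#[export] Instance T4_tperm A : T4 (tperm A).
Proof. rewrite /tperm; dsolve. Qed.

Record independent A F h : Prop := {
  ind_L : forall eta, eta ∈ F -> L eta;
  ind_perm : forall eta, eta ∈ F -> permutations A (app h eta);
  ind_fin : forall eta, eta ∈ F -> fin (movset A (app h eta));
  ind_rk : forall eta, eta ∈ F -> exists x, rk F h x eta
}.

Variables (A F h : V).
Hypothesis hI : independent A F h.

Let FL := ind_L _ _ _ hI.
Let hp := ind_perm _ _ _ hI.

Lemma rk_in x eta : rk F h x eta -> eta ∈ F.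
Proof. by case. Qed.

Lemma rk_A x eta : rk F h x eta -> x ∈ A.
Proof. by move=> [/hp he [[y [/(perm_dom _ _ _ _ he) []]]]]. Qed.

Lemma rk_fun x eta zeta : rk F h x eta -> rk F h x zeta -> eta = zeta.
Proof.
  move=> [h1 [h2 h3]] [k1 [k2 k3]].
  case: (wo_total eta zeta (FL _ h1) (FL _ k1)) => [l|[//|l]].
  - by case: (k3 eta).
  - by case: (h3 zeta).
Qed.

Lemma rk_ex eta x : eta ∈ F -> mv (app h eta) x -> exists zeta, rk F h x zeta /\
  (zeta = eta \/ ltL zeta eta).
Proof.
  move=> he hm.
  have [zeta [mz [[hz hmz] hmin]]] :=
    wo_min (M := L) (fun zeta => zeta ∈ F /\ mv (app h zeta) x) eta (FL _ he) (conj he hm).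
  have hrk : rk F h x zeta.
    by split=> //; split=> // z zF zl hmv; apply: (hmin z) => //; apply: FL.
  exists zeta; split=> //; case: (wo_total zeta eta (FL _ hz) (FL _ he)) => [|[|l]]; auto.
  by case: (hmin eta (FL _ he) l).
Qed.

Lemma reg_rk x y : reg F h x y -> exists eta zeta,
  L eta /\ L zeta /\ rk F h x eta /\ rk F h y zeta /\ ltL zeta eta.
Proof.
  move=> [eta [zeta [h1 [_ [h2 h3]]]]]; exists eta, zeta.
  by split; [apply: FL (rk_in _ _ h1)|split; [apply: FL (rk_in _ _ h2)|]].
Qed.

Lemma reg_fun x y y' : reg F h x y -> reg F h x y' -> y = y'.
Proof.
  move=> [e [_ [h1 [h2 _]]]] [e' [_ [k1 [k2 _]]]].
  rewrite -(rk_fun _ _ _ h1 k1) in k2; exact: perm_fun (hp _ (rk_in _ _ h1)) h2 k2.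
Qed.

Lemma reg_inj x x' y eta : reg F h x y -> reg F h x' y -> rk F h x eta -> rk F h x' eta -> x = x'.
Proof.
  move=> [e [_ [h1 [h2 _]]]] [e' [_ [k1 [k2 _]]]] h3 k3.
  rewrite -(rk_fun _ _ _ k3 k1) in k2; rewrite -(rk_fun _ _ _ h3 h1) in h2.
  exact: perm_inj (hp _ (rk_in _ _ h3)) h2 k2.
Qed.

Lemma gnext_fun x y y' : gnext F h x y -> gnext F h x y' -> y = y'.
Proof.
  move=> [z [e [k [r1 [r2 [e1 [e2 [l m]]]]]]]] [z' [e' [k' [r1' [r2' [e1' [e2' [l' m']]]]]]]].
  rewrite -(reg_fun _ _ _ r2 r2') in r1' m' => {r2' z'}.
  rewrite -(rk_fun _ _ _ e2 e2') in l' m' => {e2' k'}.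
  case: (wo_total e e' (FL _ (rk_in _ _ e1)) (FL _ (rk_in _ _ e1'))) => [q|[q|q]].
  - by case: (m y' e').
  - by rewrite -q in e1'; apply: reg_inj r1 r1' e1 e1'.
  - by case: (m' y e).
Qed.

Lemma gnext_inj x x' y : gnext F h x y -> gnext F h x' y -> x = x'.
Proof.
  move=> [z [e [k [r1 [r2 [e1 [e2 [l m]]]]]]]] [z' [e' [k' [r1' [r2' [e1' [e2' [l' m']]]]]]]].
  rewrite -(reg_fun _ _ _ r1 r1') in r2' m' => {r1' z'}.
  rewrite -(rk_fun _ _ _ e1 e1') in l' m' => {e1' e'}.
  case: (wo_total k k' (FL _ (rk_in _ _ e2)) (FL _ (rk_in _ _ e2'))) => [q|[q|q]].
  - by case: (m' x k).
  - by rewrite -q in e2'; apply: reg_inj r2 r2' e2 e2'.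
  - by case: (m x' k').
Qed.

Lemma gnext_dec x y : gnext F h x y -> exists eta zeta,
  L eta /\ L zeta /\ rk F h x eta /\ rk F h y zeta /\ ltL zeta eta.
Proof.
  move=> [z [e [k [r1 [r2 [e1 [e2 [l m]]]]]]]]; exists k, e.
  by split; [apply: FL (rk_in _ _ e2)|split; [apply: FL (rk_in _ _ e1)|]].
Qed.

Lemma glast_fun x y y' : glast F h x y -> glast F h x y' -> y = y'.
Proof. move=> [h1 _] [h2 _]; exact: reg_fun h1 h2. Qed.

Lemma glast_inj x x' y : glast F h x y -> glast F h x' y -> x = x'.
Proof.
  move=> [r m] [r' m'].
  have [e [_ [_ [_ [e1 _]]]]] := reg_rk _ _ r; have [e' [_ [_ [_ [e1' _]]]]] := reg_rk _ _ r'.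
  case: (wo_total e e' (FL _ (rk_in _ _ e1)) (FL _ (rk_in _ _ e1'))) => [q|[q|q]].
  - by case: (m x' e e').
  - by rewrite -q in e1'; apply: reg_inj r r' e1 e1'.
  - by case: (m' x e' e).
Qed.

Lemma glast_dec x y : glast F h x y -> exists eta zeta,
  L eta /\ L zeta /\ rk F h x eta /\ rk F h y zeta /\ ltL zeta eta.
Proof. by move=> [/reg_rk]. Qed.

Lemma edge_neq0 i eta u v : edge F h i eta u v -> i <> num 0.
Proof. by move=> hE e; move: hE => [|[|[|]]] [k _]; rewrite k in e; move/num_inj: e. Qed.

(** A common source or target is settled by functionality and injectivity of [gnext] and [glast]. If
    [u = v'], the edges are consecutive and their sources are both inside or both outside [ker],
    against [ker_disjoint] or [ker_cover]. *)
Lemma edge_matching i eta zeta u v u' v' :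
  edge F h i eta u v -> edge F h i zeta u' v' ->
  (u = u' -> v = v' /\ eta = zeta) /\ (v = v' -> u = u' /\ eta = zeta) /\ u <> v'.
Proof.
  have K g k : D2 g -> (forall x y y', g x y -> g x y' -> y = y') ->
      (forall x x' y, g x y -> g x' y -> x = x') ->
      (forall x y, g x y -> exists eta zeta,
         L eta /\ L zeta /\ rk F h x eta /\ rk F h y zeta /\ ltL zeta eta) ->
      (k = ker g \/ k = fun x => ~ ker g x) ->
      g u v -> k u -> g u' v' -> k u' -> (u = u' <-> v = v') /\ u <> v'.
  { move=> dg gf gi gd hk g1 k1 g2 k2; split.
      by split=> e; [rewrite -e in g2; apply: gf g1 g2 | rewrite -e in g2; apply: gi g1 g2].
    move=> e; rewrite -e in g2; case: hk => hk; rewrite hk in k1 k2.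
    - exact: (ker_disjoint (M := L) g (rk F h) gf gd rk_fun _ _ g2 k2 k1).
    - by case: (ker_cover (M := L) g (rk F h) gf gd rk_fun _ _ g2) => [/k2|/k1]. }
  have dn : D2 (gnext F h) by exact _.
  have dl : D2 (glast F h) by exact _.
  have KN k := K (gnext F h) k dn gnext_fun gnext_inj gnext_dec.
  have KL k := K (glast F h) k dl glast_fun glast_inj glast_dec.
  move=> hE hE'.
  have [hi [he hf]] : (u = u' <-> v = v') /\ u <> v' /\ (u = u' -> v = v' -> eta = zeta).
  { move: hE hE' => [|[|[|]]] [-> [g1 [k1 r1]]] [|[|[|]]] [/num_inj e [g2 [k2 r2]]] //.
    - have [h1 h2] := KN _ (or_introl eq_refl) g1 k1 g2 k2; split=> //; split=> // _ e'.
      by rewrite -e' in r2; apply: rk_fun r1 r2.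
    - have [h1 h2] := KN _ (or_intror eq_refl) g1 k1 g2 k2; split=> //; split=> // _ e'.
      by rewrite -e' in r2; apply: rk_fun r1 r2.
    - have [h1 h2] := KL _ (or_introl eq_refl) g1 k1 g2 k2; split=> //; split=> // e' _.
      by rewrite -e' in r2; apply: rk_fun r1 r2.
    - have [h1 h2] := KL _ (or_intror eq_refl) g1 k1 g2 k2; split=> //; split=> // e' _.
      by rewrite -e' in r2; apply: rk_fun r1 r2. }
  by split; [|split] => // e; [have e' := proj1 hi e | have e' := proj2 hi e]; split=> //; apply: hf.
Qed.

Lemma arrow_next i eta x y : arrow F h i eta x y -> exists z, arrow F h i eta y z.
Proof.
  move=> [[-> [hl [hr hm]]]|[hE|hE]]; last first.
  - by exists x; right; left.
  - by exists x; right; right.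
  - have ry := hl _ _ hr hm.
    have [z hz] := perm_tot _ _ _ (hp _ (rk_in _ _ ry)) (rk_A _ _ ry).
    by exists z; left.
Qed.

Lemma arrow_prev i eta x y : arrow F h i eta x y -> exists z, arrow F h i eta z x.
Proof.
  move=> [[-> [hl [hr hm]]]|[hE|hE]]; last first.
  - by exists y; right; left.
  - by exists y; right; right.
  - have hs := hp _ (rk_in _ _ hr).
    pose (d := sep A (fun x => rk F h x eta)).
    have hd z : z ∈ d <-> rk F h z eta.
      by rewrite in_sep; split=> [[]//|k]; split=> //; apply: rk_A k.
    pose (d' := sep d (fun y => exists x, rk F h x eta /\ maps (app h eta) x y)).
    have fd : fin d.
      apply: (fin_sub _ _ (ind_fin _ _ _ hI _ (rk_in _ _ hr))) => z /hd [_ [hmv _]].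
      by rewrite in_movset.
    have hmap z : rk F h z eta -> maps (app h eta) z (app (app h eta) z).
      move=> /rk_A Az; apply: (the_spec (fun y => maps (app h eta) z y)).
      have [w hw] := perm_tot _ _ _ hs Az; exists w; split=> // w'; exact: perm_fun hs hw.
    have sub : d ⊆ d'.
      apply: pigeonhole => //; first by move=> z; rewrite in_sep => -[].
      apply: (le_intro _ _ (app (app h eta))).
        move=> z /hd hz; have hzm := hmap z hz; rewrite in_sep hd; split; first exact: hl hz hzm.
        by exists z.
      move=> z w /hd hz /hd hw e; have hzm := hmap z hz; have hwm := hmap w hw.
      by rewrite -e in hwm; apply: perm_inj hs hzm hwm.
    have : x ∈ d' by apply: sub; apply/hd.
    by rewrite in_sep => -[_ [z [hz hzm]]]; exists z; left.
Qed.

Lemma arrow_fun i eta zeta x y y' :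
  arrow F h i eta x y -> arrow F h i zeta x y' -> eta = zeta /\ y = y'.
Proof.
  move=> [[e0 [hl [hr hm]]]|[hE|hE]] [[e0' [hl' [hr' hm']]]|[hE'|hE']];
    try by [case: (edge_neq0 _ _ _ _ hE) | case: (edge_neq0 _ _ _ _ hE')].
  - have e := rk_fun _ _ _ hr hr'; subst zeta; split=> //.
    exact: perm_fun (hp _ (rk_in _ _ hr)) hm hm'.
  - by have [/(_ eq_refl) [-> ->]] := edge_matching _ _ _ _ _ _ _ hE hE'.
  - by have [_ [_ []]] := edge_matching _ _ _ _ _ _ _ hE hE'.
  - by have [_ [_ []]] := edge_matching _ _ _ _ _ _ _ hE' hE.
  - by have [_ [/(_ eq_refl) [-> ->] _]] := edge_matching _ _ _ _ _ _ _ hE hE'.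
Qed.

Lemma arrow_inj i eta zeta x x' y :
  arrow F h i eta x y -> arrow F h i zeta x' y -> eta = zeta /\ x = x'.
Proof.
  move=> [[e0 [hl [hr hm]]]|[hE|hE]] [[e0' [hl' [hr' hm']]]|[hE'|hE']];
    try by [case: (edge_neq0 _ _ _ _ hE) | case: (edge_neq0 _ _ _ _ hE')].
  - have e := rk_fun _ _ _ (hl _ _ hr hm) (hl' _ _ hr' hm'); subst zeta; split=> //.
    exact: perm_inj (hp _ (rk_in _ _ hr)) hm hm'.
  - by have [_ [/(_ eq_refl) [-> ->] _]] := edge_matching _ _ _ _ _ _ _ hE hE'.
  - by have [_ [_ []]] := edge_matching _ _ _ _ _ _ _ hE' hE.
  - by have [_ [_ []]] := edge_matching _ _ _ _ _ _ _ hE hE'.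
  - by have [/(_ eq_refl) [-> ->]] := edge_matching _ _ _ _ _ _ _ hE hE'.
Qed.

Lemma edge_A i eta u v : edge F h i eta u v -> u ∈ A /\ v ∈ A.
Proof.
  have H e k : rk F h u e -> rk F h v k -> u ∈ A /\ v ∈ A by move=> /rk_A ? /rk_A.
  by move=> [|[|[|]]] [_ [g1 _]]; [have := gnext_dec _ _ g1|have := gnext_dec _ _ g1|
    have := glast_dec _ _ g1|have := glast_dec _ _ g1];
    move=> [e [k [_ [_ [r1 [r2 _]]]]]]; apply: H r1 r2.
Qed.

Lemma arrow_A i eta x y : arrow F h i eta x y -> x ∈ A /\ y ∈ A.
Proof.
  move=> [[_ [hl [hr hm]]]|[/edge_A []|/edge_A []]] //.
  exact: perm_dom (hp _ (rk_in _ _ hr)) hm.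
Qed.

Lemma arrow_neq i eta x y : arrow F h i eta x y -> x <> y.
Proof.
  move=> [[_ [hl [hr hm]]]|[hE|hE]] e.
  - move: hr => [he [[y' [hy' ne]] _]]; apply: ne.
    rewrite -e in hm; exact: perm_fun (hp _ he) hy' hm.
  - by have [_ [_ []]] := edge_matching _ _ _ _ _ _ _ hE hE.
  - by have [_ [_ []]] := edge_matching _ _ _ _ _ _ _ hE hE.
Qed.

Lemma arrow_cover eta : eta ∈ F -> exists i x y, i ∈ num 5 /\ arrow F h i eta x y.
Proof.
  move=> he; case: (classic (loop F h eta)) => [hl|hnl].
    have [x hx] := ind_rk _ _ _ hI eta he.
    have [y hy] := perm_tot _ _ _ (hp _ he) (rk_A _ _ hx).
    exists (num 0), x, y; split; first by rewrite in_num; exists 0; split=> //; lia.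
    by left.
  have [x [y [hx [hxy nry]]]] : exists x y, rk F h x eta /\ maps (app h eta) x y /\ ~ rk F h y eta.
    apply: NNPP => hn; apply: hnl => x y hx hxy; apply: NNPP => hy; apply: hn.
    by exists x, y.
  have hmy : mv (app h eta) y by apply: mv_image (hp _ he) (proj1 (proj2 hx)) hxy.
  have [zeta [ry [e|l]]] := rk_ex eta y he hmy; first by rewrite e in ry.
  have hreg : reg F h x y by exists eta, zeta.
  case: (classic (exists zeta z, L zeta /\ reg F h z y /\ rk F h z zeta /\ ltL eta zeta)).
    move=> [k0 [z0 [mk0 hk0]]].
    have [k [mk [[z [rz [rkz lz]]] hmin]]] :=
      wo_min (M := L) (fun k => exists z, reg F h z y /\ rk F h z k /\ ltL eta k) k0 mk0
        (ex_intro _ z0 hk0).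
    have gz : gnext F h z x.
      exists y, eta, k; do 5 (split=> //); move=> w t rw rkw lw lt_.
      by apply: (hmin t (FL _ (rk_in _ _ rkw)) lt_); exists w.
    case: (classic (ker (gnext F h) z)) => hk.
      exists (num 1), x, z; split; first by rewrite in_num; exists 1; split=> //; lia.
      by right; right; left.
    exists (num 2), x, z; split; first by rewrite in_num; exists 2; split=> //; lia.
    by right; right; right; left.
  move=> hn.
  have gl : glast F h x y.
    split=> // z e t re rz rt le_; apply: hn; exists t, z.
    rewrite -(rk_fun _ _ _ hx re) in le_; split=> //; exact: FL (rk_in _ _ rt).
  case: (classic (ker (glast F h) x)) => hk.
    exists (num 3), x, y; split; first by rewrite in_num; exists 3; split=> //; lia.
    by right; left; right; right; left.
  exists (num 4), x, y; split; first by rewrite in_num; exists 4; split=> //; lia.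
  by right; left; right; right; right.
Qed.

Lemma tperm_maps i Z x y : maps (tperm A F h i Z) x y <-> x ∈ A /\ y ∈ A /\
  ((exists eta, eta ∈ Z /\ arrow F h i eta x y) \/
   (y = x /\ ~ exists eta y', eta ∈ Z /\ arrow F h i eta x y')).
Proof.
  rewrite mapsE in_sep pr_in_prod; split=> [[[hx hy]] [x' [y' [/pr_inj [<- <-] hh]]]|[hx [hy hh]]] //.
  by split=> //; exists x, y.
Qed.

Lemma tperm_perm i Z : permutations A (tperm A F h i Z).
Proof.
  apply: perm_intro.
  - by move=> p; rewrite in_sep => -[].
  - move=> x hx; case: (classic (exists eta y', eta ∈ Z /\ arrow F h i eta x y')) => hn.
      move: hn => [eta [y [hz ha]]]; exists y; rewrite tperm_maps.
      by have [_ hy] := arrow_A _ _ _ _ ha; split=> //; split=> //; left; exists eta.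
    by exists x; rewrite tperm_maps; split=> //; split=> //; right.
  - move=> x y y'; rewrite !tperm_maps => -[_ [_ h1]] [_ [_ h2]].
    move: h1 h2 => [[e [ez ha]]|[-> hn]] [[e' [ez' ha']]|[-> hn']] //.
    + by have [] := arrow_fun _ _ _ _ _ _ ha ha'.
    + by case: hn'; exists e, y.
    + by case: hn; exists e', y'.
  - move=> x x' y; rewrite !tperm_maps => -[_ [_ h1]] [_ [_ h2]].
    move: h1 h2 => [[e [ez ha]]|[-> hn]] [[e' [ez' ha']]|[e2 hn']] //.
    + by have [] := arrow_inj _ _ _ _ _ _ ha ha'.
    + have [z hz] := arrow_next _ _ _ _ ha; case: hn'; exists e, z; by rewrite -e2.
    + have [z hz] := arrow_next _ _ _ _ ha'; case: hn; by exists e', z.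
  - move=> y hy; case: (classic (exists eta y', eta ∈ Z /\ arrow F h i eta y y')) => hn.
      move: hn => [eta [y' [hz ha]]]; have [x hx] := arrow_prev _ _ _ _ ha.
      exists x; rewrite tperm_maps; have [Ax _] := arrow_A _ _ _ _ hx.
      by split=> //; split=> //; left; exists eta.
    by exists y; rewrite tperm_maps; split=> //; split=> //; right.
Qed.

(** An arrow with label [eta] belongs to the graph of [tperm A F h i Z] exactly when [eta] is in
    [Z], because its label is unique and its ends differ. By [arrow_cover] every [eta] in [F] labels
    some arrow. *)
Lemma tperm_inj Z Z' : Z ⊆ F -> Z' ⊆ F ->
  (forall i, i ∈ num 5 -> tperm A F h i Z = tperm A F h i Z') -> Z = Z'.
Proof.
  have H U U' : U ⊆ F -> (forall i, i ∈ num 5 -> tperm A F h i U = tperm A F h i U') -> U ⊆ U'.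
    move=> hU hh eta he; have [i [x [y [hi ha]]]] := arrow_cover eta (hU _ he).
    have [Ax Ay] := arrow_A _ _ _ _ ha.
    have : maps (tperm A F h i U) x y.
      by rewrite tperm_maps; split=> //; split=> //; left; exists eta.
    rewrite hh // tperm_maps => -[_ [_ [[e [he' ha']]|[e _]]]].
      by have [<-] := arrow_fun _ _ _ _ _ _ ha' ha.
    by case: (arrow_neq _ _ _ _ ha).
  move=> hZ hZ' hh; apply: sub_antisym; apply: H => // i hi; by rewrite hh.
Qed.

End Labels.

#[global] Opaque tperm.

(** * Finite counting *)

Section Growth.
Context {V : structure} {hZF : ZF V}.
Implicit Types (a b c d g i m n p q s t u v w x y z : V).

Lemma num01 : num 0 <> num 1.
Proof. by move=> /num_inj. Qed.

Lemma num_in2 w : w ∈ num 2 <-> w = num 0 \/ w = num 1.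
Proof.
  rewrite in_num; split=> [[[|[|k]] [hk ->]]|[->|->]]; auto; first lia.
  - by exists 0; split=> //; lia.
  - by exists 1; split=> //; lia.
Qed.

Lemma le_prod_pow a b : exists c, (fin a -> fin b -> fin c) /\
  forall m, le (prod (pow (prod a (succ m))) (pow b)) (pow (prod c (succ m))).
Proof.
  exists (prod (num 2) (cup a b)); split.
    by move=> fa fb; apply: fin_prod; [apply/nat_fin/nat_num | apply: fin_cup].
  move=> m.
  pose (E := fun p => sep (prod (prod (num 2) (cup a b)) (succ m)) (fun q =>
    (exists u x, q = pr (pr (num 0) u) x /\ pr u x ∈ fst p) \/
    (exists v, q = pr (pr (num 1) v) m /\ v ∈ snd p))).
  have hE0 X Y u x : X ⊆ prod a (succ m) -> pr (pr (num 0) u) x ∈ E (pr X Y) <-> pr u x ∈ X.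
    move=> hX; rewrite in_sep fst_pr snd_pr; split.
      by move=> [_ [[u' [x' [/pr_inj [/pr_inj [_ <-] <-]]]]|[v [/pr_inj [/pr_inj [/num01]]]]]].
    move=> hux; split; last by left; exists u, x.
    have := hX _ hux; rewrite !pr_in_prod in_cup num_in2; tauto.
  have hE1 X Y v : Y ⊆ b -> pr (pr (num 1) v) m ∈ E (pr X Y) <-> v ∈ Y.
    move=> hY; rewrite in_sep fst_pr snd_pr; split.
      move=> [_ [[u' [x' [/pr_inj [/pr_inj [e _] _]]]]|[v' [/pr_inj [/pr_inj [_ <-]]]]]] //.
      by case: num01.
    move=> hv; split; last by right; exists v.
    rewrite !pr_in_prod in_cup num_in2 in_succ; have := hY _ hv; tauto.
  apply: (le_intro _ _ E).
  - by move=> p _; rewrite in_pow => q; rewrite in_sep => -[].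
  - move=> p q /in_prod [X [Y [/in_pow hX [/in_pow hY ->]]]]
      /in_prod [X' [Y' [/in_pow hX' [/in_pow hY' ->]]]] e.
    have -> : X = X'.
      apply: ext => z; split=> hz.
        have /in_prod [u [x [_ [_ ez]]]] := hX _ hz; subst z.
        by rewrite -(hE0 X' Y') // -e hE0.
      have /in_prod [u [x [_ [_ ez]]]] := hX' _ hz; subst z.
      by rewrite -(hE0 X Y) // e hE0.
    have -> // : Y = Y'.
    by apply: ext => v; rewrite -(hE1 X Y) // -(hE1 X' Y') // e.
Qed.

(** If [m] contains four copies of [c], then [c * (m + 1) < 2 ^ m]: with [u] two of the
    copies and [i = m + 1 - u], one has [c * (m + 1) <= 2 c i < (2 c + 1) i <= 2 ^ m]. *)
Lemma pow_grows c m0 : fin c -> is_nat m0 ->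
  le (prod (num 2) (prod (num 2) c)) m0 ->
  forall m, is_nat m -> m0 ⊆ m -> ~ le (pow (pow m)) (pow (prod c (succ m))).
Proof.
  move=> fc nm0 /le_elim [g [g1 g2]] m nm sm hle.
  pose (c2 := prod (num 2) c).
  have fc2 : fin c2 by apply: fin_prod => //; apply/nat_fin/nat_num.
  pose (G := fun k w => app g (pr (num k) w)).
  have Gm k w : k < 2 -> w ∈ c2 -> G k w ∈ m.
    move=> hk hw; apply/sm/g1; rewrite pr_in_prod in_num; split=> //; by exists k.
  have Ginj k w l w' : k < 2 -> l < 2 -> w ∈ c2 -> w' ∈ c2 -> G k w = G l w' -> k = l /\ w = w'.
    move=> hk hl hw hw' /g2; rewrite !pr_in_prod !in_num => e.
    have /pr_inj [/num_inj -> ->] // : pr (num k) w = pr (num l) w'.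
    by apply: e; split=> //; [exists k | exists l].
  have hG0 w : G 0 w = app g (pr emp w) by [].
  have hG1 w : G 1 w = app g (pr (num 1) w) by [].
  (* [I] is [succ m] without the first copy of [c2]; the second copy and the element [m] remain in
     it. *)
  pose (I := sep (succ m) (fun a => ~ exists w, w ∈ c2 /\ a = app g (pr emp w))).
  have hI a : a ∈ I <-> a ∈ succ m /\ ~ exists w, w ∈ c2 /\ a = G 0 w by exact: in_sep.
  pose (y := prod c2 I).
  have h1 : le (prod c (succ m)) y.
  { pose (W := fun a => the (fun w => w ∈ c2 /\ a = app g (pr emp w))).
    have hW a w : w ∈ c2 -> a = G 0 w -> W a = w.
      move=> hw e; apply: the_eq => // z [hz e']; rewrite -hG0 e in e'.
      by have [] := Ginj 0 w 0 z ltac:(lia) ltac:(lia) hw hz e'.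
    (* A column [G 0 w] outside [I] moves to the column [G 1 w] in the second copy of [c]. *)
    pose (E := fun p => ite (snd p ∈ I) (pr (pr emp (fst p)) (snd p))
                            (pr (pr (num 1) (fst p)) (app g (pr (num 1) (W (snd p)))))).
    have E0 z a : a ∈ I -> E (pr z a) = pr (pr (num 0) z) a.
      by move=> ha; rewrite /E fst_pr snd_pr ite_true.
    have E1 z a w : w ∈ c2 -> a = G 0 w -> E (pr z a) = pr (pr (num 1) z) (G 1 w).
      move=> hw e; rewrite /E fst_pr snd_pr ite_false ?(hW a w) //.
      by rewrite hI => -[_ []]; exists w.
    have cases a : a ∈ succ m -> a ∈ I \/ exists w, w ∈ c2 /\ a = G 0 w.
      by move=> ha; rewrite hI; case: (classic (exists w, w ∈ c2 /\ a = G 0 w)); tauto.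
    have G1I w : w ∈ c2 -> G 1 w ∈ I.
      move=> hw; rewrite hI in_succ; split; first by left; apply: Gm => //; lia.
      move=> [w' [hw' /Ginj]]; move=> /(_ ltac:(lia) ltac:(lia) hw hw') [] //.
    apply: (le_intro _ _ E).
    - move=> p /in_prod [z [a [hz [/cases [ha|[w [hw e]]] ->]]]].
        rewrite E0 // !pr_in_prod num_in2; auto.
      rewrite (E1 z a w) // !pr_in_prod num_in2; auto.
    - move=> p q /in_prod [z [a [hz [/cases [ha|[w [hw e]]] ->]]]]
        /in_prod [z' [a' [hz' [/cases [ha'|[w' [hw' e']]] ->]]]].
      + by rewrite !E0 // => /pr_inj [/pr_inj [_ ->] ->].
      + by rewrite E0 // (E1 z' a' w') // => /pr_inj [/pr_inj [/num01]].
      + by rewrite (E1 z a w) // E0 // => /pr_inj [/pr_inj [k _] _]; case: num01.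
      + rewrite (E1 z a w) // (E1 z' a' w') // => /pr_inj [/pr_inj [_ ->]].
        move=> /Ginj; move=> /(_ ltac:(lia) ltac:(lia) hw hw') [_ k].
        by rewrite e e' k. }
  pose (y' := prod (add c2 c2) I).
  have h2 : le y' (pow m).
  (* The pair of [w] and [a] becomes the set of [G 0 w] and [a], cut down to [m]. The extra element
     [c2] of [add c2 c2] contributes nothing to this set, and neither does [a = m]. *)
  { pose (E := fun p => sep m (fun b => (fst p ∈ c2 /\ b = app g (pr emp (fst p))) \/ b = snd p)).
    have hE w a b : b ∈ E (pr w a) <-> b ∈ m /\ ((w ∈ c2 /\ b = G 0 w) \/ b = a).
      by rewrite in_sep fst_pr snd_pr.
    have sub1 w a w' a' : w ∈ c2 -> a' ∈ I -> E (pr w a) = E (pr w' a') -> w = w' /\ w' ∈ c2.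
      move=> hw /hI [_ ha'] e.
      have : G 0 w ∈ E (pr w' a').
        by rewrite -e hE; split; [apply: Gm => //; lia | left].
      rewrite hE => -[_ [[hw' /Ginj]|e']]; last by case: ha'; exists w.
      by move=> /(_ ltac:(lia) ltac:(lia) hw hw') [_ ->].
    have sub2 w a w' a' : a ∈ I -> a ∈ m -> E (pr w a) = E (pr w' a') -> a = a'.
      move=> /hI [_ ha] am e.
      have : a ∈ E (pr w' a') by rewrite -e hE; auto.
      rewrite hE => -[_ [[hw' e']|//]]; by case: ha; exists w'.
    apply: (le_intro _ _ E).
    - by move=> p _; rewrite in_pow => b; rewrite in_sep => -[].
    - move=> p q /in_prod [w [a [hw [ha ->]]]] /in_prod [w' [a' [hw' [ha' ->]]]] e.
      have -> : w = w'.
      { move: hw hw'; rewrite !in_add => -[hw|hw] [hw'|hw'].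
        + by have [] := sub1 w a w' a' hw ha' e.
        + by have [] := sub1 w a w' a' hw ha' e.
        + by have [] := sub1 w' a' w a hw' ha (eq_sym e).
        + by rewrite hw hw'. }
      have -> // : a = a'.
      have [/in_succ [am|am] _] : a ∈ succ m /\ True by move/hI: ha => [].
        exact: sub2 e.
      have [/in_succ [am'|am'] _] : a' ∈ succ m /\ True by move/hI: ha' => [].
        by symmetry; apply: (sub2 w' a' w a) => //; rewrite e.
      by rewrite am am'. }
  have fy' : fin y'.
    apply: fin_prod; first exact: fin_add.
    apply: (fin_sub (succ m)) => [|a /hI []//]; apply: nat_fin; exact: nat_succ.
  have sub : pow y ⊆ pow y'.
    move=> z; rewrite !in_pow => hz q /hz /in_prod [w [a [hw [ha ->]]]].
    by rewrite pr_in_prod in_add; auto.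
  (* [y] is a proper subset of the finite set [y'], as the pair of [c2] and [m] shows, so this
     contradicts the pigeonhole principle. *)
  have hyy' : le (pow y') (pow y).
    apply: le_trans (le_pow _ _ h2) _; apply: le_trans hle _; exact: le_pow.
  have : y' ∈ pow y.
    by apply: (pigeonhole _ _ (fin_pow _ fy') sub hyy'); rewrite in_pow.
  have mI : m ∈ I.
    rewrite hI in_succ; split; first by right.
    move=> [w [hw e]]; apply: (notin_self m); rewrite {1}e; apply: Gm => //; lia.
  rewrite in_pow => /(_ (pr c2 m)); rewrite !pr_in_prod in_add => k.
  by have [/notin_self] := k (conj (or_intror eq_refl) mI).
Qed.

Lemma growth_bound a b : fin a -> fin b -> exists m0, is_nat m0 /\
  forall m, is_nat m -> m0 ⊆ m ->
    ~ le (pow (pow m)) (prod (pow (prod a (succ m))) (pow b)).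
Proof.
  move=> fa fb; have [c [fc hc]] := le_prod_pow a b.
  have fc4 : fin (prod (num 2) (prod (num 2) c)).
    by apply: fin_prod; [apply/nat_fin/nat_num|apply: fin_prod; [apply/nat_fin/nat_num|exact: fc]].
  have [m0 [g [nm0 [g1 [g2 _]]]]] := fin_nat _ fc4.
  exists m0; split=> // m nm sm hle.
  apply: (pow_grows c m0 (fc fa fb) nm0 _ m nm sm).
    by apply: (le_intro _ _ (app g)).
  exact: le_trans hle (hc m).
Qed.

End Growth.

(** * Sets of labels whose permutations have images of known support *)

Section Images.
Context {V : structure} {hZF : ZF V}.
Implicit Types (a b c g i j m p q s t u v w x y z Z S eta zeta xi : V).

Definition img (A f F h i Z : V) : V := app f (tperm A F h i Z).

#[export] Instance T4_img A f : T4 (img A f).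
Proof. rewrite /img; dsolve. Qed.

(** Bad for the count but wanted by the construction: a point without rank is one that no earlier
    permutation moves. *)
Definition bad (A f F h Z i : V) : Prop :=
  exists x, mv (img A f F h i Z) x /\ ~ exists eta, rk F h x eta.

#[export] Instance D4_bad A f : D4 (bad A f).
Proof. rewrite /bad; dsolve. Qed.

Definition badset (A f F h Z : V) : Prop := exists i, i ∈ num 5 /\ bad A f F h Z i.

#[export] Instance D3_badset A f : D3 (badset A f).
Proof. rewrite /badset; dsolve. Qed.

(** The letters used by [Z]. Ranks are themselves sets of ordinals, so knowing these ordinals
    confines the ranks to the subsets of one set. *)
Definition spread (A f F h Z : V) : V := sep (union F) (fun a => exists i x eta,
  i ∈ num 5 /\ mv (img A f F h i Z) x /\ rk F h x eta /\ a ∈ eta).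

#[export] Instance T3_spread A f : T3 (spread A f).
Proof. rewrite /spread; dsolve. Qed.

Variables (A N k f Pm : V).
Hypothesis fN : fin N.
Hypothesis fk : fin k.
Hypothesis in_Pm : forall t, t ∈ Pm <-> permutations A t.
Hypothesis f_perm : forall t, permutations A t -> permutations A (app f t).
Hypothesis f_mov : forall t, permutations A t -> le (movset A (app f t)) N.
Hypothesis f_fib : forall s, le (sep Pm (fun t => app f t = s)) k.

Variables (F h : V).
Hypothesis hI : independent A F h.

Lemma img_perm i Z : permutations A (img A f F h i Z).
Proof. by apply/f_perm/tperm_perm. Qed.

Lemma img_mov i Z : le (movset A (img A f F h i Z)) N.
Proof. by apply/f_mov/tperm_perm. Qed.

Lemma goodP Z i x : ~ badset A f F h Z -> i ∈ num 5 -> mv (img A f F h i Z) x ->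
  exists eta, rk F h x eta.
Proof.
  move=> hg hi hx; apply: NNPP => hn; apply: hg; exists i; split=> //; by exists x.
Qed.

(** Such a permutation is the identity outside [B], so its trace on [prod B B] determines it. *)
Lemma perms_supported_le B : le (sep Pm (fun s => movset A s ⊆ B)) (pow (prod B B)).
Proof.
  apply: (le_intro _ _ (fun s => sep s (fun p => p ∈ prod B B))).
    by move=> s _; rewrite in_pow => p; rewrite in_sep => -[].
  move=> s s'; rewrite !in_sep !in_Pm => -[hs bs] [hs' bs'] e.
  have B1 t z : permutations A t -> movset A t ⊆ B -> mv t z -> z ∈ B.
    by move=> ht hb hz; apply: hb; rewrite in_movset.
  have H t t' : permutations A t -> permutations A t' -> movset A t ⊆ B ->
      (forall q, q ∈ t /\ q ∈ prod B B -> q ∈ t' /\ q ∈ prod B B) ->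
      forall x y, x <> y -> maps t x y -> maps t' x y.
    move=> ht ht' hb hq x y ne hxy.
    have mx : mv t x by exists y; split=> // e'; rewrite e' in ne.
    have [] := hq (pr x y); last by rewrite -mapsE.
    rewrite -mapsE pr_in_prod; split=> //; split; apply: (B1 t) => //.
    exact: mv_image ht mx hxy.
  have Q q : q ∈ s /\ q ∈ prod B B <-> q ∈ s' /\ q ∈ prod B B.
    pose proof (in_sep s (fun p => p ∈ prod B B) q) as h1.
    pose proof (in_sep s' (fun p => p ∈ prod B B) q) as h2.
    rewrite -e in h2; tauto.
  apply: (perm_ext A) => // x y hxy; case: (classic (x = y)) => [exy|ne].
    subst y; have [Ax _] := perm_dom _ _ _ _ hs hxy.
    have [y hy] := perm_tot _ _ _ hs' Ax; case: (classic (x = y)) => [{2}->//|ne].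
    case: (ne); apply: (perm_fun _ _ _ _ _ hs hxy).
    by apply: (H s' s) => // q /Q.
  by apply: (H s s') => // q /Q.
Qed.

(** The bound on the fibers of [f] makes [Z |-> (f (tperm i Z))_i] boundedly finite-to-one. *)
Lemma labels_le B N' : fin N' -> le B N' ->
  le (sep (pow F) (fun Z => forall i, i ∈ num 5 -> movset A (img A f F h i Z) ⊆ B))
     (pow (prod (num 5) (prod (pow (prod N' N')) k))).
Proof.
  move=> fN' hB.
  pose (Sp := sep Pm (fun s => movset A s ⊆ B)).
  have hSp s : s ∈ Sp <-> permutations A s /\ movset A s ⊆ B by rewrite -in_Pm; apply: in_sep.
  have fB : fin B by apply: fin_le hB fN'.
  have fSp : fin Sp.
    by apply: fin_le (perms_supported_le B) _; apply/fin_pow/fin_prod.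
  pose (T := sep Pm (fun t => app f t ∈ Sp)).
  have hT t : t ∈ T <-> permutations A t /\ app f t ∈ Sp by rewrite -in_Pm; apply: in_sep.
  have leT : le T (prod Sp k).
    apply: (le_fibers (fun s t => app f t = s)) => // [t /hT [_ ht]|s hs].
      by exists (app f t).
    apply: le_trans (f_fib s); apply: le_refl_sub => t; rewrite !in_sep => -[[]]; tauto.
  have leT' : le T (prod (pow (prod N' N')) k).
    apply: le_trans leT _; apply: le_prod; last exact: le_refl_sub.
    apply: le_trans (perms_supported_le B) _; apply: le_pow; exact: le_prod.
  apply: (le_trans _ (pow (prod (num 5) T))); last first.
    by apply: le_pow; apply: le_prod => //; apply: le_refl_sub.
  pose (E := fun Z => sep (prod (num 5) T) (fun q => exists i, q = pr i (tperm A F h i Z))).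
  apply: (le_intro _ _ E).
    by move=> Z _; rewrite in_pow => q; rewrite in_sep => -[].
  move=> Z Z'; rewrite !in_sep !in_pow => -[hZ gZ] [hZ' gZ'] e.
  apply: (tperm_inj A F h hI) => // i hi.
  have : pr i (tperm A F h i Z) ∈ E Z.
    rewrite in_sep pr_in_prod; split; last by exists i.
    split=> //; rewrite hT; split; first exact: tperm_perm.
    by rewrite hSp; split; [exact: img_perm | exact: gZ].
  rewrite e in_sep => -[_ [i' /pr_inj [<- //]]].
Qed.

Hypothesis hN : forall eta, eta ∈ F -> le (movset A (app h eta)) N.

Lemma rank_class_le eta : le (sep A (fun x => rk F h x eta)) N.
Proof.
  case: (classic (eta ∈ F)) => he.
    apply: le_trans (hN eta he); apply: le_refl_sub => x; rewrite in_sep => -[_ [_ [hx _]]].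
    by rewrite in_movset //; apply: ind_perm he.
  by apply: le_refl_sub => x; rewrite in_sep => -[_ [/he]].
Qed.

(** [n] is a number of the metatheory, so this only instantiates existential statements one after
    the other. *)
Lemma finite_choice (R : V -> V -> Prop) {hR : D2 R} n :
  (forall i, i ∈ num n -> exists y, R i y) ->
  exists G, forall i, i ∈ num n -> R i (app G i).
Proof.
  elim: n => [|n IH] hex; first by exists emp => i /in_emp.
  have [i hi|G hG] := IH; first by apply: hex => /=; rewrite in_succ; left.
  have hn : num n ∈ num (S n) by rewrite in_num; exists n; split=> //; lia.
  have [y hy] := hex (num n) hn.
  have [G' hG'] := fun_rep (num (S n)) (fun i => ite (i = num n) y (app G i)).
  exists G' => i hi; rewrite hG' //; case: (classic (i = num n)) => [e|ne].
    by rewrite ite_true // e.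
  by rewrite ite_false //; apply: hG; move: hi => /=; rewrite in_succ => -[].
Qed.

(** With [Z] ranging over all subsets of [F], the supports of the images would be coded by
    too small a set. *)
Lemma finite_stage m : is_nat m -> F ⊆ pow (succ m) -> pow m ⊆ F ->
  ~ le (pow (pow m)) (prod (pow (prod (prod (num 5) N) (succ m)))
      (pow (prod (num 5) (prod (pow (prod (prod (prod (num 5) N) N) (prod (prod (num 5) N) N))) k)))) ->
  exists Z, Z ⊆ F /\ badset A f F h Z.
Proof.
  move=> nm hF hm hle; apply: NNPP => hgood; apply: hle.
  have {}hgood Z : Z ⊆ F -> ~ badset A f F h Z.
    by move=> hZ hb; apply: hgood; exists Z.
  have f5N : fin (prod (num 5) N) by apply: fin_prod => //; apply/nat_fin/nat_num.
  apply: (le_trans _ (pow F)); first exact: le_pow (le_refl_sub _ _ hm).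
  pose (row := fun W nu => sep (succ m) (fun a => pr nu a ∈ W)).
  have hrow W nu a : a ∈ row W nu <-> a ∈ succ m /\ pr nu a ∈ W by exact: in_sep.
  (* [W] codes a family of subsets of [succ m], its rows, indexed by [prod (num 5) N]; [R W Z] says
     that the rank of every point moved by one of the five images of [Z] is a row of [W]. *)
  pose (R := fun W Z => forall i x, i ∈ num 5 -> mv (img A f F h i Z) x ->
     exists nu, nu ∈ prod (num 5) N /\ rk F h x (row W nu)).
  have dR : D2 R by rewrite /R /row; dsolve.
  apply: (le_fibers R).
  - apply: fin_pow; apply: fin_prod => //; apply: nat_fin; exact: nat_succ.
  - move=> Z /in_pow hZ.
    have [G hG] : exists G, forall i, i ∈ num 5 ->
        (forall x, x ∈ movset A (img A f F h i Z) -> app (app G i) x ∈ N) /\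
        (forall x y, x ∈ movset A (img A f F h i Z) -> y ∈ movset A (img A f F h i Z) ->
           app (app G i) x = app (app G i) y -> x = y).
      apply: (finite_choice (fun i g =>
        (forall x, x ∈ movset A (img A f F h i Z) -> app g x ∈ N) /\
        (forall x y, x ∈ movset A (img A f F h i Z) -> y ∈ movset A (img A f F h i Z) ->
           app g x = app g y -> x = y))).
      by move=> i _; apply/le_elim/img_mov.
    pose (W := sep (prod (prod (num 5) N) (succ m)) (fun q => exists i x eta a,
      q = pr (pr i (app (app G i) x)) a /\ i ∈ num 5 /\ mv (img A f F h i Z) x /\
      rk F h x eta /\ a ∈ eta)).
    exists W; split; first by rewrite in_pow => q; rewrite in_sep => -[].
    move=> i x hi hx; have [eta hr] := goodP Z i x (hgood Z hZ) hi hx.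
    have [G1 G2] := hG i hi.
    have xm z : mv (img A f F h i Z) z -> z ∈ movset A (img A f F h i Z).
      by move=> hz; rewrite in_movset //; apply: img_perm.
    exists (pr i (app (app G i) x)); split; first by rewrite pr_in_prod; auto.
    have -> // : row W (pr i (app (app G i) x)) = eta.
    apply: ext => a; rewrite hrow in_sep !pr_in_prod; split.
      move=> [ha [_ [i' [x' [eta' [a' [/pr_inj [/pr_inj [ei e] ea] [hi' [hx' [hr' ha']]]]]]]]]].
      subst i' a'; have ex := G2 x x' (xm x hx) (xm x' hx') e; subst x'.
      by rewrite (rk_fun A F h hI x eta eta').
    move=> ha.
    have hsm : a ∈ succ m.
      have := hF _ (rk_in F h _ _ hr); rewrite in_pow; exact.
    split=> //; split; first by auto.
    by exists i, x, eta, a.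
  - move=> W _.
    (* At most [N] points have a given rank, so at most [5 * N * N] points have a row of [W] as
       rank. This is the [N'] of [labels_le]; the resulting factor does not depend on [m]. *)
    pose (B := sep A (fun x => exists nu, nu ∈ prod (num 5) N /\ rk F h x (row W nu))).
    have hB : le B (prod (prod (num 5) N) N).
      apply: (le_fibers (fun nu x => rk F h x (row W nu))) => // [x|nu _].
        by rewrite in_sep => -[].
      apply: le_trans (rank_class_le (row W nu)); apply: le_refl_sub => x.
      by rewrite !in_sep; tauto.
    apply: le_trans (labels_le B (prod (prod (num 5) N) N) _ hB); last exact: fin_prod.
    apply: le_refl_sub => Z; rewrite !in_sep => -[hZ hR]; split=> // i hi x hx.
    have Ax : x ∈ A by move: hx; rewrite in_sep => -[].
    rewrite in_sep; split=> //; apply: (hR i) => //.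
    by rewrite -(in_movset A) //; apply: img_perm.
Qed.

Lemma in_spread Z a : a ∈ spread A f F h Z <-> exists i x eta,
  i ∈ num 5 /\ mv (img A f F h i Z) x /\ rk F h x eta /\ a ∈ eta.
Proof.
  rewrite in_sep; split=> [[]//|hh]; split=> //.
  by move: hh => [i [x [eta [_ [_ [hr ha]]]]]]; rewrite in_union; exists eta; split=> //; case: hr.
Qed.

Lemma image_ex (E : V -> V) {hE : T1 E} x : exists y, forall z, z ∈ y <-> exists u, u ∈ x /\ z = E u.
Proof. by apply: repl_ex => ? ? ? _ -> ->. Qed.

Lemma spread_fin Z : fin (spread A f F h Z).
Proof.
  have [Y hY] := image_ex (fun i => movset A (img A f F h i Z)) (num 5).
  have fY : fin (union Y).
    apply: fin_union; first by apply: (fin_image (fun i => movset A (img A f F h i Z)) (num 5)) => [|z /hY //];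
      apply/nat_fin/nat_num.
    by move=> y /hY [i [_ ->]]; apply: fin_le (img_mov i Z) fN.
  pose (r := fun x => ite (exists eta, rk F h x eta) (the (fun eta => rk F h x eta)) emp).
  have hr1 x eta : rk F h x eta -> r x = eta.
    move=> hr; rewrite /r ite_true; first by exists eta.
    by apply: the_eq => // z hz; apply: (rk_fun A F h hI x).
  have [R hR] := image_ex r (union Y).
  apply: (fin_sub (union R)); last first.
    move=> a /in_spread [i [x [eta [hi [hx [hr ha]]]]]].
    rewrite in_union; exists eta; split=> //; rewrite hR; exists x; split.
      rewrite in_union; exists (movset A (img A f F h i Z)); split; first by rewrite hY; exists i.
      by rewrite in_movset //; apply: img_perm.
    by rewrite (hr1 x eta).
  apply: fin_union; first by apply: (fin_image r (union Y)) => // z /hR.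
  move=> y /hR [x [_ ->]]; case: (classic (exists eta, rk F h x eta)) => [[eta hr]|hn].
    rewrite (hr1 x eta hr).
    by have [] := ind_L _ _ _ hI eta (rk_in F h _ _ hr).
  by rewrite /r ite_false //; apply: fin_emp.
Qed.

(** The ranks involved are subsets of the finite set [S], so the images are supported in the finite
    set of points moved by some [app h eta] with [eta] a subset of [S], and [labels_le] applies. *)
Lemma spread_fibers_fin S : fin S ->
  fin (sep (pow F) (fun Z => ~ badset A f F h Z /\ spread A f F h Z = S)).
Proof.
  move=> fS.
  have [Y hY] := image_ex (fun eta => ite (eta ∈ F) (movset A (app h eta)) emp) (pow S).
  have fY : fin (union Y).
    apply: fin_union; first by apply: (fin_image (fun eta => ite (eta ∈ F) (movset A (app h eta)) emp) (pow S)) => [|z /hY //]; apply: fin_pow.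
    move=> y /hY [eta [_ ->]]; case: (classic (eta ∈ F)) => he.
      by rewrite ite_true //; apply: ind_fin he.
    by rewrite ite_false //; apply: fin_emp.
  apply: (fin_le _ (pow (prod (num 5) (prod (pow (prod (union Y) (union Y))) k)))); last first.
    apply: fin_pow; apply: fin_prod; first by apply/nat_fin/nat_num.
    by apply: fin_prod => //; apply: fin_pow; apply: fin_prod.
  have hle : le (union Y) (union Y) by exact: le_refl_sub.
  apply: le_trans (labels_le (union Y) (union Y) fY hle); apply: le_refl_sub => Z.
  rewrite in_sep => -[hZ [hg hs]]; rewrite in_sep; split=> // i hi x.
  rewrite in_movset; first exact: img_perm.
  move=> hx; have [eta hr] := goodP Z i x hg hi hx.
  have he := rk_in F h _ _ hr.
  rewrite in_union; exists (movset A (app h eta)); split.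
    rewrite hY; exists eta; rewrite ite_true //; split=> //; rewrite in_pow -hs => a ha.
    by rewrite in_spread; exists i, x, eta.
  rewrite in_movset; first exact: ind_perm he.
  by case: hr => _ [].
Qed.

End Images.

#[global] Opaque spread.

(** * A diagonal set of labels *)

Section Diagonal.
Context {V : structure} {hZF : ZF V}.
Implicit Types (a b c g i j m p q s t u v w x y z Z S eta zeta xi : V).

(** An injective coding of pairs of a finite subset [S] of [m + 1] and a number [j] by finite
    subsets of [m], for infinite [m]: numbers in [S] become odd, [m] becomes 0, and the
    positive even numbers encode [j]. *)
Definition code m S j : V := sep m (fun b =>
  (b ∈ S /\ b ∉ omega) \/ (exists a, a ∈ S /\ a ∈ omega /\ b = succ (double a)) \/
  (m ∈ S /\ b = emp) \/ b = double (succ j)).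

#[export] Instance T3_code : T3 code.
Proof. rewrite /code; dsolve. Qed.

(** [missed S j]: no [Z] whose images stay inside the old support, with [spread] equal to [S],
    meets the codes of [S] exactly in that of [j]. Only finitely many [Z] compete, so some [j]
    is missed, and [zstar], which does meet the codes of [S] exactly so, is none of them. *)
Definition missed (A f m F h S j : V) : Prop := is_nat j /\
  ~ exists Z, Z ⊆ F /\ ~ badset A f F h Z /\ spread A f F h Z = S /\
      forall i, is_nat i -> (code m S i ∈ Z <-> i = j).

#[export] Instance D5_missed A f : D5 (missed A f).
Proof. rewrite /missed; dsolve. Qed.

Definition first_missed (A f m F h S j : V) : Prop :=
  missed A f m F h S j /\ forall i, i ∈ j -> ~ missed A f m F h S i.

#[export] Instance D5_first_missed A f : D5 (first_missed A f).
Proof. rewrite /first_missed; dsolve. Qed.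

Definition zstar (A f m F h : V) : V := sep F (fun eta => exists S j,
  fin S /\ S ⊆ succ m /\ first_missed A f m F h S j /\ eta = code m S j).

#[export] Instance T3_zstar A f : T3 (zstar A f).
Proof. rewrite /zstar; dsolve. Qed.

Lemma emp_succ x : emp <> succ x.
Proof. by move=> e; have : x ∈ emp by [rewrite e in_succ; right]; rewrite in_emp. Qed.

Section Code.
Variable m : V.
Hypothesis om : ord m.
Hypothesis infm : ~ is_nat m.

Let nat_m n : is_nat n -> n ∈ m.
Proof. by move=> hn; apply: omega_sub => //; apply/in_omega. Qed.

Lemma in_code S j b : S ⊆ succ m -> is_nat j -> b ∈ code m S j <->
  (b ∈ S /\ ~ is_nat b /\ b <> m) \/ (exists a, a ∈ S /\ is_nat a /\ b = succ (double a)) \/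
  (m ∈ S /\ b = emp) \/ b = double (succ j).
Proof.
  move=> hS hj; rewrite in_sep in_omega; split.
    move=> [hb [[h1 h2]|[[a [h1 [/in_omega h2 h3]]]|[|]]]]; auto.
      by left; split=> //; split=> // e; rewrite e in hb; apply: notin_self hb.
    by right; left; exists a.
  move=> [[h1 [h2 h3]]|[[a [h1 [h2 h3]]]|[[h1 h2]|h1]]].
  - by split; [move: (hS b h1); rewrite in_succ => -[]|left].
  - split; first by rewrite h3; apply/nat_m/nat_succ/nat_double.
    by right; left; exists a; rewrite in_omega.
  - by split; [rewrite h2; apply/nat_m/nat_emp|right; right; left].
  - by split; [rewrite h1; apply/nat_m/nat_double/nat_succ|right; right; right].
Qed.

Lemma code_inj S j S' j' : S ⊆ succ m -> S' ⊆ succ m -> is_nat j -> is_nat j' ->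
  code m S j = code m S' j' -> S = S' /\ j = j'.
Proof.
  move=> hS hS' hj hj' e; split.
  - have sub T i T' i' : T ⊆ succ m -> T' ⊆ succ m -> is_nat i -> is_nat i' ->
        code m T i = code m T' i' -> T ⊆ T'.
    { move=> hT hT' hi hi' eT a ha.
      case: (classic (is_nat a)) => na; [|case: (classic (a = m)) => am].
      + have : succ (double a) ∈ code m T' i' by rewrite -eT in_code //; right; left; exists a.
        rewrite in_code // => -[[_ [k _]]|[[b [hb [nb /succ_inj/double_inj k]]]|[[_ k]|k]]].
        * by case: k; apply/nat_succ/nat_double.
        * by rewrite k.
        * by case: (emp_succ (double a)).
        * by case: (double_odd (succ i') a) => //; apply: nat_succ.
      + subst a; have : emp ∈ code m T' i' by rewrite -eT in_code //; right; right; left.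
        rewrite in_code // => -[[_ [k _]]|[[b [hb [nb k]]]|[[]//|k]]].
        * by case: k; apply: nat_emp.
        * by case: (emp_succ (double b)).
        * by rewrite doubleS // in k; case: (emp_succ (succ (double i'))).
      + have : a ∈ code m T' i' by rewrite -eT in_code //; left.
        rewrite in_code // => -[[]//|[[b [hb [nb k]]]|[[_ k]|k]]]; case: na; rewrite k.
        * by apply/nat_succ/nat_double.
        * exact: nat_emp.
        * by apply/nat_double/nat_succ. }
    apply: sub_antisym; [exact: sub e | exact: (sub S' j' S j)].
  - have : double (succ j) ∈ code m S' j' by rewrite -e in_code //; right; right; right.
    rewrite in_code // => -[[_ [k _]]|[[b [hb [nb k]]]|[[_ k]|k]]].
    + by case: k; apply/nat_double/nat_succ.
    + by case: (double_odd (succ j) b) => //; apply: nat_succ.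
    + by rewrite doubleS // in k; case: (emp_succ (succ (double j))).
    + by apply/succ_inj/double_inj => //; apply: nat_succ.
Qed.

Lemma code_fin S j : fin S -> S ⊆ succ m -> is_nat j -> fin (code m S j).
Proof.
  move=> fS hS hj; have [y hy] := image_ex (fun a => succ (double a)) S.
  apply: (fin_sub (add (add (cup S y) emp) (double (succ j)))).
    do 2 apply: fin_add; apply: fin_cup => //.
    by apply: (fin_image (fun a => succ (double a)) S) => // z /hy.
  move=> b; rewrite in_code // !in_add in_cup hy => -[[]|[[a [h1 [_ h2]]]|[[]|]]]; auto.
  by left; left; right; exists a.
Qed.

End Code.

Variables (A N k f Pm : V).
Hypothesis fN : fin N.
Hypothesis fk : fin k.
Hypothesis in_Pm : forall t, t ∈ Pm <-> permutations A t.
Hypothesis f_perm : forall t, permutations A t -> permutations A (app f t).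
Hypothesis f_mov : forall t, permutations A t -> le (movset A (app f t)) N.
Hypothesis f_fib : forall s, le (sep Pm (fun t => app f t = s)) k.
Variables (F h m : V).
Hypothesis hI : independent A F h.
Hypothesis om : ord m.
Hypothesis infm : ~ is_nat m.
Hypothesis F_sub : forall eta, eta ∈ F -> eta ⊆ succ m.
Hypothesis F_fin : forall eta, fin eta -> eta ⊆ m -> eta ∈ F.

(** If no [j] were missed, sending each competing [Z] to the only [j] whose code it meets would map
    a finite set onto [omega]. *)
Lemma first_missed_ex S : fin S -> S ⊆ succ m -> exists j, first_missed A f m F h S j.
Proof.
  move=> fS hS.
  have [j hj] : exists j, missed A f m F h S j.
    apply: NNPP => hn; apply: omega_not_fin.
    pose proof (spread_fibers_fin A k f Pm fk in_Pm f_perm f_fib F h hI S fS) as fZ.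
    apply: (fin_image (fun Z => the (fun j => is_nat j /\
      forall i, is_nat i -> (code m S i ∈ Z <-> i = j))) _ _ fZ) => j /in_omega hj.
    have [Z [hZ [gZ [sZ cZ]]]] : exists Z, Z ⊆ F /\ ~ badset A f F h Z /\
        spread A f F h Z = S /\ forall i, is_nat i -> (code m S i ∈ Z <-> i = j).
      by apply: NNPP => hZ; apply: hn; exists j.
    exists Z; rewrite in_sep in_pow; split=> //; symmetry; apply: the_eq => // j' [hj' cZ'].
    by apply/(cZ j' hj'); apply/(cZ' j' hj').
  have oj : ord j by apply: nat_ord; case: hj.
  have [j0 [oj0 [hj0 hmin]]] := ord_min (missed A f m F h S) j oj hj.
  by exists j0.
Qed.

Lemma first_missed_unique S j j' :
  first_missed A f m F h S j -> first_missed A f m F h S j' -> j = j'.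
Proof.
  move=> [h1 h2] [k1 k2].
  have oj : ord j by apply: nat_ord; case: h1.
  have oj' : ord j' by apply: nat_ord; case: k1.
  by case: (ord_trichotomy j j' oj oj') => [/k2|[//|/h2]].
Qed.

Lemma infinite_stage : badset A f F h (zstar A f m F h).
Proof.
  apply: NNPP => hg; set Z := zstar A f m F h in hg.
  have hZF' : Z ⊆ F by move=> z; rewrite in_sep => -[].
  pose (S := spread A f F h Z).
  have fS : fin S by exact: (spread_fin A N f fN f_perm f_mov F h hI).
  have hS : S ⊆ succ m.
    by move=> a /in_spread [i [x [eta [_ [_ [hr ha]]]]]]; apply: (F_sub eta) => //; apply: rk_in hr.
  have [j hj] := first_missed_ex S fS hS.
  have [[nj hn] _] := hj; apply: hn; exists Z; do 3 split=> //.
  - move=> i hi; split=> [|->].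
      rewrite in_sep => -[_ [S' [j' [fS' [hS' [hj' e]]]]]].
      have nj' : is_nat j' by case: hj' => -[].
      have [eS ej] := code_inj m om infm S i S' j' hS hS' hi nj' e; subst S' j'.
      exact: first_missed_unique hj' hj.
    rewrite in_sep; split; last by exists S, j.
    apply: F_fin; first exact: code_fin.
    by move=> b; rewrite in_sep => -[].
Qed.

End Diagonal.

#[global] Opaque code zstar.

(** * Transpositions *)

Section Transpositions.
Context {V : structure} {hZF : ZF V}.
Implicit Types (A N a b g m s x y z eta : V).

Definition swap A a b : V := sep (prod A A) (fun p => exists x y, p = pr x y /\
  ((x = a /\ y = b) \/ (x = b /\ y = a) \/ (x <> a /\ x <> b /\ y = x))).

#[export] Instance T2_swap A : T2 (swap A).
Proof. rewrite /swap; dsolve. Qed.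

Lemma swap_maps A a b x y : maps (swap A a b) x y <-> x ∈ A /\ y ∈ A /\
  ((x = a /\ y = b) \/ (x = b /\ y = a) \/ (x <> a /\ x <> b /\ y = x)).
Proof.
  rewrite mapsE in_sep pr_in_prod; split=> [[[hx hy]] [x' [y' [/pr_inj [<- <-] hh]]]|[hx [hy hh]]] //.
  by split=> //; exists x, y.
Qed.

Lemma swap_perm A a b : a ∈ A -> b ∈ A -> permutations A (swap A a b).
Proof.
  move=> ha hb.
  have tot x : x ∈ A -> exists y, y ∈ A /\
      ((x = a /\ y = b) \/ (x = b /\ y = a) \/ (x <> a /\ x <> b /\ y = x)).
    move=> hx; case: (classic (x = a)) => e; first by exists b; auto.
    by case: (classic (x = b)) => e'; [exists a | exists x]; tauto.
  apply: perm_intro.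
  - by move=> p; rewrite in_sep => -[].
  - by move=> x hx; have [y [hy hh]] := tot x hx; exists y; rewrite swap_maps.
  - by move=> x y y'; rewrite !swap_maps; intuition congruence.
  - by move=> x x' y; rewrite !swap_maps; intuition congruence.
  - move=> y hy; have [x [hx hh]] := tot y hy; exists x; rewrite swap_maps.
    by intuition congruence.
Qed.

Lemma swap_mv A a b x : a ∈ A -> b ∈ A -> a <> b -> mv (swap A a b) x <-> x = a \/ x = b.
Proof.
  move=> ha hb ne; split=> [[y [/swap_maps hh ney]]|hx]; first by tauto.
  by case: hx => ->; [exists b | exists a]; rewrite swap_maps; intuition congruence.
Qed.

(** All the transpositions share the point [app g (pow m)], while the other point of each is private
    to its index. The additional element of [add (pow m) (pow m)] stands for the shared point. *)
Lemma independent_swaps A N m : is_infinite A -> fin m -> le (num 2) N ->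
  exists s0, forall eta, eta ∈ pow m -> permutations A (app s0 eta) /\
    le (movset A (app s0 eta)) N /\ exists x, mv (app s0 eta) x /\
    forall zeta, zeta ∈ pow m -> zeta <> eta -> ~ mv (app s0 zeta) x.
Proof.
  move=> hA fm hN.
  have /le_elim [g [g1 g2]] : le (add (pow m) (pow m)) A.
    by apply: le_infinite => //; apply/fin_add/fin_pow.
  have [s0 hs0] := fun_rep (pow m) (fun eta => swap A (app g eta) (app g (pow m))).
  have inD z : z ∈ pow m -> z ∈ add (pow m) (pow m) by rewrite in_add; left.
  have topD : pow m ∈ add (pow m) (pow m) by rewrite in_add; right.
  have ne z : z ∈ pow m -> app g z <> app g (pow m).
    move=> hz /g2 e; apply: (notin_self (pow m)); rewrite -{1}e; auto.
  exists s0 => eta he; rewrite hs0 //.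
  have hp : permutations A (swap A (app g eta) (app g (pow m))) by apply: swap_perm; auto.
  split=> //; split.
  { apply: le_trans hN.
    apply: (le_intro _ _ (fun x => ite (x = app g eta) (num 0) (num 1))).
      move=> x _; rewrite num_in2; case: (classic (x = app g eta)) => e.
        by rewrite ite_true //; left.
      by rewrite ite_false //; right.
    move=> x y; rewrite !in_movset // !swap_mv; auto.
    case: (classic (x = app g eta)) => e; case: (classic (y = app g eta)) => e'.
    - by rewrite e e'.
    - by rewrite ite_true // ite_false // => _ _ /num01.
    - by rewrite ite_false // ite_true // => _ _ k; case: num01.
    - by move=> [|->] // [|->]. }
  exists (app g eta); split; first by rewrite swap_mv; auto.
  move=> zeta hz nez; rewrite hs0 // swap_mv; auto.
  by move=> [/g2 e|/ne]; auto; apply: nez; symmetry; auto.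
Qed.

End Transpositions.

(** * The transfinite construction *)

Section Construction.
Context {V : structure} {hZF : ZF V}.
Implicit Types (a b c g i j m p q s t u v w x y z Z S eta zeta xi : V).

#[local] Instance D2_fltL : D2 (V := V) (flt ltL).
Proof. exact: D2_flt. Qed.

Definition fbad (A f F h Z : V) : Prop := Z ⊆ F /\ fin Z /\ badset A f F h Z.

#[local] Instance D3_fbad A f : D3 (fbad A f).
Proof. rewrite /fbad; dsolve. Qed.

Definition top xi : V := the (fun m => m ∈ xi /\ forall b, b ∈ xi -> b = m \/ b ∈ m).

#[local] Instance T1_top : T1 top.
Proof. rewrite /top; dsolve. Qed.

(** [flt ltL] provides least elements among finite sets only, so a finite bad set has priority and
    [zstar] is the fallback. The definition does not ask whether [F] is finite. *)
Definition chosen (A f xi F h Z : V) : Prop :=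
  (fbad A f F h Z /\ forall Z', fbad A f F h Z' -> ~ flt ltL Z' Z) \/
  ((~ exists Z', fbad A f F h Z') /\ Z = zstar A f (top xi) F h).

#[local] Instance D4_chosen A f : D4 (chosen A f).
Proof. rewrite /chosen; dsolve. Qed.

Definition step (A f m0 s0 xi h : V) : V := the (fun y =>
  (xi ⊆ m0 /\ y = app s0 xi) \/
  (~ xi ⊆ m0 /\ exists Z i, chosen A f xi (segL xi) h Z /\ i ∈ num 5 /\
     bad A f (segL xi) h Z i /\ (forall j, j ∈ i -> ~ bad A f (segL xi) h Z j) /\
     y = img A f (segL xi) h i Z)).

#[local] Instance T2_step A f m0 s0 : T2 (step A f m0 s0).
Proof. rewrite /step; dsolve. Qed.

Lemma top_spec xi : L xi -> xi <> emp ->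
  top xi ∈ xi /\ forall b, b ∈ xi -> b = top xi \/ b ∈ top xi.
Proof.
  move=> hL hne; have [m [hm bm]] := finset_max xi hL hne.
  rewrite /top (the_eq _ m) // => z [hz bz].
  case: (bm z hz) => // zm; case: (bz m hm) => // mz.
  by case: (no_two_cycle _ _ zm).
Qed.

(** This and [seg_full] provide the hypotheses on [F] in [finite_stage] and [infinite_stage], with
    [top xi] as [m]. *)
Lemma seg_bound xi eta : L xi -> xi <> emp -> eta ∈ segL xi -> eta ⊆ succ (top xi).
Proof.
  move=> hL hne; rewrite wo_seg // => -[[_ he] [a [ha [_ hlt]]]] b hb.
  have [tx bx] := top_spec xi hL hne; have ox := proj2 hL.
  have ob := he b hb; have ot := ox _ tx.
  rewrite in_succ; case: (ord_trichotomy b (top xi) ob ot) => [|[|tb]]; auto.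
  have ab : a ∈ b by case: (bx a ha) => [->//|h]; apply: ord_trans ob h tb.
  have /bx : b ∈ xi by apply/(hlt b ab).
  by tauto.
Qed.

Lemma seg_full xi eta : L xi -> xi <> emp -> fin eta -> eta ⊆ top xi -> eta ∈ segL xi.
Proof.
  move=> hL hne fe he; have [tx bx] := top_spec xi hL hne; have ox := proj2 hL.
  rewrite wo_seg //; split; first by split=> // a /he; apply: ord_in (ox _ tx).
  exists (top xi); split=> //; split; first by move=> /he; apply: notin_self.
  move=> b tb; split=> [/he bt|/bx [e|bt]].
  - by case: (no_two_cycle _ _ bt).
  - by rewrite e in tb; case: (notin_self _ tb).
  - by case: (no_two_cycle _ _ bt).
Qed.

Variables (A N k f Pm : V).
Hypothesis infA : is_infinite A.
Hypothesis fN : fin N.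
Hypothesis N2 : le (num 2) N.
Hypothesis fk : fin k.
Hypothesis in_Pm : forall t, t ∈ Pm <-> permutations A t.
Hypothesis f_perm : forall t, permutations A t -> permutations A (app f t).
Hypothesis f_mov : forall t, permutations A t -> le (movset A (app f t)) N.
Hypothesis f_fib : forall s, le (sep Pm (fun t => app f t = s)) k.

Definition extends (q : V -> V) xi : Prop := q xi ∈ Pm /\ le (movset A (q xi)) N /\
  exists x, mv (q xi) x /\ forall eta, eta ∈ segL xi -> ~ mv (q eta) x.

Lemma chosen_unique xi F h Z Z' : (forall eta, eta ∈ F -> L eta) ->
  chosen A f xi F h Z -> chosen A f xi F h Z' -> Z = Z'.
Proof.
  move=> FL [[b1 m1]|[n1 ->]] [[b2 m2]|[n2 ->]] //.
  - have H U : fbad A f F h U -> finset L U by move=> [hU [fU _]]; split=> // a /hU /FL.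
    by case: (wo_total (M := finset L) (lt := flt ltL) Z Z' (H _ b1) (H _ b2)) => [/(m2 _ b1)|[//|/(m1 _ b2)]].
  - by case: n2; exists Z.
  - by case: n1; exists Z'.
Qed.

Lemma chosen_bad m0 xi h : is_nat m0 ->
  (forall m, is_nat m -> m0 ⊆ m ->
  ~ le (pow (pow m)) (prod (pow (prod (prod (num 5) N) (succ m)))
      (pow (prod (num 5) (prod (pow (prod (prod (prod (num 5) N) N) (prod (prod (num 5) N) N))) k))))) ->
  L xi -> ~ xi ⊆ m0 -> independent A (segL xi) h ->
  (forall eta, eta ∈ segL xi -> le (movset A (app h eta)) N) ->
  exists Z, chosen A f xi (segL xi) h Z /\ Z ⊆ segL xi /\ badset A f (segL xi) h Z.
Proof.
  move=> nm0 hm0 hL hxi hI hN.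
  have hne : xi <> emp by move=> e; apply: hxi => z; rewrite e => /in_emp.
  have [tx bx] := top_spec xi hL hne.
  have ot : ord (top xi) by apply: (proj2 hL).
  have om0 : ord m0 by apply: nat_ord.
  (* Some element of [xi] is outside [m0], so the largest one is at least [m0] and the growth bound
     applies there. *)
  have m0t : m0 ⊆ top xi.
    case: (ord_trichotomy m0 (top xi) om0 ot) => [h1|[->//|h1]].
      by move=> z hz; apply: ord_trans ot hz h1.
    case: hxi => z /bx [->//|zt]; exact: ord_trans om0 zt h1.
  case: (classic (exists Z, fbad A f (segL xi) h Z)) => [[Z0 hZ0]|hn].
  { have [||Z []] := wo_wf (M := finset L) (lt := flt ltL) (sep (pow (segL xi)) (fbad A f (segL xi) h)).
    - move=> Z; rewrite in_sep in_pow => -[hZ [_ [fZ _]]]; split=> // a /hZ.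
      exact: (ind_L _ _ _ hI).
    - by exists Z0; rewrite in_sep in_pow; split=> //; case: hZ0.
    - rewrite in_sep in_pow => -[hZ bZ] hmin; exists Z; split; last by split=> //; case: bZ => _ [].
      left; split=> // Z' bZ'; apply: hmin; rewrite in_sep in_pow; split=> //; by case: bZ'. }
  exists (zstar A f (top xi) (segL xi) h); split; first by right.
  split; first by move=> z; rewrite in_sep => -[].
  (* For a natural [top xi] the segment is finite, so the bad set found by counting is finite,
     against [hn]. *)
  case: (classic (is_nat (top xi))) => ht.
  { case: hn.
    have fF : fin (segL xi).
      apply: (fin_sub (pow (succ (top xi)))); first by apply/fin_pow/nat_fin/nat_succ.
      by move=> eta /(seg_bound xi eta hL hne); rewrite in_pow.
    have [eta /(seg_bound xi eta hL hne)|eta|Z [hZ bZ]] :=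
      finite_stage A N k f Pm fN in_Pm f_perm f_mov f_fib (segL xi) h hI hN (top xi) ht _ _
        (hm0 _ ht m0t).
    - by rewrite in_pow.
    - rewrite in_pow => he; apply: seg_full => //; apply: fin_sub he; exact: nat_fin.
    - by exists Z; split=> //; split=> //; apply: fin_sub fF hZ. }
  apply: (infinite_stage A N k f Pm) => //.
  - by move=> eta; apply: seg_bound.
  - by move=> eta; apply: seg_full.
Qed.

Lemma independent_sequence : exists q : V -> V, T1 q /\ forall xi, L xi -> extends q xi.
Proof.
  have f5N : fin (prod (num 5) N) by apply: fin_prod => //; apply/nat_fin/nat_num.
  have fb : fin (prod (num 5) (prod (pow (prod (prod (prod (num 5) N) N)
      (prod (prod (num 5) N) N))) k)).
    apply: fin_prod; first by apply/nat_fin/nat_num.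
    by apply: fin_prod => //; apply/fin_pow/fin_prod; apply: fin_prod.
  (* From [m0] on, the double power set of [m] exceeds the number of codes in [finite_stage]; the
     indices contained in [m0] are served by transpositions instead. *)
  have [m0 [nm0 hm0]] := growth_bound _ _ f5N fb.
  have om0 : ord m0 by apply: nat_ord.
  have [s0 hs0] := independent_swaps A N m0 infA (nat_fin _ nm0) N2.
  pose (q := wo_rec (seg := segL) (step A f m0 s0)).
  have dq : T1 q by exact: T1_wo_rec.
  exists q; split=> //.
  have dE : D1 (extends q) by rewrite /extends; dsolve.
  apply: wo_ind => xi hL IH.
  pose (h := history (seg := segL) (step A f m0 s0) xi).
  have hq : q xi = step A f m0 s0 xi h by exact: wo_recE.
  have hh eta : eta ∈ segL xi -> app h eta = q eta by exact: app_history.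
  have IH' eta : eta ∈ segL xi -> extends q eta.
    by move=> he; move: (he); rewrite wo_seg // => -[h1 h2]; apply: IH.
  have segtr eta zeta : eta ∈ segL xi -> zeta ∈ segL xi -> ltL zeta eta -> zeta ∈ segL eta.
    by rewrite wo_seg // => -[h1 _] /(wo_seg xi hL) [h2 _] lt_; rewrite wo_seg.
  have hI : independent A (segL xi) h.
  { split=> eta he; rewrite ?hh //; have [h1 [h2 [x [h3 h4]]]] := IH' eta he.
    - by move: he; rewrite wo_seg // => -[].
    - by rewrite -in_Pm.
    - exact: fin_le h2 fN.
    - exists x; split=> //; split; first by rewrite hh.
      by move=> zeta hz lt_; rewrite hh //; apply: h4; apply: segtr. }
  have hN eta : eta ∈ segL xi -> le (movset A (app h eta)) N.
    by move=> he; rewrite hh //; have [_ []] := IH' eta he.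
  case: (classic (xi ⊆ m0)) => hxi.
    have e : q xi = app s0 xi.
      by rewrite hq; apply: the_eq => [|z [[]|[]]] //; left.
    have xm : xi ∈ pow m0 by rewrite in_pow.
    have [h1 [h2 [x [h3 h4]]]] := hs0 xi xm.
    rewrite /extends e in_Pm; split=> //; split=> //; exists x; split=> // eta he.
    (* The subsets of [m0] are closed under predecessors, so all earlier stages are transpositions
       as well. *)
    have em : eta ⊆ m0.
      case: (classic (xi = emp)) => [ex|hne].
        by move: he; rewrite wo_seg // => -[_ [a []]]; rewrite ex in_emp.
      have [tx bx] := top_spec xi hL hne.
      move=> b /(seg_bound xi eta hL hne he b); rewrite in_succ => -[bt|->]; last exact: hxi.
      exact: ord_trans om0 bt (hxi _ tx).
    have -> : q eta = app s0 eta.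
      by apply: the_eq => [|z [[]|[]]] //; left.
    apply: h4; first by rewrite in_pow.
    by move=> ee; move: he; rewrite wo_seg // ee => -[_ /wo_irr].
  have [Z [cZ [sZ [i0 [hi0 bi0]]]]] := chosen_bad m0 xi h nm0 hm0 hL hxi hI hN.
  have onum i : i ∈ num 5 -> ord i by move=> /(nat_in _ _ (nat_num 5))/nat_ord.
  have [i [oi [[hi bi] mi]]] := ord_min (fun i => i ∈ num 5 /\ bad A f (segL xi) h Z i)
    i0 (onum _ hi0) (conj hi0 bi0).
  have {}mi j : j ∈ i -> ~ bad A f (segL xi) h Z j.
    move=> ji bj; apply: (mi j ji); split=> //.
    exact: ord_trans (nat_ord _ (nat_num 5)) ji hi.
  have e : q xi = img A f (segL xi) h i Z.
    rewrite hq; apply: the_eq; first by right; split=> //; exists Z, i.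
    move=> z [[]//|[_ [Z' [i' [cZ' [hi' [bi' [mi' ->]]]]]]]].
    have eZ : Z' = Z by apply: (chosen_unique xi (segL xi) h) => //; apply: ind_L hI.
    subst Z'; case: (ord_trichotomy i' i (onum _ hi') oi) => [/mi|[->|/mi']] //.
  rewrite /extends e in_Pm; split; first exact: (img_perm A f f_perm _ _ hI).
  split; first exact: (img_mov A N f f_mov _ _ hI).
  have [x [hx nx]] := bi; exists x; split=> // eta he hmv; apply: nx.
  have [zeta [hz _]] := rk_ex A (segL xi) h hI eta x he ltac:(by rewrite hh).
  by exists zeta.
Qed.

(** Restricted to singletons, the sequence injects the ordinals into the set [Pm]; replacement along
    the inverse then makes all ordinals the elements of one set. *)
Lemma no_bounded_map : False.
Proof.
  have [q [dq hq]] := independent_sequence.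
  have q_inj xi eta : L xi -> L eta -> q xi = q eta -> xi = eta.
    have H u v : L u -> L v -> ltL u v -> q u <> q v.
      move=> hu hv lt_ e; have [_ [_ [x [h1 h2]]]] := hq v hv.
      by apply: (h2 u); [rewrite wo_seg | rewrite e].
    move=> h1 h2 e; case: (wo_total xi eta h1 h2) => [l|[//|l]].
      by case: (H xi eta).
    by case: (H eta xi).
  have Ls a : ord a -> L (sing a).
    move=> oa; split; last by move=> b /in_sing ->.
    by apply: (fin_sub (add emp a)); [apply/fin_add/fin_emp|move=> b; rewrite in_sing in_add; right].
  have [s a a' _ [oa ->] [oa' e]|O hO] := repl_ex Pm (fun s a => ord a /\ s = q (sing a)).
    by apply: sing_inj; apply: q_inj; auto.
  apply: (ord_not_set O) => a oa; rewrite hO; exists (q (sing a)); split=> //.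
  by have [] := hq _ (Ls a oa).
Qed.

End Construction.

Theorem theorem3p1 (V : structure) (hZF : ZF V) (A n : V)
    (hA : is_infinite A) (hn : is_nat n) :
  ~ exists f : V,
      is_function f (permutations A) (permutations_le n A) /\
      boundedly_finite_to_one f.
Proof.
  move=> [f [[f1 f2] [k [hk fib]]]].
  have [Pm in_Pm] := permutations_form_a_set V hZF A.
  have f_app t : permutations A t -> maps f t (app f t).
    by move=> ht; apply: (the_spec (fun y => maps f t y)); apply: f2.
  have f_le t : permutations A t -> permutations_le n A (app f t).
    move=> /f_app [p [/is_opairE -> /f1 [x [y [_ [hy]]]]]].
    by move=> /is_opairE /pr_inj [_ ->].
  (* The bound [n + 2] covers both the values of [f], which move at most [n] points, and the
     transpositions, which move two. *)
  have fN : fin (succ (succ n)) by apply/nat_fin/nat_succ/nat_succ.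
  apply: (no_bounded_map A (succ (succ n)) k f Pm) => //.
  - apply: (le_intro _ _ (fun x => ite (x = num 0) n (succ n))).
      move=> x _; case: (classic (x = num 0)) => e; [rewrite ite_true // | rewrite ite_false //];
        rewrite !in_succ; auto.
    have ne : n <> succ n by move=> e; apply: (notin_self n); rewrite {2}e in_succ; right.
    move=> x y /num_in2 [->|->] /num_in2 [->|->] //.
    + by rewrite ite_true // ite_false // => /num_inj.
    + by rewrite ite_false ?ite_true // => [/num_inj|/(@eq_sym _ _ _)].
  - exact: nat_fin.
  - by move=> t /f_le [].
  - move=> t ht; have [hp hc] := f_le t ht.
    have hset x : x ∈ movset A (app f t) <-> mov A (app f t) x.
      by rewrite in_movset // (mv_mov A).
    apply: (le_trans _ n); first by apply/(card_le_set _ _ _ hset).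
    by apply: le_refl_sub => z hz; rewrite !in_succ; auto.
  - move=> s; have [g [g1 g2]] := card_le_elim _ _ (fib s).
    have hm t : t ∈ sep Pm (fun t => app f t = s) -> maps f t s.
      by rewrite in_sep in_Pm => -[/f_app ht <-].
    by apply: (le_intro _ _ (app g)) => [t /hm|t u /hm ht /hm hu]; auto.
Qed.
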